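(* Let $\lambda>0$ and let $f\in BMO_{\mathrm{o}}(\mathbb{R})$ be such that $f=0$ on $(a,\infty)$ for some $a>0$. Then there exist $g\in L^\infty(0,\infty)$ and a Carleson measure $\mu$ on $(0,\infty)\times(0,\infty)$ such that $f=g+S_{\mu,W^\lambda}$ and $$\|g\|_{L^\infty(0,\infty)}+\|\mu\|_{\mathcal{C}}\le C\|f\|_{BMO_{\mathrm{o}}(\mathbb{R})},$$ where $C>0$ does not depend on $f$.
   Context: For $\lambda>0$, the heat kernel associated with the Bessel operator $B_\lambda:=-x^{-\lambda}\frac{d}{dx}x^{2\lambda}\frac{d}{dx}x^{-\lambda}$ on $(0,\infty)$ is $$W_t^\lambda(x,y):=\frac{\sqrt{xy}}{2t}\,I_{\lambda-1/2}\Big(\frac{xy}{2t}\Big)e^{-(x^2+y^2)/(4t)},\quad x,y,t\in(0,\infty),$$ where $I_\nu$ is the modified Bessel function of the first kind and order $\nu$. For a Borel measure $\mu$ on $(0,\infty)\times(0,\infty)$, the balayage of $\mu$ with respect to $\{W_t^\lambda\}_{t>0}$ is $$S_{\mu,W^\lambda}(x):=\int_0^\infty\int_0^\infty W_t^\lambda(x,y)\,d\mu(y,t),\quad x\in(0,\infty).$$ The space $BMO_{\mathrm{o}}(\mathbb{R})$ consists of the functions $f$ on $(0,\infty)$ with $f\in L^1(0,a)$ for every $a>0$, for which there exists $C>0$ such that: (a) for every bounded interval $I\subset(0,\infty)$, $\frac{1}{|I|}\int_I|f(y)-f_I|\,dy\le C$, where $f_I:=\frac1{|I|}\int_I f(y)\,dy$;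 and (b) for every $a\in(0,\infty)$, $\frac1a\int_0^a|f(y)|\,dy\le C$. The norm $\|f\|_{BMO_{\mathrm{o}}(\mathbb{R})}$ is the infimum of all $C>0$ for which (a) and (b) hold. Functions are identified when equal almost everywhere. A Borel measure $\mu$ on $(0,\infty)\times(0,\infty)$ (not necessarily positive), with total variation measure $|\mu|$, is a Carleson measure on $(0,\infty)\times(0,\infty)$ if $$\|\mu\|_{\mathcal{C}}:=\sup_I\frac{|\mu|(\widehat I)}{|I|}<\infty,$$ where the supremum is over all bounded intervals $I\subset(0,\infty)$, $|I|$ is the length of $I$, and $\widehat I:=I\times(0,|I|)$. *)

(* Defs.v *)
From HB Require Import structures.
From mathcomp Require Import all_boot all_order all_algebra.
From mathcomp Require Import all_classical all_reals all_analysis.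

Set Implicit Arguments.
Unset Strict Implicit.
Unset Printing Implicit Defensive.

Import Order.TTheory GRing.Theory Num.Theory.
Import numFieldNormedType.Exports.

Local Open Scope classical_set_scope.
Local Open Scope ring_scope.

(* Functions on (0,oo) are represented by functions R -> R; their values
   outside (0,oo) are never consulted. *)

Section bessel_heat_kernel.
Context {R : realType}.
Implicit Types (s nu z lambda t x y : R).

(* Meaningful (convergent integral) for s > 0 only; [besselI] below uses it at
   k + nu + 1, which is positive for every k when nu > -1. *)
Definition Gamma s : R :=
  \int[lebesgue_measure]_(t in `]0%R, +oo[) (t `^ (s - 1) * expR (- t)).

(* Modified Bessel function of the first kind, for nu > -1 and z > 0:
   the sum over k of (z/2)^(2k+nu) / (k! Gamma(k+nu+1)). *)
Definition besselI_coeff nu z : R^nat := fun k =>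
  (z / 2) `^ ((2 * k)%:R + nu) / (k`!%:R * Gamma (k%:R + nu + 1)).

Definition besselI nu z : R := limn (series (besselI_coeff nu z)).

Definition heat_kernel lambda t x y : R :=
  Num.sqrt (x * y) / (2 * t) * besselI (lambda - 2^-1) (x * y / (2 * t)) *
  expR (- (x ^+ 2 + y ^+ 2) / (4 * t)).

End bessel_heat_kernel.

(* Degenerate intervals (empty or a single point) are excluded, since one
   divides by the length. *)
Definition bounded_interval {R : realType} (I : set R) : Prop :=
  [/\ is_interval I, bounded_set I, I `<=` `]0, +oo[ &
      (0 < lebesgue_measure I)%E].

Definition len {R : realType} (I : set R) : R := fine (lebesgue_measure I).

Section bmo.
Context {R : realType}.
Implicit Types (f : R -> R) (I : set R) (C : R).
Local Notation leb := (@lebesgue_measure R).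

Definition mean f I : R := (len I)^-1 * \int[leb]_(y in I) f y.

Definition bmo_bound f C : Prop :=
  (forall I, bounded_interval I ->
     (len I)^-1 * \int[leb]_(y in I) `|f y - mean f I| <= C) /\
  (forall a : R, 0 < a -> a^-1 * \int[leb]_(y in `]0%R, a[) `|f y| <= C).

Definition BMOo f : Prop :=
  (forall a : R, 0 < a -> leb.-integrable `]0%R, a[ (EFin \o f)) /\
  (exists2 C, 0 < C & bmo_bound f C).

Definition BMOo_norm f : R := inf [set C | 0 < C /\ bmo_bound f C].

Definition Linfty_norm (g : R -> R) : \bar R :=
  ('N[mrestr leb (measurable_itv `]0%R, +oo[)]_+oo [EFin \o g])%E.

Definition Linfty (g : R -> R) : Prop :=
  measurable_fun (`]0%R, +oo[ : set R) g /\ (Linfty_norm g < +oo)%E.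

End bmo.

Definition quadrant {R : realType} : set (R * R) :=
  `]0%R, +oo[ `*` `]0%R, +oo[.

(* A real, not necessarily positive Borel measure mu on (0,oo) x (0,oo), given
   by its Jordan decomposition mu = pos_part - neg_part. A Carleson measure
   need only have finite variation on bounded sets, so both parts may have
   infinite total mass; this is why the library's charges, which are finite,
   are not used. *)
Record signed_measure (R : realType) := SignedMeasure {
  pos_part : {measure set (R * R) -> \bar R} ;
  neg_part : {measure set (R * R) -> \bar R} ;
  pos_part_quadrant : pos_part (~` quadrant) = 0%E ;
  neg_part_quadrant : neg_part (~` quadrant) = 0%E ;
  mutually_singular : exists P : set (R * R),
    [/\ measurable P, pos_part (~` P) = 0%E & neg_part P = 0%E]
}.

Section carleson.
Context {R : realType}.
Implicit Types (mu : signed_measure R) (lambda x : R).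

Definition abs_measure mu : {measure set (R * R) -> \bar R} :=
  measure_add (pos_part mu) (neg_part mu).

Definition carleson_box (I : set R) : set (R * R) := I `*` `]0%R, len I[.

Definition carleson_norm mu : \bar R :=
  ereal_sup [set (abs_measure mu (carleson_box I) * (len I)^-1%:E)%E |
             I in @bounded_interval R].

Definition carleson_measure mu : Prop := (carleson_norm mu < +oo)%E.

(* Points of the quadrant are pairs p = (y, t). *)
Definition balayage_kernel lambda x (p : R * R) : R :=
  heat_kernel lambda p.2 x p.1.

Definition balayage_converges lambda mu x : Prop :=
  (abs_measure mu).-integrable quadrant (EFin \o balayage_kernel lambda x).

(* Only meaningful where [balayage_converges] holds. *)
Definition balayage lambda mu x : R :=
  \int[pos_part mu]_(p in quadrant) balayage_kernel lambda x p -
  \int[neg_part mu]_(p in quadrant) balayage_kernel lambda x p.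

End carleson.

(* Submission.v *)
(* It suffices to find mu = sum_k b_k(y) dy x delta_(t_k) with sum_k |b_k| <= B, since the
   Carleson norm of such a measure is at most B.

   Extended by 0 to the negative half-line, f becomes a function on R with bounded
   oscillation at scales at most r, a fixed multiple of the size of its support. On a grid
   of dyadic cells, follow the cell averages of f lazily, jumping to the current average only
   when it has drifted away by more than a constant: the jumps add up to f minus a bounded
   function, and by the John-Nirenberg argument the number of jumps has exponentially small
   tails, so that all but a small part of them has a bounded absolute sum. Averaged over
   finitely many translated grids, the jumps of generation k vary little at the scale
   sigma_k = eta^2 r 2^-k, hence are close to their Gaussian convolutions at that scale. For
   eta small the error has half the oscillation of f, and iterating gives
   f = g + sum_k G_(sigma_k) beta_k, with g and sum_k |beta_k| bounded.

   The heat kernel at time sigma^2 / 2 is a (G_sigma(x - y) - G_sigma(x + y)) up to an error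
   whose integrals in y are summable over the scales sigma_k, uniformly in x; this follows
   from the asymptotics of the Bessel function, read off the Riccati equation of its
   logarithmic derivative. Since f vanishes on the negative half-line, f(x) = f(x) - f(-x)
   for x > 0, and one takes b_k(y) = (beta_k(y) - beta_k(-y)) / a. *)
Require Import Defs.
From mathcomp Require Import all_boot all_order all_algebra.
From mathcomp Require Import all_classical all_reals all_analysis.
From mathcomp Require Import measurable_realfun ess_sup_inf.
From mathcomp Require Import zify ring lra.
Set Implicit Arguments.
Unset Strict Implicit.
Unset Printing Implicit Defensive.
Import Order.TTheory GRing.Theory Num.Theory.
Import numFieldNormedType.Exports.
Local Open Scope classical_set_scope.
Local Open Scope ring_scope.

(** * Dyadic cells *)

(** One grid would not do: its jumps are discontinuous at cell boundaries, so near them the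
    convolution error is as large as the jumps, however small [eta] is. Among N grids translated by
    multiples of r / N, only a fraction of about 1 / N + |x - y| / scale separates two points, so
    the averaged jumps are almost continuous and the error is small in sup norm too. The remainder
    of a step is a series over all generations. Its oscillation on an interval of length l is
    estimated in three ranges: generations finer than l are small in L^1, because jumps are few on
    average; the q generations next above l are bounded in sup norm, at the cost of q * eta; still
    coarser ones barely vary across the interval. The Gaussian widths eta^2 * scale produce factors
    eta^-2, in sup norms and in Lipschitz constants, and these are paid for by requiring 2^-m <=
    eta^3 and 2^-q <= eta^3, where m bounds the number of jumps kept at a point. Since q need only
    be logarithmic in 1 / eta, the product q * eta is small for small [eta]. *)

Definition scale {R : realType} (r : R) (k : nat) : R := r / 2 ^+ k.

Lemma scale_gt0 {R : realType} (r : R) k : 0 < r -> 0 < scale r k.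
Proof. by move=> r0; rewrite /scale divr_gt0// exprn_gt0. Qed.

Lemma scaleS {R : realType} (r : R) k : scale r k = scale r k.+1 *+ 2.
Proof.
rewrite /scale exprS -mulr_natr; field.
by rewrite expf_neq0//.
Qed.

Lemma scale0 {R : realType} (r : R) : scale r 0 = r.
Proof. by rewrite /scale expr0 divr1. Qed.

Lemma scale_le {R : realType} (r : R) k : 0 < r -> scale r k <= r.
Proof.
move=> r0; rewrite /scale ler_pdivrMr ?exprn_gt0// ler_peMr ?(ltW r0)//.
by rewrite exprn_ege1// ler1n.
Qed.

Section cells.
Context {R : realType} (r o : R) (r0 : 0 < r).
Implicit Types (x y : R) (k j n : nat) (f : R -> R).
Local Notation leb := (@lebesgue_measure R).

Definition cidx k x : int := Num.floor ((x - o) / scale r k).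
Definition cleft k x : R := o + (cidx k x)%:~R * scale r k.
Definition cell k x : set R := `[cleft k x, cleft k x + scale r k[%classic.

Let s0 k : 0 < scale r k. Proof. exact: scale_gt0. Qed.

Lemma cidxP k x (z : int) :
  cidx k x = z <-> z%:~R * scale r k <= x - o < (z + 1)%:~R * scale r k.
Proof.
rewrite -ler_pdivlMr// -ltr_pdivrMr//; split=> [<-|]; first exact: floor_itv.
by move=> h; exact: floor_def.
Qed.

Lemma cellP k x y : cell k x y <-> cidx k y = cidx k x.
Proof.
rewrite cidxP /cell /= in_itv/= /cleft intrD mulrDl mul1r.
by rewrite lerBrDl ltrBlDl addrA.
Qed.

Lemma cell_refl k x : cell k x x. Proof. exact/cellP. Qed.

Lemma cleft_idx k x y : cidx k x = cidx k y -> cleft k x = cleft k y.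
Proof. by rewrite /cleft => ->. Qed.

Lemma cidx_cleft k x : cidx k (cleft k x) = cidx k x.
Proof.
apply/cellP; rewrite /cell/= in_itv/= lexx/= ltrDl; exact: s0.
Qed.

Lemma cidxS_bound k x : (2 * cidx k x <= cidx k.+1 x <= 2 * cidx k x + 1)%R.
Proof.
have /cidxP/andP[h1 h2] := erefl (cidx k x).
have /cidxP/andP[h3 h4] := erefl (cidx k.+1 x).
move: h1 h2; rewrite scaleS => h1 h2; have s := s0 k.+1.
have {h1 h4} : ((cidx k x)%:~R * 2 : R) < (cidx k.+1 x + 1)%:~R.
  rewrite -(ltr_pM2r s); apply: le_lt_trans h4; move: h1.
  by rewrite -mulrA (mulr_natl _ 2).
have {h2 h3} : ((cidx k.+1 x)%:~R : R) < (cidx k x + 1)%:~R * 2.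
  rewrite -(ltr_pM2r s); apply: le_lt_trans h3 _; move: h2.
  by rewrite -mulrA (mulr_natl _ 2).
rewrite -[2]/(2%:~R) -!intrM !ltr_int; lia.
Qed.

Lemma cidx_coarse k x y : cidx k.+1 x = cidx k.+1 y -> cidx k x = cidx k y.
Proof. by have := cidxS_bound k x; have := cidxS_bound k y; lia. Qed.

Lemma cidx_coarser j k x y : (j <= k)%N -> cidx k x = cidx k y ->
  cidx j x = cidx j y.
Proof.
move=> jk; rewrite -(subnK jk); elim: (k - j)%N => [//|n IH].
by rewrite addSn => /cidx_coarse.
Qed.

Lemma cleftS_l k x : cleft k.+1 (cleft k x) = cleft k x.
Proof.
rewrite [LHS]/cleft; suff -> : cidx k.+1 (cleft k x) = 2 * cidx k x.
  rewrite intrM [in RHS]/cleft (scaleS r k) -mulr_natr; ring.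
apply/cidxP; rewrite /cleft addrC addKr (scaleS r k) intrD intrM mulrDl.
rewrite -(mulr_natr (scale r k.+1)); have := s0 k.+1 => s; apply/andP; split; lra.
Qed.

Lemma cleftS_r k x :
  cleft k.+1 (cleft k x + scale r k.+1) = cleft k x + scale r k.+1.
Proof.
rewrite [LHS]/cleft.
suff -> : cidx k.+1 (cleft k x + scale r k.+1) = 2 * cidx k x + 1.
  by rewrite intrD intrM [in RHS]/cleft (scaleS r k) -mulr_natr; ring.
apply/cidxP; rewrite /cleft (addrC o) -addrA addrC addrAC (scaleS r k).
rewrite !intrD intrM !mulrDl -(mulr_natr (scale r k.+1)); have := s0 k.+1 => s.
apply/andP; split; lra.
Qed.

Lemma cell_split k x :
  cell k x = cell k.+1 (cleft k x) `|` cell k.+1 (cleft k x + scale r k.+1).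
Proof.
rewrite /cell cleftS_l cleftS_r (scaleS r k) mulr2n addrA.
rewrite -itv_bndbnd_setU// bnd_simp ?lerDl ?ltW//.
Qed.

Lemma cell_disj k x :
  [disjoint cell k.+1 (cleft k x) & cell k.+1 (cleft k x + scale r k.+1)].
Proof.
rewrite /cell cleftS_l cleftS_r; apply/disj_setPS => y [/=]; rewrite !in_itv/=.
by move=> /andP[_ h] /andP[h' _]; move: h; rewrite ltNge h'.
Qed.

Lemma measurable_cell k x : measurable (cell k x).
Proof. exact: measurable_itv. Qed.

Lemma leb_cell k x : leb (cell k x) = (scale r k)%:E.
Proof.
rewrite /cell lebesgue_measure_itv/= lte_fin ltrDl s0 -EFinD addrC addKr//.
Qed.

Lemma cellwise_measurable d (T : measurableType d) k (phi : R -> T) :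
  (forall x y, cidx k x = cidx k y -> phi x = phi y) ->
  measurable_fun [set: R] phi.
Proof.
move=> h _ Y mY; rewrite setTI.
rewrite (_ : _ @^-1` _ = \bigcup_(z in [set z : int |
   Y (phi (o + z%:~R * scale r k))]) cell k (o + z%:~R * scale r k)).
  rewrite bigcup_mkcond; apply: countable_bigcupT_measurable => // z.
  by case: ifP => // _; exact: measurable_cell.
have E z : cidx k (o + z%:~R * scale r k) = z.
  by apply/cidxP; rewrite addrC addKr lexx/= ltr_pM2r// ltr_int; lia.
apply/seteqP; split=> [x/= Yx|x /= [z/= Yz] /cellP].
  exists (cidx k x) => /=; last by apply/cellP; rewrite E.
  by rewrite (h _ x)// E.
by move=> /h ->.
Qed.

Local Open Scope ereal_scope.

Lemma int_cell_split k x (h : R -> \bar R) : measurable_fun [set: R] h ->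
  (forall y, 0 <= h y) ->
  \int[leb]_(y in cell k x) h y =
  \int[leb]_(y in cell k.+1 (cleft k x)) h y +
  \int[leb]_(y in cell k.+1 (cleft k x + scale r k.+1)%R) h y.
Proof.
move=> mh h0; rewrite cell_split ge0_integral_setU//.
- exact: measurable_cell.
- exact: measurable_cell.
- by apply: measurable_funS mh.
- exact: cell_disj.
Qed.

(** A cell is the union of two cells of the next generation, so an inequality between integrals over
    all fine cells adds up, one generation at a time, to the coarse ones. *)
Lemma cell_lift k n (phi psi : R -> \bar R) (M : R) :
  measurable_fun [set: R] phi -> (forall y, 0 <= phi y) ->
  measurable_fun [set: R] psi -> (forall y, 0 <= psi y) -> (0 <= M)%R ->
  (forall x, \int[leb]_(y in cell (k + n) x) phi y
     <= M%:E * \int[leb]_(y in cell (k + n) x) psi y) ->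
  forall x, \int[leb]_(y in cell k x) phi y
     <= M%:E * \int[leb]_(y in cell k x) psi y.
Proof.
move=> mphi phi0 mpsi psi0 M0; elim: n k => [|n IH] k h x.
  by have := h x; rewrite addn0.
rewrite int_cell_split// [X in _ * X]int_cell_split//.
rewrite ge0_muleDr ?integral_ge0// leeD//; apply: (IH k.+1) => y;
  by have := h y; rewrite addnS addSn.
Qed.

End cells.

(** * Cell averages and stopping times *)

Section nonneg_integral.
Context d (T : measurableType d) (R : realType) (mu : {measure set T -> \bar R}).

Lemma measurable_funEFin (D : set T) (g : T -> R) : measurable_fun [set: T] g ->
  measurable_fun D (fun x => (g x)%:E).
Proof. by move=> mg; apply: measurable_funTS; exact/measurable_EFinP. Qed.

Local Open Scope ereal_scope.

Lemma le_intR (D : set T) (g h : T -> R) : measurable D ->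
  measurable_fun [set: T] g -> measurable_fun [set: T] h ->
  (forall x, D x -> 0 <= g x <= h x)%R ->
  \int[mu]_(x in D) (g x)%:E <= \int[mu]_(x in D) (h x)%:E.
Proof.
move=> mD mg mh gh; apply: ge0_le_integral => //.
- by move=> x /gh /andP[]; rewrite lee_fin.
- exact: measurable_funEFin.
- exact: measurable_funEFin.
- by move=> x /gh /andP[_]; rewrite lee_fin.
Qed.

Lemma intRZ (D : set T) (g : T -> R) (M : R) : measurable D ->
  measurable_fun [set: T] g -> (forall x, 0 <= g x)%R -> (0 <= M)%R ->
  \int[mu]_(x in D) (M * g x)%:E = M%:E * \int[mu]_(x in D) (g x)%:E.
Proof.
move=> mD mg g0 M0; under eq_integral do rewrite EFinM.
rewrite ge0_integralZl_EFin//; first by move=> x _; rewrite lee_fin.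
exact: measurable_funEFin.
Qed.

Lemma intRD (D : set T) (g h : T -> R) : measurable D ->
  measurable_fun [set: T] g -> (forall x, 0 <= g x)%R ->
  measurable_fun [set: T] h -> (forall x, 0 <= h x)%R ->
  \int[mu]_(x in D) (g x + h x)%:E =
  \int[mu]_(x in D) (g x)%:E + \int[mu]_(x in D) (h x)%:E.
Proof.
move=> mD mg g0 mh h0; under eq_integral do rewrite EFinD.
rewrite ge0_integralD//; do ?exact: measurable_funEFin.
- by move=> x _; rewrite lee_fin.
- by move=> x _; rewrite lee_fin.
Qed.

Lemma intR_cst (D : set T) (M : R) : measurable D ->
  \int[mu]_(x in D) M%:E = M%:E * mu D.
Proof. by move=> mD; rewrite -(integral_cst mu mD). Qed.

End nonneg_integral.

Section nonneg_lebesgue.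
Context {R : realType}.
Implicit Types (D : set R) (g h : R -> R) (M : R).
Local Notation leb := (@lebesgue_measure R).
Local Open Scope ereal_scope.

Lemma le_intL D g h : measurable D ->
  measurable_fun [set: R] g -> measurable_fun [set: R] h ->
  (forall x, D x -> 0 <= g x <= h x)%R ->
  \int[leb]_(x in D) (g x)%:E <= \int[leb]_(x in D) (h x)%:E.
Proof. exact: (@le_intR _ (measurableTypeR R) R leb D g h). Qed.

Lemma intLZ D g M : measurable D ->
  measurable_fun [set: R] g -> (forall x, 0 <= g x)%R -> (0 <= M)%R ->
  \int[leb]_(x in D) (M * g x)%:E = M%:E * \int[leb]_(x in D) (g x)%:E.
Proof. exact: (@intRZ _ (measurableTypeR R) R leb D g M). Qed.

Lemma intLD D g h : measurable D ->
  measurable_fun [set: R] g -> (forall x, 0 <= g x)%R ->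
  measurable_fun [set: R] h -> (forall x, 0 <= h x)%R ->
  \int[leb]_(x in D) (g x + h x)%:E =
  \int[leb]_(x in D) (g x)%:E + \int[leb]_(x in D) (h x)%:E.
Proof. exact: (@intRD _ (measurableTypeR R) R leb D g h). Qed.

Lemma intL_cst D M : measurable D ->
  \int[leb]_(x in D) M%:E = M%:E * leb D.
Proof. exact: (@intR_cst _ (measurableTypeR R) R leb D M). Qed.

Lemma intL_indic D (A : set R) : measurable D -> measurable A ->
  \int[leb]_(x in D) (\1_A x)%:E = leb (A `&` D).
Proof. by move=> mD mA; exact: (@integral_indic _ (measurableTypeR R) R leb D mD A mA). Qed.

Lemma ae_leb_impl (P Q : R -> Prop) : {ae leb, forall x, P x} ->
  (forall x, P x -> Q x) -> {ae leb, forall x, Q x}.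
Proof.
by move=> aP PQ; apply: (@filterS _ _ (ae_filter_ringOfSetsType leb) P).
Qed.

Lemma ae_leb_impl2 (P Q S : R -> Prop) : {ae leb, forall x, P x} ->
  {ae leb, forall x, Q x} -> (forall x, P x -> Q x -> S x) ->
  {ae leb, forall x, S x}.
Proof.
by move=> aP aQ PQ; apply: (@filterS2 _ _ (ae_filter_ringOfSetsType leb) P Q).
Qed.

Lemma ae_leb_forall (P : nat -> R -> Prop) :
  (forall n, {ae leb, forall x, P n x}) ->
  {ae leb, forall x, forall n, P n x}.
Proof.
move=> aP; rewrite /almost_everywhere/=.
have : leb.-negligible (\bigcup_n ~` [set x | P n x]).
  by apply: negligible_bigcup => n; exact: aP.
by apply: negligibleS => x /= /existsNP [n h]; exists n.
Qed.

End nonneg_lebesgue.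

(** * Bounded mean oscillation on the line at scales up to r *)

Section lbmo.
Context {R : realType}.
Implicit Types (f : R -> R) (r c u v l x y m : R).
Local Notation leb := (@lebesgue_measure R).

Definition ico u l : set R := `[u, u + l[%classic.

Lemma measurable_ico u l : measurable (ico u l).
Proof. exact: measurable_itv. Qed.
#[local] Hint Extern 0 (measurable (ico _ _)) => solve [exact: measurable_ico] : core.

Definition iavg f u l : R := l^-1 * \int[leb]_(y in ico u l) f y.

(** The integrals are extended reals, so the bounds include local integrability. The constant m is
    free instead of being the mean, which suits the remainders built below. The last clause bounds
    the averages at the top scale, where the value followed starts from 0. *)
Definition lbmo r c f : Prop :=
  [/\ measurable_fun [set: R] f,
      forall x l, 0 < l <= r -> exists m,
        (\int[leb]_(y in ico x l) `|f y - m|%:E <= (c * l)%:E)%E &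
      forall x, (\int[leb]_(y in ico x r) `|f y|%:E <= (c * r)%:E)%E].

Lemma leb_itv u l : 0 <= l -> leb (ico u l) = l%:E.
Proof.
rewrite le_eqVlt => /predU1P[<-|l0].
  by rewrite /ico addr0 set_itv_ge ?measure0// bnd_simp ltxx.
by rewrite lebesgue_measure_itv/= lte_fin ltrDl l0 -EFinD addrC addKr.
Qed.

Lemma lbmo_integrable r c f u l : lbmo r c f -> l <= r ->
  leb.-integrable (ico u l) (EFin \o f).
Proof.
move=> [mf _ h] lr.
have : leb.-integrable (ico u r) (EFin \o f).
  apply/integrableP; split; first exact: measurable_funEFin.
  by apply: le_lt_trans (h u) _; rewrite ltry.
apply: integrableS; [exact: measurable_ico|exact: measurable_ico|].
by apply: subset_itvl; rewrite bnd_simp lerD2l.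
Qed.

Lemma iavg_dist f u l m : 0 < l -> leb.-integrable (ico u l) (EFin \o f) ->
  ((`|iavg f u l - m| * l)%:E <= \int[leb]_(y in ico u l) `|f y - m|%:E)%E.
Proof.
move=> l0 fi.
have im : leb.-integrable (ico u l) (EFin \o cst m).
  apply: measurable_bounded_integrable.
  - by [].
  - by rewrite /= leb_itv ?ltW// ltry.
  - exact: measurable_cst.
  - exact: bounded_cst.
have -> : `|iavg f u l - m| * l = `|\int[leb]_(y in ico u l) (f y - m)|.
  rewrite RintegralB//.
  rewrite Rintegral_cst//= (leb_itv u (ltW l0))/= -{2}(gtr0_norm l0).
  by rewrite -normrM mulrBl /iavg mulrAC mulVf ?mul1r ?gt_eqF.
have fmi : leb.-integrable (ico u l) (EFin \o (fun y => f y - m)).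
  by apply: eq_integrable (integrableB _ fi im).
rewrite EFin_normr_Rintegral//; apply: le_abse_integral => //.
by case/integrableP: fmi.
Qed.

Lemma iavg_sub r c f u v l l' m : lbmo r c f -> 0 < l' -> l <= r ->
  u <= v -> v + l' <= u + l ->
  (\int[leb]_(y in ico u l) `|f y - m|%:E <= (c * l)%:E)%E ->
  `|iavg f v l' - m| * l' <= c * l.
Proof.
move=> fB l'0 lr uv vu h; rewrite -lee_fin; apply: le_trans h.
apply: (@le_trans _ _ (\int[leb]_(y in `[v, (v + l')%R[) `|f y - m|%:E)%E).
  apply: iavg_dist => //; apply: lbmo_integrable fB _.
  by rewrite -(lerD2l v) (le_trans vu)// lerD.
apply: ge0_subset_integral => //.
- apply: measurable_funEFin; apply: measurableT_comp => //.
  by apply: measurable_funB => //; case: fB.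
- by apply: subset_itv; rewrite bnd_simp.
Qed.

(** Both averages are compared with the constant m of the large interval: the large one is within 1
    of it and the small one within 2, halving the length costing a factor 2. *)
Lemma iavg_half r f u v l : lbmo r 1 f -> 0 < l -> l *+ 2 <= r ->
  (v = u \/ v = u + l) -> `|iavg f v l - iavg f u (l *+ 2)| <= 3.
Proof.
move=> fB l0 lr vE; have [mf h _] := fB.
have [|m hm] := h u (l *+ 2); first by rewrite mulrn_wgt0.
have := @iavg_sub r 1 f u v (l *+ 2) l m fB l0 lr.
have := @iavg_sub r 1 f u u (l *+ 2) (l *+ 2) m fB.
rewrite mulrn_wgt0// => /(_ isT lr (lexx _) (lexx _) hm) h1.
have /[swap] /[apply] h2 : u <= v by case: vE => ->; lra.
have {}h2 := h2 _ hm; have {h2} h2 : `|iavg f v l - m| <= 2.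
  rewrite -(ler_pM2r l0) (le_trans (h2 _))//; last by rewrite mul1r mulr_natl.
  by case: vE => ->; rewrite mulr2n; lra.
have {}h1 : `|iavg f u (l *+ 2) - m| <= 1.
  by rewrite -(@ler_pM2r _ (l *+ 2)) ?mulrn_wgt0.
rewrite (_ : _ - _ = (iavg f v l - m) - (iavg f u (l *+ 2) - m)); last by ring.
by rewrite (le_trans (ler_normB _ _))// (le_trans (lerD h2 h1))//; lra.
Qed.

Lemma iavg_adj r f u l : lbmo r 1 f -> 0 < l -> l *+ 2 <= r ->
  `|iavg f (u + l) l - iavg f u l| <= 4.
Proof.
move=> fB l0 lr; have [mf h _] := fB.
have [|m hm] := h u (l *+ 2); first by rewrite mulrn_wgt0.
have H v : u <= v -> v + l <= u + l *+ 2 -> `|iavg f v l - m| <= 2.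
  move=> uv vu; rewrite -(ler_pM2r l0) (le_trans (iavg_sub fB l0 lr uv vu hm))//.
  by rewrite mul1r mulr_natl.
have h1 : `|iavg f u l - m| <= 2 by apply: H => //; rewrite mulr2n; lra.
have h2 : `|iavg f (u + l) l - m| <= 2 by apply: H => //; rewrite ?mulr2n; lra.
rewrite (_ : _ - _ = (iavg f (u + l) l - m) - (iavg f u l - m)); last by ring.
by rewrite (le_trans (ler_normB _ _))// (le_trans (lerD h2 h1))//; lra.
Qed.

Lemma iavg_osc r f u l a : lbmo r 1 f -> 0 < l <= r ->
  (\int[leb]_(y in ico u l) `|f y - a|%:E
    <= ((2 + `|iavg f u l - a|) * l)%:E)%E.
Proof.
move=> fB lr; have [mf h _] := fB; have [l0 l1] := andP lr.
have [m hm] := h u l lr.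
have h1 : `|iavg f u l - m| <= 1.
  by rewrite -(ler_pM2r l0); apply: (iavg_sub fB l0 l1 _ _ hm).
have mm (b : R) : measurable_fun [set: R] (fun y => `|f y - b|).
  by apply: measurableT_comp => //; exact: measurable_funB.
apply: (@le_trans _ _ (\int[leb]_(y in ico u l)
   (`|f y - m| + (1 + `|iavg f u l - a|))%:E)%E).
  apply: le_intL => //; first exact: measurable_funD.
  move=> y _; rewrite normr_ge0/=.
  rewrite (_ : f y - a = (f y - m) - (iavg f u l - m) + (iavg f u l - a)); last by ring.
  rewrite (le_trans (ler_normD _ _))// addrA lerD2r (le_trans (ler_normB _ _))//.
  by rewrite lerD2l.
rewrite intLD// ?addr_ge0// intL_cst// (leb_itv u (ltW l0)).
apply: (@le_trans _ _ ((1 * l)%:E + ((1 + `|iavg f u l - a|) * l)%:E)%E).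
  by rewrite leeD// EFinM.
by rewrite -EFinD lee_fin; lra.
Qed.

Lemma iavg_top r f u : 0 < r -> lbmo r 1 f -> `|iavg f u r| <= 1.
Proof.
move=> r0 fB; have [_ _ h] := fB; rewrite -(ler_pM2r r0) -lee_fin.
rewrite -[X in `|X|]subr0; apply: le_trans (iavg_dist 0 r0 _) _.
  exact: lbmo_integrable fB _.
by under eq_integral do rewrite subr0.
Qed.

End lbmo.

(** * Following the cell averages, and the number of jumps *)

Section hits.
Context {R : realType} (r o : R) (r0 : 0 < r) (f : R -> R) (fB : lbmo r 1 f).
Implicit Types (x y : R) (j k n m : nat).
Local Notation leb := (@lebesgue_measure R).
Local Notation cidx := (cidx r o).
Local Notation cell := (cell r o).
Local Notation cleft := (cleft r o).

Definition cavg k x : R := iavg f (cleft k x) (scale r k).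

(* [refv] follows the cell averages lazily, jumping to the current average only
   when it has drifted away by more than 5 *)
Fixpoint refv k x : R := if k is k'.+1 then
  if 5 < `|cavg k x - refv k' x| then cavg k x else refv k' x else 0.

Definition hit k x : bool :=
  if k is k'.+1 then 5 < `|cavg k x - refv k' x| else false.

Fixpoint cnt n j x : nat :=
  if n is n'.+1 then (hit j.+1 x + cnt n' j.+1 x)%N else 0%N.

Definition inc k x : R := refv k x - refv k.-1 x.

Let s0 k : 0 < scale r k. Proof. exact: scale_gt0. Qed.

Lemma cavg_const k x y : cidx k x = cidx k y -> cavg k x = cavg k y.
Proof. by rewrite /cavg => /cleft_idx ->. Qed.

Lemma refv_const k x y : cidx k x = cidx k y -> refv k x = refv k y.
Proof.
elim: k => [//|k IH] h /=; rewrite (IH (cidx_coarse r0 h)).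
by rewrite (cavg_const h).
Qed.

Lemma hit_const k x y : cidx k x = cidx k y -> hit k x = hit k y.
Proof.
case: k => [//|k] h /=; rewrite (refv_const (cidx_coarse r0 h)).
by rewrite (cavg_const h).
Qed.

Lemma inc_const k x y : cidx k x = cidx k y -> inc k x = inc k y.
Proof.
move=> h; rewrite /inc (refv_const h); congr (_ - _); apply: refv_const.
by apply: cidx_coarser h => //; exact: leq_pred.
Qed.

Lemma cnt_const n k x y : cidx (k + n) x = cidx (k + n) y ->
  cnt n k x = cnt n k y.
Proof.
elim: n k => [//|n IH] k h.
have hh : hit k.+1 x = hit k.+1 y.
  by apply: hit_const; apply: cidx_coarser h => //; rewrite addnS ltnS leq_addr.
by move: hh => /= ->; rewrite (IH k.+1) ?addSn -?addnS.
Qed.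

Lemma cntS n j x : cnt n.+1 j x = (hit j.+1 x + cnt n j.+1 x)%N.
Proof. by []. Qed.

Lemma cavg_succ k x : `|cavg k.+1 x - cavg k x| <= 3.
Proof.
rewrite /cavg (scaleS r k); apply: (iavg_half fB) => //.
  by rewrite -scaleS; exact: scale_le.
have := cell_refl o r0 k x; rewrite (cell_split _ r0) => -[|] /(cellP _ r0)/cleft_idx ->.
  by left; rewrite cleftS_l.
by right; rewrite cleftS_r.
Qed.

Lemma refv_near k x : `|refv k x - cavg k x| <= 5.
Proof.
case: k => [|k] /=.
  rewrite sub0r normrN /cavg scale0; apply: le_trans (iavg_top _ r0 fB) _.
  by rewrite ler1n.
by case: ltP => [_|]; rewrite ?subrr ?normr0// distrC.
Qed.

(** Before a jump the value followed is within 5 of the last average, and averages move by at most 3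
    between generations. *)
Lemma inc_bound k x : `|inc k x| <= 8 * (hit k x)%:R.
Proof.
case: k => [|k]; first by rewrite /inc /= subrr normr0 mulr0.
rewrite /inc/=; case: ifPn => _; last by rewrite subrr normr0 mulr0.
rewrite mulr1 (_ : _ - _ = (cavg k.+1 x - cavg k x) - (refv k x - cavg k x)).
  rewrite (le_trans (ler_normB _ _))// (le_trans (lerD (cavg_succ k x) (refv_near k x)))//.
  lra.
by ring.
Qed.

Lemma sum_inc k x : \sum_(1 <= i < k.+1) inc i x = refv k x.
Proof.
elim: k => [|k IH]; first by rewrite big_geq.
by rewrite big_nat_recr//= IH /inc /= addrC subrK.
Qed.

Lemma measurable_inc k : measurable_fun [set: R] (inc k).
Proof. by apply: (cellwise_measurable r0) => x y; exact: inc_const. Qed.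

Lemma measurable_hit k : measurable_fun [set: R] (fun x => (hit k x)%:R : R).
Proof. by apply: (cellwise_measurable r0) => x y /(hit_const (k := k)) ->. Qed.

Lemma measurable_cnt (phi : nat -> R) n k :
  measurable_fun [set: R] (fun x => phi (cnt n k x)).
Proof.
by apply: (cellwise_measurable r0 (k := k + n)) => x y /cnt_const ->.
Qed.

Local Open Scope ereal_scope.

Let mfm (a : R) : measurable_fun [set: R] (fun y => `|f y - a|%R).
Proof.
by apply: measurableT_comp => //; apply: measurable_funB => //; case: fB.
Qed.

Lemma int_cell_osc k x (a : R) : \int[leb]_(y in cell k x) `|f y - a|%:E
    <= ((2 + `|cavg k x - a|) * scale r k)%:E.
Proof. by apply: (iavg_osc _ _ fB); rewrite s0 scale_le. Qed.

Lemma int_cell_refv k x : \int[leb]_(y in cell k x) `|f y - refv k x|%:E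
    <= (7 * scale r k)%:E.
Proof.
apply: (le_trans (int_cell_osc k x (refv k x))); rewrite lee_fin ler_pM2r//.
by have := refv_near k x; rewrite distrC; lra.
Qed.

(** Induction on the number of generations, and the origin of the threshold 5. On a cell without a
    jump the value followed is unchanged. At a jump, 2^(n+1) - 1 = 2 (2^n - 1) + 1, and the new
    value is the average itself, so the induction hypothesis bounds the integral by 2 * 2 + 1 = 5
    times the length of the cell. A jump means that the average is more than 5 away from the old
    value, hence this is at most the integral of the distance of f to the old value. *)
Lemma int_cnt n j x : \int[leb]_(y in cell j x) (2 ^+ cnt n j y - 1)%:E
   <= \int[leb]_(y in cell j x) `|f y - refv j x|%:E.
Proof.
have mp n' j' : measurable_fun [set: R] (fun y => 2 ^+ cnt n' j' y - 1 : R)%R.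
  exact: (measurable_cnt (fun p => 2 ^+ p - 1)%R).
have p0 n' j' y : (0 <= 2 ^+ cnt n' j' y - 1 :> R)%R.
  by rewrite subr_ge0 exprn_ege1// ler1n.
elim: n j x => [|n IH] j x.
  under eq_integral do rewrite /= expr0 subrr.
  by rewrite integral0 integral_ge0.
rewrite (int_cell_split _ r0)//; last 2 first.
- by apply/measurable_EFinP; exact: mp.
- by move=> y; rewrite lee_fin p0.
rewrite [leRHS](int_cell_split _ r0)//; last by apply/measurable_EFinP; exact: mfm.
have key z : cidx j z = cidx j x ->
    \int[leb]_(y in cell j.+1 z) (2 ^+ cnt n.+1 j y - 1)%:E <=
    \int[leb]_(y in cell j.+1 z) `|f y - refv j x|%:E.
  move=> zx; have mc : measurable (cell j.+1 z) by exact: measurable_cell.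
  have [hz|hz] := boolP (hit j.+1 z); last first.
    apply: (@le_trans _ _ (\int[leb]_(y in cell j.+1 z) (2 ^+ cnt n j.+1 y - 1)%:E)).
      apply: le_intL => // y /(cellP _ r0) yz.
      by rewrite p0 cntS (hit_const yz) (negbTE hz) add0n lexx.
    apply: (le_trans (IH _ _)); suff -> : refv j.+1 z = refv j x by [].
    by rewrite /=; move: hz => /= /negbTE ->; exact: refv_const.
  apply: (@le_trans _ _ (5 * scale r j.+1)%:E).
    apply: (@le_trans _ _ (\int[leb]_(y in cell j.+1 z)
        (2 * (2 ^+ cnt n j.+1 y - 1) + 1)%:E)).
      apply: le_intL => //.
        by apply: measurable_funD => //; apply: measurable_funM => //; exact: mp.
      move=> y /(cellP _ r0) yz; rewrite p0 cntS (hit_const yz) hz add1n exprS/=.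
      by rewrite mulrBr mulr1 -addrA -[(-2 + 1)%R]/(- (1 + 1) + 1)%R opprD addrNK.
    rewrite intLD//; last 2 first.
    - by apply: measurable_funM => //; exact: mp.
    - by move=> y; rewrite mulr_ge0.
    rewrite intLZ// intL_cst// leb_cell// mul1e.
    apply: (@le_trans _ _ (2%:E * (2 * scale r j.+1)%:E + (scale r j.+1)%:E)).
      rewrite leeD2r// lee_pmul2l//; apply: (le_trans (IH _ _)).
      apply: (le_trans (int_cell_osc _ _ _)); rewrite lee_fin.
      have -> : refv j.+1 z = cavg j.+1 z by move: hz => /= ->.
      by rewrite subrr normr0 addr0.
    by rewrite -EFinM -EFinD lee_fin; lra.
  apply: (@le_trans _ _ (`|cavg j.+1 z - refv j x| * scale r j.+1)%:E).
    rewrite lee_fin ler_pM2r// ltW//; move: hz => /=.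
    by rewrite (refv_const zx).
  apply: iavg_dist => //; apply: lbmo_integrable fB _; exact: scale_le.
apply: leeD; apply: key; first exact: cidx_cleft.
apply/(cellP _ r0); rewrite /cell/= in_itv/= lerDl ltW//= ltrD2l.
by rewrite (scaleS r j) mulr2n ltrDl.
Qed.

Lemma int_pow_cnt n j x :
  \int[leb]_(y in cell j x) (2 ^+ cnt n j y)%:E <= (8 * scale r j)%:E.
Proof.
have mc : measurable (cell j x) by exact: measurable_cell.
apply: (@le_trans _ _ (\int[leb]_(y in cell j x) ((2 ^+ cnt n j y - 1) + 1)%:E)).
  by under eq_integral do rewrite -{1}(subrK 1%R (2 ^+ cnt n j _)%R).
rewrite intLD//; last 2 first.
- exact: (measurable_cnt (fun p => 2 ^+ p - 1)%R).
- by move=> y; rewrite subr_ge0 exprn_ege1// ler1n.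
rewrite intL_cst// leb_cell// mul1e.
apply: (@le_trans _ _ ((7 * scale r j)%:E + (scale r j)%:E)).
  by rewrite leeD2r//; apply: le_trans (int_cnt _ _ _) (int_cell_refv _ _).
by rewrite -EFinD lee_fin; lra.
Qed.

End hits.

(** * Jumps followed by few or by many further jumps *)

Section retained_hits.
Context {R : realType} (r o : R) (r0 : 0 < r) (f : R -> R) (fB : lbmo r 1 f).
Implicit Types (x y : R) (j k n m : nat).
Local Notation leb := (@lebesgue_measure R).
Local Notation cidx := (cidx r o).
Local Notation cell := (cell r o).
Local Notation cleft := (cleft r o).
Local Notation cavg := (cavg r o f).
Local Notation refv := (refv r o f).
Local Notation hit := (hit r o f).
Local Notation cnt := (cnt r o f).
Local Notation inc := (inc r o f).

Let s0 k : 0 < scale r k. Proof. exact: scale_gt0. Qed.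

Lemma cnt_sum n j x : cnt n j x = (\sum_(j.+1 <= k < (j + n).+1) hit k x)%N.
Proof.
elim: n j => [|n IH] j; first by rewrite addn0 big_geq.
by rewrite cntS IH addSnnS [RHS]big_ltn// ltnS addnS ltnS leq_addr.
Qed.

Lemma cnt_leS n j x : (cnt n j x <= cnt n.+1 j x)%N.
Proof. by rewrite !cnt_sum addnS [leqRHS]big_nat_recr/= ?leq_addr// ltnS leq_addr. Qed.

Lemma cnt_mono j x : {homo (fun n => cnt n j x) : n p / (n <= p)%N}.
Proof. by apply: homo_leq => [//|? ? ?|n]; [exact: leq_trans|exact: cnt_leS]. Qed.

(** Only generations after k are counted: a jump is judged by its successors. The set is not a union
    of cells of generation k, but it fills a small part of each of them. *)
Definition many m k : set R := [set x | exists n, (m <= cnt n k x)%N].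

Lemma measurable_many m k : measurable (many m k).
Proof.
rewrite (_ : many _ _ = \bigcup_n [set x | (m <= cnt n k x)%N]).
  apply: bigcupT_measurable => n.
  have := measurable_cnt o r0 f (fun p => (m <= p)%N%:R) n k.
  move=> /(_ measurableT [set 1] (measurable_set1 _)); rewrite setTI.
  congr (measurable _); apply/seteqP; split=> x /=; first by case: leqP => // _ /eqP; rewrite eq_sym oner_eq0.
  by move=> ->.
by apply/seteqP; split=> [x [n h]|x [n _ h]]; exists n.
Qed.
#[local] Hint Extern 0 (measurable (many _ _)) => solve [exact: measurable_many] : core.
#[local] Hint Extern 0 (measurable (Submission.cell _ _ _ _)) => solve [exact: measurable_cell] : core.

Definition kept m k x : R := inc k x * \1_(~` many m k) x.
Definition lost m k x : R := inc k x * \1_(many m k) x.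

Lemma kept_lost m k x : inc k x = kept m k x + lost m k x.
Proof.
rewrite /kept /lost !indicE in_setC; case: (_ \in _) => /=.
  by rewrite mulr0 add0r mulr1.
by rewrite mulr0 addr0 mulr1.
Qed.

Lemma measurable_kept m k : measurable_fun [set: R] (kept m k).
Proof.
apply: measurable_funM; first exact: measurable_inc.
by apply: measurable_indic; exact: measurableC.
Qed.

Lemma measurable_lost m k : measurable_fun [set: R] (lost m k).
Proof.
apply: measurable_funM; first exact: measurable_inc.
exact: measurable_indic.
Qed.

Lemma inc_le8 k x : `|inc k x| <= 8.
Proof.
apply: le_trans (inc_bound o r0 fB k x) _.
by case: (hit k x); rewrite ?mulr1 ?mulr0.
Qed.

Lemma indic01 (A : set R) x : 0 <= (\1_A x : R) <= 1.
Proof. by rewrite indicE; case: (_ \in _); rewrite /= ?lexx ?ler01. Qed.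

Lemma kept_hit m k x : `|kept m k x| <= 8 * ((hit k x)%:R * \1_(~` many m k) x).
Proof.
rewrite /kept normrM mulrA (ger0_norm (andP (indic01 _ _)).1).
by rewrite ler_wpM2r ?(andP (indic01 _ _)).1//; exact: inc_bound.
Qed.

Lemma lost_hit m k x : `|lost m k x| <= 8 * ((hit k x)%:R * \1_(many m k) x).
Proof.
rewrite /lost normrM mulrA (ger0_norm (andP (indic01 _ _)).1).
by rewrite ler_wpM2r ?(andP (indic01 _ _)).1//; exact: inc_bound.
Qed.

Lemma kept_le8 m k x : `|kept m k x| <= 8.
Proof.
rewrite /kept normrM -[8]mulr1 ler_pM ?inc_le8//.
by rewrite ger0_norm ?(andP (indic01 _ _)).1 ?(andP (indic01 _ _)).2.
Qed.

Lemma lost_le8 m k x : `|lost m k x| <= 8.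
Proof.
rewrite /lost normrM -[8]mulr1 ler_pM ?inc_le8//.
by rewrite ger0_norm ?(andP (indic01 _ _)).1 ?(andP (indic01 _ _)).2.
Qed.

(** The first kept jump has fewer than m successors, so it makes at most m together with them. *)
Lemma count_kept m j n x :
  \sum_(j.+1 <= k < (j + n).+1) ((hit k x)%:R * \1_(~` many m k) x) <= m%:R :> R.
Proof.
elim: n j => [|n IH] j; first by rewrite addn0 big_geq.
have IH' := IH j.+1; rewrite addSn -addnS in IH'.
rewrite big_ltn.
case: (boolP (hit j.+1 x)) => hj; last by rewrite mul0r add0r.
rewrite mul1r indicE in_setC; case: (boolP (x \in _)) => /= xm.
  by rewrite add0r.
have {xm} : ~ many m j.+1 x by move=> xm'; move/negP: xm; apply; rewrite inE.
move=> /forallNP /(_ n) /negP; rewrite -ltnNge => cm.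
apply: (@le_trans _ _ (1 + (cnt n j.+1 x)%:R)); last first.
  by rewrite addrC natr1 ler_nat.
rewrite lerD2l cnt_sum addSnnS natr_sum; apply: ler_sum => k _.
  rewrite -[leRHS]mulr1 ler_wpM2l//; exact: (andP (indic01 _ _)).2.
by rewrite addnS ltnS leq_addr.
Qed.

Lemma sum_kept m n x : \sum_(1 <= k < n.+1) `|kept m k x| <= 8 * m%:R.
Proof.
apply: le_trans (ler_sum _ (fun k _ => kept_hit m k x)) _.
rewrite -mulr_sumr ler_wpM2l//; have := count_kept m 0 n x.
by rewrite add0n.
Qed.

Local Open Scope ereal_scope.

(** Markov's inequality for 2 to the power [cnt], followed by continuity of the measure as the
    number of generations grows. *)
Lemma int_many m k x :
  \int[leb]_(y in cell k x) (\1_(many m k) y)%:E <= (8 / 2 ^+ m * scale r k)%:E.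
Proof.
have mA n : measurable ([set y | (m <= cnt n k y)%N] `&` cell k x).
  apply: measurableI => //.
  have := measurable_cnt o r0 f (fun p => (m <= p)%N%:R) n k.
  move=> /(_ measurableT [set 1%R] (measurable_set1 _)); rewrite setTI.
  congr (measurable _); apply/seteqP; split=> z /=; first by case: leqP => // _ /eqP; rewrite eq_sym oner_eq0.
  by move=> ->.
rewrite intL_indic//.
have -> : many m k `&` cell k x = \bigcup_n ([set y | (m <= cnt n k y)%N] `&` cell k x).
  by apply/seteqP; split=> [y [[n h] yc]|y [n _ [h yc]]]; [exists n|split=> //; exists n].
have mU : measurable (\bigcup_n ([set y | (m <= cnt n k y)%N] `&` cell k x)).
  exact: bigcupT_measurable.
have nd : {homo (fun n => [set y | (m <= cnt n k y)%N] `&` cell k x) :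
    n p / (n <= p)%N >-> (n <= p)%O}.
  move=> n p np; rewrite subsetEset => y [/= h yc]; split=> //=.
  exact: leq_trans h (cnt_mono _ _ np).
have cv := nondecreasing_cvg_mu (mu := leb) mA mU nd.
rewrite -(cvg_lim (@ereal_hausdorff R) cv); apply: lime_le.
  by apply/cvg_ex; exists (leb (\bigcup_n ([set y | (m <= cnt n k y)%N] `&` cell k x))).
apply: nearW => n /=.
rewrite -(@lee_pmul2l _ (2 ^+ m)%:E)// ?lte_fin ?exprn_gt0//.
rewrite -EFinM (_ : _ * (_ * _) = 8 * scale r k)%R; last first.
  by field; rewrite expf_neq0.
apply: le_trans (int_pow_cnt o r0 fB n k x).
have -> : [set y | (m <= cnt n k y)%N] `&` cell k x =
    ([set y | (m <= cnt n k y)%N] `&` cell k x) `&` cell k x.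
  by rewrite -setIA setIid.
rewrite -intL_indic// -intLZ//.
apply: le_intL => //.
  + by apply: measurable_funM => //; exact: measurable_indic.
  + exact: (measurable_cnt o r0 f (fun p => 2 ^+ p)%R).
  + move=> y _; rewrite indicE; case: (boolP (y \in _)) => [|_]; last by rewrite mulr0 lexx/= exprn_ge0.
    by rewrite inE => -[/= h _]; rewrite mulr1 exprn_ge0//= ler_eXn2l// ltr1n.
Qed.

(** Since n <= 2^n - 1, the exponential estimate also bounds the mean number of later jumps,
    uniformly in the number of generations. *)
Lemma sum_int_hit j n x :
  \sum_(j.+1 <= k < (j + n).+1) \int[leb]_(y in cell j x) (hit k y)%:R%:E
    <= (7 * scale r j)%:E.
Proof.
rewrite -ge0_integral_sum//; last first.
  by move=> k; apply: measurable_funEFin; exact: measurable_hit.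
apply: le_trans (int_cell_refv o r0 fB j x).
apply: le_trans (int_cnt o r0 fB n j x).
under eq_integral do rewrite sumEFin -natr_sum -cnt_sum.
apply: le_intL => //.
- exact: (measurable_cnt o r0 f (fun p => p%:R)).
- exact: (measurable_cnt o r0 f (fun p => 2 ^+ p - 1)%R).
move=> y _; rewrite ler0n/= lerBrDr natr1 -natrX ler_nat.
by rewrite ltn_expl.
Qed.

Lemma sum_int_inc j n x :
  \sum_(j.+1 <= k < (j + n).+1) \int[leb]_(y in cell j x) `|inc k y|%:E
    <= (56 * scale r j)%:E.
Proof.
apply: (@le_trans _ _ (\sum_(j.+1 <= k < (j + n).+1)
    (8%:E * \int[leb]_(y in cell j x) (hit k y)%:R%:E))).
  apply: lee_sum => k _; rewrite -intLZ//; last exact: measurable_hit.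
  apply: le_intL => //.
  - by apply: measurableT_comp => //; exact: measurable_inc.
  - by apply: measurable_funM => //; exact: measurable_hit.
  - by move=> y _; rewrite normr_ge0/=; exact: inc_bound.
rewrite -ge0_sume_distrr; last by move=> k _; rewrite integral_ge0// => y _; rewrite lee_fin.
by rewrite (_ : (56 * _)%R = (8 * (7 * scale r j))%R) ?EFinM ?lee_pmul2l ?sum_int_hit//; ring.
Qed.

(** Whether generation k jumps is decided on whole cells, and only a fraction 8 / 2^m of such a cell
    carries m later jumps; jumps have size at most 8, hence 64. *)
Lemma int_lost_hit m k x : \int[leb]_(y in cell k x) `|lost m k y|%:E
  <= (64 / 2 ^+ m)%:E * \int[leb]_(y in cell k x) (hit k y)%:R%:E.
Proof.
apply: (@le_trans _ _ (\int[leb]_(y in cell k x) ((8 * (hit k x)%:R) * \1_(many m k) y)%:E)).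
  apply: le_intL => //.
  - by apply: measurableT_comp => //; exact: measurable_lost.
  - by apply: measurable_funM => //; exact: measurable_indic.
  - move=> y /(cellP _ r0) yx; rewrite normr_ge0/= -(@hit_const _ _ _ r0 f k _ _ yx) -mulrA.
    exact: lost_hit.
rewrite intLZ ?mulr_ge0//.
have -> : \int[leb]_(y in cell k x) (hit k y)%:R%:E = (hit k x)%:R%:E * (scale r k)%:E.
  rewrite -(leb_cell o r0 k x) -intL_cst//; apply: eq_integral => y.
  by rewrite inE => /(cellP _ r0) /(@hit_const _ _ _ r0 f k) ->.
apply: (@le_trans _ _ ((8 * (hit k x)%:R)%:E * (8 / 2 ^+ m * scale r k)%:E)).
  by rewrite lee_wpmul2l ?lee_fin ?mulr_ge0// int_many.
by rewrite -!EFinM lee_fin; rewrite le_eqVlt; apply/orP; left; apply/eqP; ring.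
Qed.

Lemma int_lost m k x : \int[leb]_(y in cell k x) `|lost m k y|%:E
  <= (64 / 2 ^+ m * scale r k)%:E.
Proof.
apply: (le_trans (int_lost_hit m k x)); rewrite [leRHS]EFinM lee_wpmul2l ?lee_fin ?divr_ge0 ?exprn_ge0//.
apply: (@le_trans _ _ (\int[leb]_(y in cell k x) 1%:E)).
  apply: le_intL => //; first exact: measurable_hit.
  by move=> y _; case: (hit k y); rewrite /= ?lexx ?ler01.
by rewrite intL_cst//= leb_cell// mul1e.
Qed.

Lemma sum_int_lost m j n x :
  \sum_(j.+1 <= k < (j + n).+1) \int[leb]_(y in cell j x) `|lost m k y|%:E
    <= (448 / 2 ^+ m * scale r j)%:E.
Proof.
have e0 : (0 <= 64 / 2 ^+ m :> R)%R by rewrite divr_ge0// exprn_ge0.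
apply: (@le_trans _ _ (\sum_(j.+1 <= k < (j + n).+1)
    ((64 / 2 ^+ m)%:E * \int[leb]_(y in cell j x) (hit k y)%:R%:E))).
  rewrite big_nat [leRHS]big_nat; apply: lee_sum => k /andP[jk _].
  apply: (@cell_lift _ _ o r0 j (k - j)).
  - by apply: measurable_funEFin; apply: measurableT_comp => //; exact: measurable_lost.
  - by move=> y; rewrite lee_fin.
  - by apply: measurable_funEFin; exact: measurable_hit.
  - by move=> y; rewrite lee_fin.
  - exact: e0.
  - by move=> z; rewrite subnKC ?(ltnW jk)//; exact: int_lost_hit.
rewrite -ge0_sume_distrr; last by move=> k _; rewrite integral_ge0// => y _; rewrite lee_fin.
rewrite (_ : (448 / _ * _)%R = (64 / 2 ^+ m * (7 * scale r j))%R); last by ring.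
by rewrite [leRHS]EFinM lee_wpmul2l// sum_int_hit.
Qed.

End retained_hits.

(** * Almost everywhere stabilisation of the value followed *)

Section limit_of_reference.
Context {R : realType} (r o : R) (r0 : 0 < r) (f : R -> R) (fB : lbmo r 1 f).
Implicit Types (x y : R) (j k n m : nat).
Local Notation leb := (@lebesgue_measure R).
Local Notation cell := (cell r o).
Local Notation cleft := (cleft r o).
Local Notation cavg := (cavg r o f).
Local Notation refv := (refv r o f).
#[local] Hint Extern 0 (measurable (ico _ _)) => solve [exact: measurable_ico] : core.

Lemma lbmo_int_mul c n u : lbmo r c f ->
  (\int[leb]_(y in ico u (n%:R * r)) `|f y|%:E <= (n%:R * (c * r))%:E)%E.
Proof.
move=> [mf _ h]; elim: n => [|n IH].
  by rewrite !mul0r /ico addr0 set_itv_ge ?integral_set0// bnd_simp ltxx.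
have mn : measurable_fun [set: R] (fun y => `|f y|) by exact: measurableT_comp.
have -> : ico u (n.+1%:R * r) = ico u (n%:R * r) `|` ico (u + n%:R * r) r.
  rewrite /ico -natr1 mulrDl mul1r addrA; apply: esym; rewrite -itv_bndbnd_setU//.
    by rewrite bnd_simp lerDl mulr_ge0// ltW.
  by rewrite bnd_simp lerDl ltW.
rewrite ge0_integral_setU//=.
- by rewrite -natr1 mulrDl mul1r EFinD leeD.
- exact: measurable_funEFin.
- apply/disj_setPS => y [/=]; rewrite /ico/= !in_itv/=.
  by move=> /andP[_ a] /andP[b _]; move: a; rewrite ltNge b.
Qed.

Lemma lbmo_locally_integrable : locally_integrable setT f.
Proof.
have [mf _ _] := fB; split => //; first exact: openT.
move=> K _ cK; have /compact_bounded [M [_ hM]] := cK.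
have {hM} hM : forall x, K x -> `|x| <= `|M| + 1.
  by apply: hM; rewrite (le_lt_trans (ler_norm _))// ltrDl.
pose n := (Num.truncn ((`|M| + 2) *+ 2 / r)).+1.
have hn : (`|M| + 2) *+ 2 < n%:R * r.
  by rewrite -ltr_pdivrMr// truncnS_gt.
apply: le_lt_trans (_ : _ <= \int[leb]_(y in ico (- (`|M| + 2)) (n%:R * r)) `|f y|%:E)%E _.
  apply: ge0_subset_integral => //.
  - by apply: closed_measurable; apply: compact_closed cK; exact: Rhausdorff.
  - apply: measurable_funEFin; exact: measurableT_comp.
  - move=> x /hM; rewrite ler_norml /ico/= in_itv/= => /andP[a b].
    by apply/andP; split; move: hn; rewrite mulr2n; lra.
by apply: le_lt_trans (lbmo_int_mul _ _ fB) _; rewrite ltry.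
Qed.

Lemma cell_nicely_shrinking x : nicely_shrinking x (fun k => cell k x).
Proof.
split; first by move=> k; exact: measurable_cell.
exists (2, fun k => PosNum (scale_gt0 k r0)); split => //=.
- rewrite (_ : (fun k => _) = (fun k => r * (2^-1) ^+ k)); last first.
    by apply/funext => k; rewrite /scale exprVn.
  rewrite -[X in _ --> X](mulr0 r); apply: cvgMr; apply: cvg_expr.
  by rewrite ger0_norm ?invr_ge0// invf_lt1 ?ltr1n.
- move=> k y; have := cell_refl o r0 k x.
  rewrite /cell /= !in_itv/= /ball/= => /andP[a b] /andP[c d].
  by rewrite ltr_norml; apply/andP; split; lra.
- move=> k; rewrite lebesgue_measure_ball ?leb_cell// ?(ltW (scale_gt0 _ _))//.
  by rewrite -EFinM lee_fin mulr_natl.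
Qed.

Lemma cavg_cvg : {ae leb, forall x, cavg k x @[k --> \oo] --> f x}.
Proof.
have := lebesgue_differentiation lbmo_locally_integrable.
move=> h; apply: (ae_leb_impl h) => x fx.
have := nice_lebesgue_differentiation cell_nicely_shrinking lbmo_locally_integrable fx.
rewrite (_ : (fun n => _) = EFin \o (fun k => cavg k x)).
  by move/fine_cvgP => [].
apply/funext => k /=; rewrite leb_cell// /cavg /iavg inver gt_eqF ?scale_gt0//.
rewrite [in RHS]EFinM /Rintegral fineK//.
apply: integrable_fin_num; first exact: measurable_ico.
by apply: (lbmo_integrable _ fB); exact: scale_le.
Qed.

(** Once the averages stay within 1 of f x, a jump puts the value followed on one of them, and all
    later averages are within 2 of it, below the threshold. So at most one more jump can occur. *)
Lemma refv_eventually : {ae leb, forall x, exists K, forall k, (K <= k)%N ->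
  refv k x = refv K x /\ `|f x - refv K x| <= 5}.
Proof.
apply: (ae_leb_impl cavg_cvg) => x cx.
have /cvgrPdist_lt/(_ 1 ltr01) [K0 _ hK0] := cx.
have [K hK] : exists K, forall k, (K <= k)%N -> refv k x = refv K x.
  have [[K1 [K01 hit1]]|nohit] := pselect (exists K1, (K0 <= K1)%N /\ hit r o f K1.+1 x).
    have e1 : refv K1.+1 x = cavg K1.+1 x by move: hit1 => /= ->.
    exists K1.+1 => k; elim: k => [//|k IH]; rewrite leq_eqVlt => /predU1P[<-//|].
    rewrite ltnS => Kk /=; rewrite IH// e1; case: ltP => // h5; exfalso.
    move: h5; apply/negP; rewrite -leNgt.
    have := hK0 k.+1 (leq_trans K01 (leqW (ltnW Kk))).
    have := hK0 K1.+1 (leqW K01); rewrite /= => a b.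
    rewrite (_ : _ - _ = (f x - cavg K1.+1 x) - (f x - cavg k.+1 x)); last by ring.
    by rewrite (le_trans (ler_normB _ _))// (le_trans (lerD (ltW a) (ltW b)))//; lra.
  exists K0 => k; elim: k => [|k IH]; first by rewrite leqn0 => /eqP ->.
  rewrite leq_eqVlt => /predU1P[<-//|]; rewrite ltnS => Kk; rewrite -IH//=.
  case: ifPn => // h; exfalso; apply: nohit; exists k; split => //.
exists K => k Kk; split; first exact: hK.
apply/ler_addgt0Pr => e e0.
have /cvgrPdist_lt/(_ e e0) [K2 _ hK2] := cx.
have := hK2 (maxn K K2) (leq_maxr _ _); rewrite /= => h.
rewrite -(hK (maxn K K2) (leq_maxl _ _)).
rewrite (_ : _ - _ = - (refv (maxn K K2) x - cavg (maxn K K2) x) + (f x - cavg (maxn K K2) x)); last by ring.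
rewrite (le_trans (ler_normD _ _))// normrN lerD ?(ltW h)//.
exact: refv_near.
Qed.

End limit_of_reference.

(** * Translated grids *)

Section shifted_grids.
Context {R : realType} (r : R) (r0 : 0 < r) (N : nat) (N_odd : odd N).
Implicit Types (x y : R) (k : nat) (i : 'I_N).

Definition goff i : R := i%:R * r / N%:R.

Let N0 : (0 < N)%N. Proof. by case: N N_odd. Qed.
Let NR0 : 0 < N%:R :> R. Proof. by rewrite ltr0n. Qed.

(** In units of scale r k / N, node z of grid i at generation k is the integer i 2^k + N z. The
    position of x relative to all N grids is thus read off a single floor. *)
Lemma goff_idx i k x (z : int) : (z <= cidx r (goff i) k x) =
  (i%:Z * 2 ^+ k + N%:Z * z <= Num.floor (N%:R * x / scale r k)).
Proof.
rewrite /cidx !floor_ge_int; have s0 := scale_gt0 k r0.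
rewrite ler_pdivlMr// [in RHS]ler_pdivlMr// -(ler_pM2l NR0) mulrBr lerBrDr.
congr (_ <= _); rewrite intrD !intrM rmorphXn/= /goff /scale -!pmulrn.
by field; rewrite expf_neq0//= gt_eqF.
Qed.

Lemma goff_inj k (i j : 'I_N) (z w : int) :
  i%:Z * 2 ^+ k + N%:Z * z = j%:Z * 2 ^+ k + N%:Z * w -> i = j.
Proof.
move=> h; have : (N%:Z %| (i%:Z - j%:Z) * 2 ^+ k)%Z.
  by apply/dvdzP; exists (w - z); rewrite mulrBl; lia.
rewrite Gauss_dvdzl; last by rewrite coprimezXr// coprimezE/= coprimen2.
move=> /dvdzP[/= q0 hq]; apply: val_inj => /=; have := ltn_ord i; have := ltn_ord j.
move: hq; set q : int := q0 => hq jN iN.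
have [q1|[q1|q1]] : (q = 0 \/ 1 <= q \/ q <= -1)%R by lia.
- by move: hq; rewrite q1; lia.
- by nia.
- by nia.
Qed.

(* As 2 is invertible modulo the odd N, the nodes of the N translated grids of mesh
   [scale r k] are those of one grid of mesh [scale r k / N], each taken once. *)
Lemma grid_count k x y : x <= y ->
  \sum_(i < N) (cidx r (goff i) k x != cidx r (goff i) k y)%:R
    <= N%:R * (y - x) / scale r k + 1 :> R.
Proof.
move=> xy; have s0 := scale_gt0 k r0.
pose u := N%:R * x / scale r k; pose v := N%:R * y / scale r k.
have uv : u <= v by rewrite /u /v ler_pM2r ?invr_gt0// ler_pM2l.
have fuv : Num.floor u <= Num.floor v by exact: le_floor.
pose D := `|Num.floor v - Num.floor u|%N.
have DE : D%:Z = Num.floor v - Num.floor u by rewrite /D; lia.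
have DR : D%:R <= N%:R * (y - x) / scale r k + 1 :> R.
  rewrite mulrBr mulrBl -/u -/v -[D%:R]/(D%:Z%:~R) DE intrB.
  have := floor_itv u; have := floor_itv v; rewrite intrD => /andP[a b] /andP[].
  by rewrite intrD; lra.
apply: le_trans DR; rewrite -natr_sum ler_nat.
pose E (i : 'I_N) : int := i%:Z * 2 ^+ k + N%:Z * cidx r (goff i) k y.
pose A := [pred i | cidx r (goff i) k x != cidx r (goff i) k y].
have hE i : i \in A -> Num.floor u < E i <= Num.floor v.
  rewrite inE => ne; rewrite /E -goff_idx lexx andbT ltNge -goff_idx.
  have : cidx r (goff i) k x <= cidx r (goff i) k y.
    by rewrite /cidx le_floor// ler_pM2r ?invr_gt0// lerD2r.
  by rewrite le_eqVlt (negbTE ne)/= ltNge.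
rewrite (_ : (\sum_(i < N) _)%N = size [seq absz (E i - Num.floor u - 1)%R | i <- enum A]); last first.
  rewrite size_map -cardE -sum1_card [RHS]big_mkcond; apply: eq_bigr => i _.
  by rewrite inE; case: (_ != _).
rewrite -(size_iota 0 D); apply: uniq_leq_size.
  rewrite map_inj_in_uniq ?enum_uniq// => i j; rewrite !mem_enum => /hE hi /hE hj ij.
  by apply: (@goff_inj k i j (cidx r (goff i) k y) (cidx r (goff j) k y)); rewrite -/(E i) -/(E j); lia.
by move=> _ /mapP[i /[!mem_enum] /hE hi ->]; rewrite mem_iota; lia.
Qed.

Lemma grid_countC k x y :
  \sum_(i < N) (cidx r (goff i) k x != cidx r (goff i) k y)%:R
    <= N%:R * `|x - y| / scale r k + 1 :> R.
Proof.
have [xy|yx] := leP x y; first by rewrite ler0_norm ?subr_le0// opprB grid_count.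
rewrite gtr0_norm ?subr_gt0//; under eq_bigr do rewrite eq_sym.
by rewrite grid_count// ltW.
Qed.

End shifted_grids.

(** * Gaussian convolution *)

Section gaussian.
Context {R : realType}.
Implicit Types (s x y u h d M : R) (b : R -> R).
Local Notation leb := (@lebesgue_measure R).

Definition gk s x y : R := normal_pdf x s y.

Lemma gkE s x y : 0 < s ->
  gk s x y = normal_peak s * expR (- ((y - x) / s) ^+ 2 / 2).
Proof.
move=> s0; rewrite /gk normal_pdfE ?gt_eqF// /normal_fun; congr (_ * expR _).
by field; rewrite gt_eqF.
Qed.

Lemma normal_peak2 s : 0 < s -> normal_peak s = 2 * normal_peak (2 * s).
Proof.
move=> s0; rewrite /normal_peak.
rewrite (_ : (2 * s) ^+ 2 * pi *+ 2 = 2 ^+ 2 * (s ^+ 2 * pi *+ 2)); last first.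
  by rewrite exprMn -mulrA mulrnAr.
by rewrite sqrtrM ?exprn_ge0// sqrtr_sqr ger0_norm// invfM mulrA mulfV ?mul1r.
Qed.

Lemma normal_peak_le s : 0 < s -> normal_peak s <= s^-1.
Proof.
move=> s0; rewrite /normal_peak lef_pV2 ?posrE ?sqrtr_gt0 ?mulrn_wgt0 ?mulr_gt0 ?pi_gt0 ?exprn_gt0//.
rewrite -[leLHS](ger0_norm (ltW s0)) -sqrtr_sqr ler_wsqrtr// -mulrnAr.
by rewrite ler_peMr ?sqr_ge0// mulr2n; have := @pi_ge2 R; lra.
Qed.

Lemma gk_sym s x y : 0 < s -> gk s x y = gk s y x.
Proof. by move=> s0; rewrite !gkE//; congr (_ * expR _); field; rewrite gt_eqF. Qed.

Lemma gk_ge0 s x y : 0 <= gk s x y. Proof. exact: normal_pdf_ge0. Qed.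
Hint Resolve gk_ge0 : core.

Lemma gk_ub s x y : 0 < s -> gk s x y <= s^-1.
Proof.
move=> s0; rewrite (le_trans (normal_pdf_ub _ _ _)) ?gt_eqF//.
exact: normal_peak_le.
Qed.

Lemma measurable_gk s x : measurable_fun [set: R] (gk s x).
Proof. exact: measurable_normal_pdf. Qed.

Lemma measurable_gk2 s : 0 < s ->
  measurable_fun [set: R * R] (fun p => gk s p.1 p.2).
Proof.
move=> s0; rewrite (_ : (fun p => _) =
  (fun p => normal_peak s * expR (- ((p.2 - p.1) / s) ^+ 2 / 2))); last first.
  by apply/funext => p; rewrite gkE.
apply: measurable_funM => //; apply: measurableT_comp => //.
apply: measurable_funM => //; apply: measurableT_comp => //.
apply: measurable_funX; apply: measurable_funM => //.
exact: measurable_funB.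
Qed.

Lemma int_gk s x : 0 < s -> (\int[leb]_y (gk s x y)%:E = 1)%E.
Proof. by move=> s0; rewrite integral_normal_pdf. Qed.

Lemma int_gk_le1 (D : set R) s x : 0 < s -> measurable D ->
  (\int[leb]_(y in D) (gk s x y)%:E <= 1)%E.
Proof.
move=> s0 mD; rewrite -(int_gk x s0); apply: ge0_subset_integral => //.
  by apply: measurable_funEFin; exact: measurable_gk.
by move=> y _; rewrite lee_fin.
Qed.

(** With u = (y - x) / s the ratio of the two Gaussians is 2 exp (- 3 u^2 / 8), and exp (- v) <= 1 /
    v gives the factor 16 / 3 <= 6. A Gaussian is kept on the right so that the bound can be
    integrated in y. *)
Lemma gk_tail s x y d : 0 < s -> 0 < d -> d <= `|x - y| ->
  gk s x y <= 6 * (s / d) ^+ 2 * gk (2 * s) x y.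
Proof.
move=> s0 d0 dxy; have s20 : 0 < 2 * s by rewrite mulr_gt0.
rewrite !gkE// normal_peak2//.
set p := normal_peak _; have p0 : 0 <= p by exact: normal_peak_ge0.
have -> : (y - x) / (2 * s) = (y - x) / s / 2 by field; rewrite gt_eqF.
set u := (y - x) / s.
have du : (d / s) ^+ 2 <= u ^+ 2.
  rewrite -[leRHS]real_normK ?num_real// /u normrM normfV (gtr0_norm s0) distrC.
  by rewrite ler_pXn2r ?nnegrE ?divr_ge0// ?(ltW d0) ?(ltW s0)// ler_pM2r ?invr_gt0.
have ds0 : 0 < (d / s) ^+ 2 by rewrite exprn_gt0// divr_gt0.
have -> : (s / d) ^+ 2 = ((d / s) ^+ 2)^-1 by rewrite -exprVn invf_div.
set q := (d / s) ^+ 2 in du ds0 *.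
have -> : - u ^+ 2 / 2 = - (u / 2) ^+ 2 / 2 - (3 / 8) * u ^+ 2 by field.
rewrite expRD; set e := expR (- (u / 2) ^+ 2 / 2); have e0 : 0 <= e by exact: expR_ge0.
have h : expR (- (3 / 8 * u ^+ 2)) <= 8 / 3 * q^-1.
  rewrite expRN -[leRHS]invrK lef_pV2 ?posrE ?expR_gt0 ?invr_gt0 ?mulr_gt0 ?invr_gt0//.
  rewrite invfM invrK invf_div (le_trans _ (expR_ge1Dx _))//.
  have : 3 / 8 * q <= 3 / 8 * u ^+ 2 by rewrite ler_wpM2l.
  lra.
apply: (@le_trans _ _ (2 * p * (e * (8 / 3 * q^-1)))).
  by rewrite ler_wpM2l ?mulr_ge0// ler_wpM2l.
rewrite (_ : 2 * p * _ = (p * e * q^-1) * (16 / 3)); last by field; rewrite gt_eqF.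
rewrite (_ : 6 / q * _ = (p * e * q^-1) * 6); last by field; rewrite gt_eqF.
by rewrite ler_wpM2l ?mulr_ge0 ?invr_ge0 ?(ltW ds0)//; lra.
Qed.

Lemma int_gk_tail (D : set R) s x d : 0 < s -> 0 < d -> measurable D ->
  (forall y, D y -> d <= `|x - y|) ->
  (\int[leb]_(y in D) (gk s x y)%:E <= (6 * (s / d) ^+ 2)%:E)%E.
Proof.
move=> s0 d0 mD hD.
apply: (@le_trans _ _ (\int[leb]_(y in D) (6 * (s / d) ^+ 2 * gk (2 * s) x y)%:E)%E).
  apply: le_intL => //; first exact: measurable_gk.
    by apply: measurable_funM => //; exact: measurable_gk.
  by move=> y /hD h; rewrite gk_ge0/= gk_tail.
have c0 : 0 <= 6 * (s / d) ^+ 2 by rewrite mulr_ge0// exprn_ge0// divr_ge0// ltW.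
rewrite intLZ//; last exact: measurable_gk.
by rewrite -[leRHS]mule1 lee_wpmul2l// int_gk_le1// mulr_gt0.
Qed.

(** Mean value inequality for the exponential. The linear factor |u + h / 2| is absorbed by exp (u^2
    / 8), which still leaves a Gaussian of twice the width. *)
Lemma expR_sub_le u h : `|h| <= 1 ->
  `|expR (- (u + h) ^+ 2 / 2) - expR (- u ^+ 2 / 2)|
     <= 8 * `|h| * expR (- (u / 2) ^+ 2 / 2).
Proof.
move=> h1.
have key (a c : R) : `|expR a - expR c| <= `|a - c| * expR (Num.max a c).
  wlog ac : a c / c <= a.
    by move=> H; case/orP: (le_total c a) => [/H//|/H]; rewrite (distrC (expR c)) (distrC c) maxC.
  rewrite (max_l ac) !ger0_norm ?subr_ge0 ?ler_expR//.
  have : expR c = expR a * expR (c - a) by rewrite -expRD addrC subrK.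
  move=> ->; have := expR_ge1Dx (c - a); have := expR_ge0 a; nra.
apply: le_trans (key _ _) _.
have -> : - (u + h) ^+ 2 / 2 - - u ^+ 2 / 2 = - (h * (u + h / 2)) by field.
rewrite normrN normrM mulrAC [8 * _]mulrC -!mulrA ler_wpM2l//.
have hmax : Num.max (- (u + h) ^+ 2 / 2) (- u ^+ 2 / 2) <= - u ^+ 2 / 4 + 2^-1.
  have := normr_ge0 h; move: h1; rewrite ler_norml ge_max => /andP[h1 h2] _.
  have a1 := sqr_ge0 (u + 2 * h); have a2 : h ^+ 2 <= 1 by nra.
  by have a3 := sqr_ge0 u; apply/andP; split; nra.
have hu : `|u + h / 2| <= 4 * (1 + u ^+ 2 / 8).
  move: h1; rewrite !ler_norml => /andP[h1 h2]; apply/andP; split; nra.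
have e1 : 1 + u ^+ 2 / 8 <= expR (u ^+ 2 / 8) by exact: expR_ge1Dx.
have e2 : expR (2^-1 : R) <= 2.
  have := expR_ge1Dx (- 2^-1 : R); rewrite expRN => h2.
  by rewrite -[leRHS]invrK -[leLHS]invrK lef_pV2 ?posrE ?invr_gt0 ?expR_gt0//; lra.
apply: (@le_trans _ _ ((expR (- u ^+ 2 / 4) * 2) * (4 * expR (u ^+ 2 / 8)))).
  rewrite ler_pM ?expR_ge0//; last by rewrite (le_trans hu)// ler_pM2l.
  rewrite (le_trans (_ : _ <= expR (- u ^+ 2 / 4 + 2^-1))) ?ler_expR//.
  by rewrite expRD ler_pM2l ?expR_gt0.
rewrite (_ : _ * _ * _ = 8 * (expR (u ^+ 2 / 8) * expR (- u ^+ 2 / 4))); last by ring.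
by rewrite -expRD ler_pM2l// ler_expR; lra.
Qed.

Lemma gk_sub_le s x x' y : 0 < s -> `|x - x'| <= s ->
  `|gk s x y - gk s x' y| <= 16 * (`|x - x'| / s) * gk (2 * s) x y.
Proof.
move=> s0 xs; have s20 : 0 < 2 * s by rewrite mulr_gt0.
rewrite !gkE// normal_peak2//.
set p := normal_peak _; have p0 : 0 <= p by exact: normal_peak_ge0.
have -> : (y - x) / (2 * s) = (y - x) / s / 2 by field; rewrite gt_eqF.
have -> : (y - x') / s = (y - x) / s + (x - x') / s by ring.
rewrite -mulrBr normrM ger0_norm ?mulr_ge0// distrC.
apply: (@le_trans _ _ (2 * p * (8 * `|(x - x') / s| * expR (- ((y - x) / s / 2) ^+ 2 / 2)))).
  rewrite ler_wpM2l ?mulr_ge0// expR_sub_le// normrM normfV (gtr0_norm s0).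
  by rewrite ler_pdivrMr// mul1r.
by rewrite normrM normfV (gtr0_norm s0) le_eqVlt; apply/orP; left; apply/eqP; ring.
Qed.

Lemma int_gk_sub s x x' : 0 < s ->
  (\int[leb]_y `|gk s x y - gk s x' y|%:E <= (16 * (`|x - x'| / s))%:E)%E.
Proof.
move=> s0; have msub : measurable_fun [set: R] (fun y => `|gk s x y - gk s x' y|).
  by apply: measurableT_comp => //; apply: measurable_funB; exact: measurable_gk.
have [xs|/ltW xs] := leP `|x - x'| s.
  apply: (@le_trans _ _ (\int[leb]_y (16 * (`|x - x'| / s) * gk (2 * s) x y)%:E)%E).
    apply: le_intL => //.
      by apply: measurable_funM => //; exact: measurable_gk.
    by move=> y _; rewrite normr_ge0/= gk_sub_le.
  have c0 : 0 <= 16 * (`|x - x'| / s) by rewrite mulr_ge0// divr_ge0// ltW.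
  rewrite intLZ//; last exact: measurable_gk.
  by rewrite int_gk ?mulr_gt0// mule1.
apply: (@le_trans _ _ (\int[leb]_y (gk s x y + gk s x' y)%:E)%E).
  apply: le_intL => //; first by apply: measurable_funD; exact: measurable_gk.
  move=> y _; rewrite normr_ge0/= (le_trans (ler_normB _ _))//.
  by rewrite !ger0_norm.
rewrite intLD//; [|exact: measurable_gk|exact: measurable_gk].
rewrite !int_gk// -EFinD lee_fin.
have : 1 <= `|x - x'| / s by rewrite ler_pdivlMr// mul1r.
lra.
Qed.

Definition gconv s b x : R := \int[leb]_y (gk s x y * b y).

Lemma integrable_gk_mul s x b M : 0 < s -> measurable_fun [set: R] b ->
  (forall y, `|b y| <= M) ->
  leb.-integrable [set: R] (EFin \o (fun y => gk s x y * b y)).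
Proof.
move=> s0 mb bM; have ig : leb.-integrable [set: R] (EFin \o (fun y => M * gk s x y)).
  under [X in _.-integrable _ X]eq_fun do rewrite /= EFinM.
  by apply: integrableZl => //; exact: integrable_normal_pdf.
apply: le_integrable ig => //.
  apply/measurable_EFinP; apply: measurable_funM => //; exact: measurable_gk.
move=> y _ /=; rewrite lee_fin !normrM mulrC ler_wpM2r//.
by rewrite (le_trans (bM y))// ler_norm.
Qed.

Lemma gconv_dist s b M x (c : R) : 0 < s -> measurable_fun [set: R] b ->
  (forall y, `|b y| <= M) ->
  (`|c - gconv s b x|%:E <= \int[leb]_y (gk s x y * `|c - b y|)%:E)%E.
Proof.
move=> s0 mb bM; have mc : measurable_fun [set: R] (fun y => c - b y).
  exact: measurable_funB.
have cM y : `|c - b y| <= `|c| + M.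
  by rewrite (le_trans (ler_normB _ _))// lerD2l.
have ic : leb.-integrable [set: R] (EFin \o (fun y => gk s x y * c)).
  by apply: (@integrable_gk_mul _ _ (cst c) `|c|).
have -> : c - gconv s b x = \int[leb]_y (gk s x y * (c - b y)).
  under [RHS]eq_Rintegral do rewrite mulrBr.
  rewrite RintegralB//; last exact: integrable_gk_mul bM.
  congr (_ - _); rewrite RintegralZr//; last exact: integrable_normal_pdf.
  by rewrite /Rintegral int_gk//= mul1r.
have icb := integrable_gk_mul x s0 mc cM.
rewrite EFin_normr_Rintegral//; apply: le_trans (le_abse_integral _ _ _) _ => //.
  by case/integrableP: icb.
apply: le_intL => //.
- apply: measurableT_comp => //; apply: measurable_funM => //; exact: measurable_gk.
- apply: measurable_funM; first exact: measurable_gk.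
  exact: measurableT_comp.
- by move=> y _; rewrite normr_ge0/= normrM ger0_norm.
Qed.

Lemma gconv_le s b M x : 0 < s -> measurable_fun [set: R] b ->
  (forall y, `|b y| <= M) ->
  (`|gconv s b x|%:E <= \int[leb]_y (gk s x y * `|b y|)%:E)%E.
Proof.
move=> s0 mb bM; have := gconv_dist x 0 s0 mb bM; rewrite sub0r normrN.
by under eq_integral do rewrite sub0r normrN.
Qed.

Lemma gconv_lip s b M x x' : 0 < s -> measurable_fun [set: R] b ->
  (forall y, `|b y| <= M) ->
  `|gconv s b x - gconv s b x'| <= 16 * M * (`|x - x'| / s).
Proof.
move=> s0 mb bM; have M0 : 0 <= M by exact: le_trans (bM 0).
have i1 := integrable_gk_mul x s0 mb bM.
have i2 := integrable_gk_mul x' s0 mb bM.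
rewrite /gconv -RintegralB//.
have isub : leb.-integrable [set: R] (EFin \o (fun y => gk s x y * b y - gk s x' y * b y)).
  by apply: eq_integrable (integrableB _ i1 i2).
have msub : measurable_fun [set: R] (fun y => `|gk s x y - gk s x' y|).
  by apply: measurableT_comp => //; apply: measurable_funB; exact: measurable_gk.
rewrite -lee_fin EFin_normr_Rintegral//.
apply: le_trans (le_abse_integral _ _ _) _ => //; first by case/integrableP: isub.
apply: (@le_trans _ _ (\int[leb]_y (M * `|gk s x y - gk s x' y|)%:E)%E).
  apply: le_intL => //.
  - apply: measurableT_comp => //; apply: measurable_funB => //.
      by apply: measurable_funM => //; exact: measurable_gk.
    by apply: measurable_funM => //; exact: measurable_gk.
  - exact: measurable_funM.
  - by move=> y _; rewrite normr_ge0/= -mulrBl normrM mulrC ler_wpM2r.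
rewrite intLZ//; apply: (@le_trans _ _ (M%:E * (16 * (`|x - x'| / s))%:E)%E).
  by rewrite lee_wpmul2l ?lee_fin// int_gk_sub.
by rewrite -EFinM lee_fin le_eqVlt; apply/orP; left; apply/eqP; ring.
Qed.

Lemma measurable_gconv s b M : 0 < s -> measurable_fun [set: R] b ->
  (forall y, `|b y| <= M) -> measurable_fun [set: R] (gconv s b).
Proof.
move=> s0 mb bM; apply: continuous_measurable_fun => x.
have M0 : 0 <= M by exact: le_trans (bM 0).
have C0 : 0 < 16 * (M + 1) / s by rewrite divr_gt0// mulr_gt0// ltr_wpDl.
apply/cvgrPdist_le => /= e e0; near=> x'.
apply: le_trans (gconv_lip x x' s0 mb bM) _.
apply: (@le_trans _ _ (16 * (M + 1) / s * `|x - x'|)).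
  rewrite -[leRHS]mulrA [s^-1 * _]mulrC ler_wpM2r ?divr_ge0 ?(ltW s0)//.
  by rewrite ler_pM2l// lerDl.
rewrite -ler_pdivlMl//; near: x'; apply: cvgr_dist_le.
  exact: cvg_id.
by rewrite mulr_gt0// invr_gt0.
Unshelve. all: by end_near. Qed.

End gaussian.

(** * Convolution error on one grid *)

Section sums.
Context {R : realType}.
Local Open Scope ereal_scope.

Lemma sume_le4 (rg : seq nat) (a b c d : nat -> \bar R) (M : R) :
  \sum_(k <- rg) a k <= M%:E -> \sum_(k <- rg) b k <= M%:E ->
  \sum_(k <- rg) c k <= M%:E -> \sum_(k <- rg) d k <= M%:E ->
  \sum_(k <- rg) (a k + (b k + (c k + d k))) <= (4 * M)%:E.
Proof.
move=> ha hb hc hd; rewrite !big_split/=.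
rewrite (_ : (4 * M)%:E = M%:E + (M%:E + (M%:E + M%:E))); last first.
  by rewrite -!EFinD; congr (_%:E); lra.
by rewrite !leeD.
Qed.

Lemma sume_le3 (rg : seq nat) (a b : nat -> \bar R) (c : nat -> R) (M : R) :
  \sum_(k <- rg) a k <= M%:E -> \sum_(k <- rg) b k <= M%:E ->
  \sum_(k <- rg) (a k + a k + (b k + (c k)%:E)) <=
    (M + M + (M + (\sum_(k <- rg) c k)%R)%R)%:E.
Proof.
by move=> ha hb; rewrite !big_split/= sumEFin !EFinD !leeD.
Qed.

Lemma leeD_err (A B X Y : \bar R) (u v : R) :
  A <= X + u%:E -> B <= Y + v%:E -> A + B <= X + (Y + (u + v)%R%:E).
Proof. by move=> h1 h2; rewrite EFinD addeA addeACA leeD. Qed.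

End sums.

Section tonelli.
Context {R : realType}.
Local Notation leb := (@lebesgue_measure R).
Local Open Scope ereal_scope.
Variables (h : R * R -> R) (mh : measurable_fun [set: R * R] h).
Hypothesis h0 : forall p, (0 <= h p)%R.

Let mhI (D1 D2 : set R) : measurable D1 -> measurable D2 ->
  measurable_fun [set: R * R] (fun p => h p * \1_D1 p.1 * \1_D2 p.2)%R.
Proof.
move=> m1 m2; apply: measurable_funM; first apply: measurable_funM => //.
  have mi : measurable_fun [set: R] (\1_D1 : R -> R) by exact: measurable_indic.
  exact: (measurableT_comp mi).
have mi : measurable_fun [set: R] (\1_D2 : R -> R) by exact: measurable_indic.
exact: (measurableT_comp mi).
Qed.

Let hI0 (D1 D2 : set R) p : (0 <= h p * \1_D1 p.1 * \1_D2 p.2)%R.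
Proof. by rewrite !mulr_ge0// (andP (indic01 _ _)).1. Qed.

Let int_indic (D1 D2 : set R) x : measurable D1 -> measurable D2 ->
  ((fun x => \int[leb]_(y in D2) (h (x, y))%:E) \_ D1) x =
  \int[leb]_y (h (x, y) * \1_D1 x * \1_D2 y)%:E.
Proof.
move=> m1 m2; rewrite /patch; case: ifPn => xD.
  rewrite integral_mkcond; apply: eq_integral => y _.
  rewrite /patch !indicE xD mulr1; case: (y \in D2); by rewrite ?mulr1 ?mulr0.
under eq_integral do rewrite [\1_D1 x]indicE (negbTE xD) mulr0 mul0r.
by rewrite integral0.
Qed.

Let int_indic' (D1 D2 : set R) y : measurable D1 -> measurable D2 ->
  ((fun y => \int[leb]_(x in D1) (h (x, y))%:E) \_ D2) y =
  \int[leb]_x (h (x, y) * \1_D1 x * \1_D2 y)%:E.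
Proof.
move=> m1 m2; rewrite /patch; case: ifPn => yD.
  rewrite integral_mkcond; apply: eq_integral => x _.
  rewrite /patch !indicE yD mulr1; case: (x \in D1); by rewrite ?mulr1 ?mulr0.
under eq_integral do rewrite [\1_D2 y]indicE (negbTE yD) mulr0.
by rewrite integral0.
Qed.

Lemma tonelli_itv (D1 D2 : set R) : measurable D1 -> measurable D2 ->
  \int[leb]_(x in D1) \int[leb]_(y in D2) (h (x, y))%:E =
  \int[leb]_(y in D2) \int[leb]_(x in D1) (h (x, y))%:E.
Proof.
move=> m1 m2; rewrite integral_mkcond [RHS]integral_mkcond.
under eq_integral do rewrite int_indic//.
under [RHS]eq_integral do rewrite int_indic'//.
apply: (fubini_tonelli (m1 := leb) (m2 := leb)
  (fun p => (h p * \1_D1 p.1 * \1_D2 p.2)%:E)).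
  by apply/measurable_EFinP; exact: mhI.
by move=> p; rewrite lee_fin ?gk_ge0.
Qed.

Lemma measurable_int_itv (D : set R) : measurable D ->
  measurable_fun [set: R] (fun x => \int[leb]_(y in D) (h (x, y))%:E).
Proof.
move=> mD; have := measurable_fun_fubini_tonelli_F (m2 := leb)
  (fun p => (h p * \1_[set: R] p.1 * \1_D p.2)%:E).
move=> H; rewrite (_ : (fun x => _) = fun x => \int[leb]_y (h (x, y) * \1_[set: R] x * \1_D y)%:E).
  apply: H; last by move=> p; rewrite lee_fin ?gk_ge0.
  by apply/measurable_EFinP; exact: mhI.
by apply/funext => x; rewrite -int_indic// /patch mem_set.
Qed.

End tonelli.

Section single_grid_tail.
Context {R : realType} (r o : R) (r0 : 0 < r) (f : R -> R) (fB : lbmo r 1 f).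
Variables (eta : R) (eta01 : 0 < eta <= 1).
Implicit Types (x y : R) (j k n m : nat).
Local Notation leb := (@lebesgue_measure R).
Local Notation cidx := (cidx r o).
Local Notation cell := (cell r o).
Local Notation cleft := (cleft r o).
Local Notation inc := (inc r o f).
Local Notation lost := (lost r o f).
Local Notation kept := (kept r o f).
Local Notation s := (scale r).
#[local] Hint Extern 0 (measurable (ico _ _)) => solve [exact: measurable_ico] : core.
#[local] Hint Extern 0 (measurable (Submission.cell _ _ _ _)) => solve [exact: measurable_cell] : core.
#[local] Hint Resolve gk_ge0 : core.

Let s0 k : 0 < s k. Proof. exact: scale_gt0. Qed.
Let e0 : 0 < eta. Proof. by case/andP: eta01. Qed.
Let e1 : eta <= 1. Proof. by case/andP: eta01. Qed.

(** The Gaussian width of generation k. At distance eta * s k the tail is of order eta^2, while the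
    points that close to a cell boundary fill a fraction 2 * eta of the cell. *)
Definition sg k : R := eta ^+ 2 * s k.

Lemma sg_gt0 k : 0 < sg k. Proof. by rewrite mulr_gt0// exprn_gt0. Qed.
Hint Resolve sg_gt0 : core.

Let cw k (p : R * R) : R := (cidx k p.1 != cidx k p.2)%:R.

Let measurable_cw k : measurable_fun [set: R * R] (cw k).
Proof.
have mc : measurable_fun [set: R] (fun x => (cidx k x)%:~R : R).
  by apply: (@cellwise_measurable _ r o r0 _ _ k) => x y ->.
have md : measurable_fun [set: R * R] (fun p => (cidx k p.1)%:~R - (cidx k p.2)%:~R : R).
  apply: measurable_funB; first exact: (measurableT_comp mc).
  exact: (measurableT_comp mc).
rewrite (_ : cw k = \1_((fun p => (cidx k p.1)%:~R - (cidx k p.2)%:~R : R) @^-1` (~` [set 0]))).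
  apply: measurable_indic; rewrite -[X in measurable X]setTI; apply: md => //.
  exact: measurableC.
apply/funext => p; rewrite /cw indicE; congr (_%:R).
have -> : (p \in (fun p => (cidx k p.1)%:~R - (cidx k p.2)%:~R : R) @^-1` (~` [set 0])) =
    ((cidx k p.1)%:~R - (cidx k p.2)%:~R != 0 :> R).
  by apply/idP/idP => [/set_mem/= /eqP|/eqP h]//; apply/mem_set.
by rewrite subr_eq0 eqr_int.
Qed.

Let cw01 k p : 0 <= cw k p <= 1.
Proof. by rewrite /cw; case: (_ != _); rewrite ?lexx ?ler01. Qed.
Let cw0 k p : 0 <= cw k p. Proof. by case/andP: (cw01 k p). Qed.

Definition spill k x : \bar R := (\int[leb]_y (gk (sg k) x y * cw k (x, y))%:E)%E.

Let mgw k : measurable_fun [set: R * R] (fun p => gk (sg k) p.1 p.2 * cw k p).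
Proof. apply: measurable_funM => //; exact: (measurable_gk2 (sg_gt0 k)). Qed.

Let gw0 k p : 0 <= gk (sg k) p.1 p.2 * cw k p.
Proof. by rewrite mulr_ge0 ?gk_ge0 ?cw0. Qed.

Let msl (h : R * R -> R) x : measurable_fun [set: R * R] h ->
  measurable_fun [set: R] (fun y => h (x, y)).
Proof. by move=> mh; apply: measurableT_comp => //; exact: measurable_pair1. Qed.

Lemma measurable_spill k : measurable_fun [set: R] (spill k).
Proof. exact: (measurable_int_itv (mgw k) (gw0 k) measurableT). Qed.

Lemma spill_ge0 k x : (0 <= spill k x)%E.
Proof. by apply: integral_ge0 => y _; rewrite lee_fin (gw0 k (x, y)). Qed.

Lemma spill_le1 k x : (spill k x <= 1)%E.
Proof.
rewrite -(int_gk x (sg_gt0 k)); apply: le_intL => //.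
- exact: (msl x (mgw k)).
- exact: measurable_gk.
- by move=> y _; rewrite (gw0 k (x, y))/= ler_piMr ?gk_ge0// (andP (cw01 _ _)).2.
Qed.

Lemma spill_center k x : cleft k x + eta * s k <= x ->
  x + eta * s k <= cleft k x + s k -> (spill k x <= (6 * eta ^+ 2)%:E)%E.
Proof.
move=> h1 h2; have d0 : 0 < eta * s k by rewrite mulr_gt0.
apply: (@le_trans _ _ (\int[leb]_(y in ~` cell k x) (gk (sg k) x y)%:E)%E).
  rewrite /spill [leRHS]integral_mkcond; apply: ge0_le_integral => //.
  - by move=> y _; rewrite lee_fin (gw0 k (x, y)).
  - by apply/measurable_EFinP; exact: (msl x (mgw k)).
  - apply/(measurable_restrictT _ _).1; first exact: measurableC.
    by apply: measurable_funEFin; exact: measurable_gk.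
  - move=> y _; rewrite /patch /cw/=; case: ifPn => [_|].
      by rewrite lee_fin ler_piMr ?gk_ge0//; case: (_ != _).
    rewrite in_setC negbK inE => /(cellP _ r0) ->.
    by rewrite eqxx/= mulr0.
apply: le_trans (int_gk_tail (d := eta * s k) _ _ _ _) _ => //.
- exact: measurableC.
- move=> y; rewrite /cell/= in_itv/= => /negP; rewrite negb_and -ltNge -leNgt.
  move=> /orP[h|h]; first by rewrite ler_normr; apply/orP; left; lra.
  by rewrite ler_normr; apply/orP; right; lra.
- rewrite lee_fin /sg (_ : _ / _ = eta)//; by field; rewrite !gt_eqF.
Qed.

Local Open Scope ereal_scope.

(** The tail estimate in the middle of the cell, and the trivial bound 1 on two boundary strips of
    width eta * s k: 6 * eta^2 + 2 * eta <= 8 * eta. *)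
Lemma int_spill k x : \int[leb]_(y in cell k x) spill k y <= (8 * eta * s k)%:E.
Proof.
pose L := cleft k x; have es : (0 < eta * s k)%R by rewrite mulr_gt0.
pose b y : R := (6 * eta ^+ 2 + (\1_(ico L (eta * s k)) y
   + \1_(ico (L + s k - eta * s k) (eta * s k)) y))%R.
have i1 (A : set R) y : (0 <= (\1_A y : R))%R by case/andP: (indic01 A y).
have mb : measurable_fun [set: R] b.
  apply: measurable_funD => //; apply: measurable_funD; exact: measurable_indic.
have c0 : (0 <= 6 * eta ^+ 2)%R by rewrite mulr_ge0// exprn_ge0// ltW.
have b0 y : (0 <= b y)%R by rewrite !addr_ge0.
apply: (@le_trans _ _ (\int[leb]_(y in cell k x) (b y)%:E)).
  apply: ge0_le_integral => //.
  - by move=> y _; exact: spill_ge0.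
  - by apply: measurable_funTS; exact: measurable_spill.
  - exact: measurable_funEFin.
  - move=> y yc; have yL : cleft k y = L by apply: cleft_idx; exact/(cellP _ r0).
    move: yc; rewrite /cell/= in_itv/= -/L => /andP[ya yb].
    have [h1|h1] := leP (L + eta * s k)%R y; last first.
      apply: le_trans (spill_le1 k y) _; rewrite lee_fin /b.
      rewrite [X in (_ <= _ + (X + _))%R]indicE mem_set /ico/= ?in_itv/= ?ya//.
      by rewrite addrCA lerDl addr_ge0.
    have [h2|h2] := leP (y + eta * s k)%R (L + s k)%R.
      by apply: le_trans (spill_center _ _) _; rewrite ?yL// lee_fin /b lerDl addr_ge0.
    apply: le_trans (spill_le1 k y) _; rewrite lee_fin /b.
    rewrite [X in (_ <= _ + (_ + X))%R]indicE mem_set /ico/= ?in_itv/=.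
      by rewrite addrA lerDr addr_ge0.
    by rewrite subrK yb andbT; lra.
rewrite /b intLD//; last by apply: measurable_funD; exact: measurable_indic.
rewrite intL_cst// leb_cell// intLD//.
rewrite !intL_indic//.
have hm u : leb (ico u (eta * s k) `&` cell k x) <= (eta * s k)%:E.
  by rewrite -(leb_itv u (ltW es)) le_measure// inE//; exact: measurableI.
apply: (@le_trans _ _ ((6 * eta ^+ 2)%:E * (s k)%:E + ((eta * s k)%:E + (eta * s k)%:E))).
  by rewrite leeD2l// leeD.
rewrite -EFinM -!EFinD lee_fin.
have : (eta ^+ 2 * s k <= eta * s k)%R.
  by rewrite ler_pM2r// expr2 ler_piMl// ltW.
lra.
Qed.

(** Whole cells, so that cell estimates can be added. They contain all points within s j of the
    interval of length s j starting at x; this takes a length 3 * s j, plus one more cell because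
    the left end is rounded down. *)
Definition hull j x : set R := ico (cleft j (x - s j)) (4 * s j).

Lemma measurable_hull j x : measurable (hull j x). Proof. exact: measurable_ico. Qed.
#[local] Hint Extern 0 (measurable (hull _ _)) => solve [exact: measurable_hull] : core.

Lemma hull_far j x0 x y : ico x0 (s j) x -> (~` hull j x0) y ->
  (s j <= `|x - y|)%R.
Proof.
rewrite /hull /ico/= !in_itv/= => /andP[a b] /negP; rewrite negb_and -ltNge -leNgt.
have := cell_refl o r0 j (x0 - s j)%R; rewrite /cell/= in_itv/= => /andP[c d].
move=> /orP[h|h]; first by rewrite ler_normr; apply/orP; left; lra.
by rewrite ler_normr; apply/orP; right; lra.
Qed.

Lemma sub_hull j x0 : ico x0 (s j) `<=` hull j x0.
Proof.
move=> x hx; apply: contrapT => h; have := hull_far hx h.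
by rewrite subrr normr0 leNgt s0.
Qed.

Lemma int_hull j x : exists z1 z2 z3 z4, forall h : R -> \bar R,
  measurable_fun [set: R] h -> (forall y, 0 <= h y) ->
  \int[leb]_(y in hull j x) h y =
   \int[leb]_(y in cell j z1) h y + (\int[leb]_(y in cell j z2) h y +
    (\int[leb]_(y in cell j z3) h y + \int[leb]_(y in cell j z4) h y)).
Proof.
pose L := cleft j (x - s j)%R.
have cL (n : nat) : cell j (L + n%:R * s j)%R = ico (L + n%:R * s j)%R (s j).
  rewrite /cell; congr (ico _ _); rewrite /Submission.cleft.
  rewrite (_ : cidx j _ = cidx j (x - s j) + n%:Z)%R.
    by rewrite /L /Submission.cleft intrD mulrDl addrA.
  apply/(cidxP _ r0); rewrite /L /Submission.cleft !intrD !mulrDl -pmulrn.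
  by have := s0 j; set a := (_%:~R * _)%R; set b := (_%:R * _)%R => sj; apply/andP; split; lra.
exists (L + 0%:R * s j)%R, (L + 1%:R * s j)%R, (L + 2%:R * s j)%R, (L + 3%:R * s j)%R.
move=> h mh h0; have split2 a l1 l2 : (0 <= l1)%R -> (0 <= l2)%R ->
   \int[leb]_(y in ico a (l1 + l2)%R) h y =
   \int[leb]_(y in ico a l1) h y + \int[leb]_(y in ico (a + l1)%R l2) h y.
  move=> l10 l20; have -> : ico a (l1 + l2)%R = ico a l1 `|` ico (a + l1)%R l2.
    by rewrite /ico addrA -itv_bndbnd_setU// bnd_simp lerDl.
  rewrite ge0_integral_setU//; first by apply: measurable_funS mh.
  apply/disj_setPS => y [/=]; rewrite /ico/= !in_itv/=.
  by move=> /andP[_ p] /andP[q _]; move: p; rewrite ltNge q.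
rewrite !cL /hull -/L mul0r addr0 mul1r.
rewrite (_ : 4 * s j = s j + (s j + (s j + s j)))%R; last by lra.
have sj := ltW (s0 j); rewrite !split2 ?addr_ge0//.
have -> : (L + 2 * s j = L + s j + s j)%R by ring.
by have -> : (L + 3 * s j = L + s j + s j + s j)%R by ring.
Qed.

Lemma sum_scale j n : (\sum_(j.+1 <= k < (j + n).+1) s k <= s j)%R.
Proof.
suff : (\sum_(j.+1 <= k < (j + n).+1) s k = s j - s (j + n))%R.
  by move=> ->; rewrite gerBl ltW.
elim: n => [|n IH]; first by rewrite addn0 big_geq ?subrr.
rewrite addnS big_nat_recr/= ?IH ?ltnS ?leq_addr//.
by rewrite [in LHS](scaleS r (j + n)) mulr2n; lra.
Qed.

(** Makes the far part of generation k linear in s k, so that the far parts of all generations after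
    j sum up to a multiple of s j. *)
Lemma sg_tail j k : (j <= k)%N -> (6 * (sg k / s j) ^+ 2 * s j <= 6 * eta * s k)%R.
Proof.
move=> jk; have kj : (s k <= s j)%R.
  rewrite /scale ler_pM2l// lef_pV2 ?posrE ?exprn_gt0//.
  by rewrite ler_weXn2l// ler1n.
rewrite /sg (_ : _ * s j = 6 * (eta ^+ 4 * (s k * (s k / s j))))%R; last first.
  by field; rewrite gt_eqF.
have ek : (eta ^+ 4 <= eta)%R by rewrite exprS ler_piMr ?(ltW e0)// exprn_ile1// ltW.
have sk : (s k * (s k / s j) <= s k)%R.
  by rewrite ler_piMr ?(ltW (s0 k))// ler_pdivrMr// mul1r.
rewrite -[leRHS]mulrA ler_pM2l//; apply: ler_pM => //; first by rewrite exprn_ge0// ltW.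
by apply: mulr_ge0; [|apply: divr_ge0]; exact: ltW.
Qed.

Lemma int_far j k x0 : (j <= k)%N ->
  \int[leb]_(x in ico x0 (s j)) \int[leb]_(y in ~` hull j x0) (gk (sg k) x y)%:E
   <= (6 * eta * s k)%:E.
Proof.
move=> jk; have mC : measurable (~` hull j x0) by exact: measurableC.
apply: (@le_trans _ _ (\int[leb]_(x in ico x0 (s j)) (6 * (sg k / s j) ^+ 2)%:E)).
  apply: ge0_le_integral => //.
  - by move=> x _; apply: integral_ge0 => y _; rewrite lee_fin ?gk_ge0.
  - apply: measurable_funTS; apply: (measurable_int_itv (h := fun p => gk (sg k) p.1 p.2)) => //.
    exact: (measurable_gk2 (sg_gt0 k)).
  - by move=> x hx; apply: int_gk_tail => // y hy; exact: hull_far hx hy.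
by rewrite intL_cst// leb_itv ?(ltW (s0 _))// -EFinM lee_fin sg_tail.
Qed.

(** After exchanging the integrals, the Gaussian is integrated in x and contributes at most 1. *)
Lemma int_gk_near (D1 D2 : set R) k (b : R -> R) : measurable D1 -> measurable D2 ->
  measurable_fun [set: R] b -> (forall y, 0 <= b y)%R ->
  \int[leb]_(x in D1) \int[leb]_(y in D2) (gk (sg k) x y * b y)%:E
   <= \int[leb]_(y in D2) (b y)%:E.
Proof.
move=> m1 m2 mb b0.
have mh : measurable_fun [set: R * R] (fun p => gk (sg k) p.1 p.2 * b p.2)%R.
  by apply: measurable_funM; [exact: (measurable_gk2 (sg_gt0 k))|exact: (measurableT_comp mb)].
rewrite (tonelli_itv (h := fun p => gk (sg k) p.1 p.2 * b p.2)%R)//=; last first.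
  by move=> p; rewrite mulr_ge0 ?gk_ge0.
apply: ge0_le_integral => //.
- by move=> y _; apply: integral_ge0 => x _; rewrite lee_fin mulr_ge0 ?gk_ge0.
- apply: measurable_funTS.
  apply: (measurable_int_itv (h := fun p => gk (sg k) p.2 p.1 * b p.1)%R) => //.
    apply: measurable_funM; last exact: (measurableT_comp mb).
    rewrite (_ : (fun p => _) = (fun p => gk (sg k) p.1 p.2)); first exact: (measurable_gk2 (sg_gt0 k)).
    by apply/funext => p; rewrite gk_sym.
  by move=> p; rewrite mulr_ge0 ?gk_ge0.
- exact: measurable_funEFin.
- move=> y _; under eq_integral do rewrite mulrC gk_sym//.
  rewrite intLZ//; last exact: measurable_gk.
  by rewrite -[leRHS]mule1 lee_wpmul2l ?lee_fin// int_gk_le1.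
Qed.

Lemma int_far_le j k x0 (h : R * R -> R) (M : R) : (j <= k)%N ->
  measurable_fun [set: R * R] h ->
  (forall p, 0 <= h p <= gk (sg k) p.1 p.2 * M)%R ->
  \int[leb]_(x in ico x0 (s j)) \int[leb]_(y in ~` hull j x0) (h (x, y))%:E
   <= (6 * M * eta * s k)%:E.
Proof.
move=> jk mh hM; have h0 p : (0 <= h p)%R by case/andP: (hM p).
have M0 : (0 <= M)%R.
  have : (0 <= gk (sg k) 0 0 * M)%R by case/andP: (hM (0, 0)%R) => a b; exact: le_trans b.
  rewrite pmulr_rge0// gkE// mulr_gt0 ?expR_gt0//.
  by rewrite normal_peak_gt0// gt_eqF.
have mC : measurable (~` hull j x0) by exact: measurableC.
have mG : measurable_fun [set: R] (fun x => \int[leb]_(y in ~` hull j x0) (gk (sg k) x y)%:E).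
  apply: (measurable_int_itv (h := fun p => gk (sg k) p.1 p.2)) => //.
  exact: (measurable_gk2 (sg_gt0 k)).
apply: (@le_trans _ _ (\int[leb]_(x in ico x0 (s j)) (M%:E *
    \int[leb]_(y in ~` hull j x0) (gk (sg k) x y)%:E))).
  apply: ge0_le_integral => //.
  - by move=> x _; apply: integral_ge0 => y _; rewrite lee_fin.
  - by apply: measurable_funTS; exact: measurable_int_itv.
  - by apply: measurable_funTS; apply: emeasurable_funM.
  - move=> x _; rewrite -intLZ//; last exact: measurable_gk.
    apply: le_intL => //.
    + exact: (msl x mh).
    + by apply: measurable_funM => //; exact: measurable_gk.
    + by move=> y _; have := hM (x, y); rewrite /= mulrC.
rewrite ge0_integralZl_EFin//.
- rewrite (_ : 6 * M * eta * s k = M * (6 * eta * s k))%R; last by ring.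
  by rewrite [leRHS]EFinM lee_wpmul2l ?lee_fin// int_far.
- by move=> x _; apply: integral_ge0 => y _; rewrite lee_fin gk_ge0.
- exact: measurable_funTS.
Qed.

Lemma int_hull_split j k x0 (h : R * R -> R) (M : R) : (j <= k)%N ->
  measurable_fun [set: R * R] h ->
  (forall p, 0 <= h p <= gk (sg k) p.1 p.2 * M)%R ->
  \int[leb]_(x in ico x0 (s j)) \int[leb]_y (h (x, y))%:E <=
  \int[leb]_(x in ico x0 (s j)) \int[leb]_(y in hull j x0) (h (x, y))%:E
   + (6 * M * eta * s k)%:E.
Proof.
move=> jk mh hM; have h0 p : (0 <= h p)%R by case/andP: (hM p).
have mC : measurable (~` hull j x0) by exact: measurableC.
have -> : \int[leb]_(x in ico x0 (s j)) \int[leb]_y (h (x, y))%:E =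
   \int[leb]_(x in ico x0 (s j)) (\int[leb]_(y in hull j x0) (h (x, y))%:E +
   \int[leb]_(y in ~` hull j x0) (h (x, y))%:E).
  apply: eq_integral => x _; rewrite -ge0_integral_setU ?setUv//.
  - by apply/measurable_EFinP; exact: (msl x mh).
  - by move=> y _; rewrite lee_fin.
  - by apply/disj_setPCl.
rewrite ge0_integralD//.
- by apply: leeD => //; exact: int_far_le.
- by move=> x _; apply: integral_ge0 => y _; rewrite lee_fin.
- by apply: measurable_funTS; exact: measurable_int_itv.
- by move=> x _; apply: integral_ge0 => y _; rewrite lee_fin.
- by apply: measurable_funTS; exact: measurable_int_itv.
Qed.

Lemma sum_hull j x (rg : seq nat) (h : nat -> R -> \bar R) (M : R) :
  (forall k, measurable_fun [set: R] (h k)) -> (forall k y, 0 <= h k y) ->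
  (forall z, \sum_(k <- rg) \int[leb]_(y in cell j z) h k y <= M%:E) ->
  \sum_(k <- rg) \int[leb]_(y in hull j x) h k y <= (4 * M)%:E.
Proof.
move=> mh h0 hM; have [z1 [z2 [z3 [z4 hz]]]] := int_hull j x.
under eq_bigr do rewrite hz//.
exact: sume_le4.
Qed.

(** Majorant of the convolution error on one grid, from inc x - kept y = (inc x - inc y) + lost
    y. *)
Definition drift m k x : \bar R :=
  \int[leb]_y (gk (sg k) x y * (`|inc k x - inc k y| + `|lost m k y|))%:E.

Let minc2 k : measurable_fun [set: R * R] (fun p => `|inc k p.1 - inc k p.2|)%R.
Proof.
have mi := measurable_inc o r0 f k.
apply: measurableT_comp => //; apply: measurable_funB; exact: (measurableT_comp mi).
Qed.

Let mdr m k : measurable_fun [set: R * R]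
  (fun p => gk (sg k) p.1 p.2 * (`|inc k p.1 - inc k p.2| + `|lost m k p.2|))%R.
Proof.
apply: measurable_funM; first exact: (measurable_gk2 (sg_gt0 k)).
apply: measurable_funD => //; apply: measurableT_comp => //.
exact: (measurableT_comp (measurable_lost o r0 f m k)).
Qed.

Let dr0 m k p : (0 <= gk (sg k) p.1 p.2 * (`|inc k p.1 - inc k p.2| + `|lost m k p.2|))%R.
Proof. by rewrite mulr_ge0 ?gk_ge0 ?addr_ge0. Qed.

Lemma measurable_drift m k : measurable_fun [set: R] (drift m k).
Proof. exact: (measurable_int_itv (mdr m k) (dr0 m k) measurableT). Qed.

Lemma drift_ge0 m k x : 0 <= drift m k x.
Proof. by apply: integral_ge0 => y _; rewrite lee_fin (dr0 m k (x, y)). Qed.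

Let mA k : measurable_fun [set: R * R]
  (fun p => gk (sg k) p.1 p.2 * `|inc k p.1 - inc k p.2|)%R.
Proof. by apply: measurable_funM; [exact: (measurable_gk2 (sg_gt0 k))|]. Qed.

Let A0 k p : (0 <= gk (sg k) p.1 p.2 * `|inc k p.1 - inc k p.2|)%R.
Proof. by rewrite mulr_ge0 ?gk_ge0. Qed.

Let minc k : measurable_fun [set: R] (fun y => `|inc k y|)%R.
Proof. by apply: measurableT_comp => //; exact: measurable_inc. Qed.

Lemma spillC k y : \int[leb]_x (gk (sg k) x y * cw k (x, y))%:E = spill k y.
Proof.
apply: eq_integral => x _; rewrite gk_sym// /cw /=.
by rewrite eq_sym.
Qed.

(** Increments differ only between points of different cells, and then by at most |inc k x| + |inc k
    y|; by symmetry of the kernel each term integrates to |inc| times the spill. The factor |inc|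
    must survive: its integrals have a bounded sum over the generations, whereas the bound on the
    spill alone is, relative to the length, the same in each of them. *)
Lemma int_inc_near j k x0 : \int[leb]_(x in ico x0 (s j)) \int[leb]_(y in hull j x0)
   (gk (sg k) x y * `|inc k x - inc k y|)%:E
  <= \int[leb]_(y in hull j x0) (`|inc k y|%:E * spill k y) +
     \int[leb]_(y in hull j x0) (`|inc k y|%:E * spill k y).
Proof.
pose P1 p : R := (gk (sg k) p.1 p.2 * cw k p * `|inc k p.1|)%R.
pose P2 p : R := (gk (sg k) p.1 p.2 * cw k p * `|inc k p.2|)%R.
have m1 : measurable_fun [set: R * R] P1.
  by apply: measurable_funM => //; exact: (measurableT_comp (minc k)).
have m2 : measurable_fun [set: R * R] P2.
  by apply: measurable_funM => //; exact: (measurableT_comp (minc k)).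
have p1 p : (0 <= P1 p)%R by rewrite mulr_ge0.
have p2 p : (0 <= P2 p)%R by rewrite mulr_ge0.
have mH : measurable (hull j x0) by exact: measurable_hull.
have mS : measurable_fun [set: R] (fun y => `|inc k y|%:E * spill k y).
  by apply: emeasurable_funM; [exact/measurable_EFinP|exact: measurable_spill].
have S0 y : 0 <= `|inc k y|%:E * spill k y by rewrite mule_ge0// spill_ge0.
apply: (@le_trans _ _ (\int[leb]_(x in ico x0 (s j))
  (\int[leb]_(y in hull j x0) (P1 (x, y))%:E + \int[leb]_(y in hull j x0) (P2 (x, y))%:E))).
  apply: ge0_le_integral => //.
  - by move=> x _; apply: integral_ge0 => y _; rewrite lee_fin (A0 k (x, y)).
  - by apply: measurable_funTS; exact: (measurable_int_itv (mA k) (A0 k)).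
  - apply: measurable_funTS; apply: emeasurable_funD.
      exact: (measurable_int_itv m1 p1).
    exact: (measurable_int_itv m2 p2).
  - move=> x _; rewrite -intLD//; do ?[exact: (msl x m1)|exact: (msl x m2)].
    apply: le_intL => //.
    + exact: (msl x (mA k)).
    + by apply: measurable_funD; [exact: (msl x m1)|exact: (msl x m2)].
    + move=> y _; rewrite (A0 k (x, y))/= /P1 /P2/= -mulrDr -mulrA ler_wpM2l ?gk_ge0//.
      rewrite /cw/=; have [xy|_] := eqVneq (cidx k x) (cidx k y).
        by rewrite (inc_const r0 f xy) subrr normr0 mul0r.
      by rewrite mul1r ler_normB.
rewrite ge0_integralD//; first apply: leeD.
- apply: (@le_trans _ _ (\int[leb]_(x in hull j x0) (`|inc k x|%:E * spill k x))); last by [].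
  apply: (@le_trans _ _ (\int[leb]_(x in ico x0 (s j)) (`|inc k x|%:E * spill k x))).
    apply: ge0_le_integral => //.
    + by move=> x _; apply: integral_ge0 => y _; rewrite lee_fin.
    + by apply: measurable_funTS; exact: (measurable_int_itv m1 p1).
    + exact: measurable_funTS.
    + move=> x _; rewrite /P1/=; under eq_integral do rewrite mulrC.
      have -> : \int[leb]_(y in hull j x0) (`|inc k x| * (gk (sg k) x y * cw k (x, y)))%:E
          = `|inc k x|%:E * \int[leb]_(y in hull j x0) (gk (sg k) x y * cw k (x, y))%:E.
        apply: intLZ => //; [exact: (msl x (mgw k))|move=> y; exact: (gw0 k (x, y))].
      rewrite lee_wpmul2l ?lee_fin//; apply: ge0_subset_integral => //.
        by apply/measurable_EFinP; exact: (msl x (mgw k)).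
      by move=> y _; rewrite lee_fin (gw0 k (x, y)).
  by apply: ge0_subset_integral => //; [exact: measurable_funTS|exact: sub_hull].
- rewrite (tonelli_itv m2 p2)//; apply: ge0_le_integral => //.
  + by move=> y _; apply: integral_ge0 => x _; rewrite lee_fin.
  + apply: measurable_funTS; apply: (measurable_int_itv (h := fun p => P2 (p.2, p.1))) => //.
    apply: (measurableT_comp m2) => //.
    by apply: measurable_fun_pair.
  + exact: measurable_funTS.
  + move=> y _; rewrite /P2/=; under eq_integral do rewrite mulrC.
    have my : measurable_fun [set: R] (fun x => gk (sg k) x y * cw k (x, y))%R.
      exact: (measurableT_comp (mgw k) (measurable_pair2 y)).
    have -> : \int[leb]_(x in ico x0 (s j)) (`|inc k y| * (gk (sg k) x y * cw k (x, y)))%:E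
        = `|inc k y|%:E * \int[leb]_(x in ico x0 (s j)) (gk (sg k) x y * cw k (x, y))%:E.
      by apply: intLZ => // x; exact: (gw0 k (x, y)).
    rewrite lee_wpmul2l ?lee_fin// -spillC; apply: ge0_subset_integral => //.
      exact/measurable_EFinP.
    by move=> x _; rewrite lee_fin (gw0 k (x, y)).
- by move=> x _; apply: integral_ge0 => y _; rewrite lee_fin.
- by apply: measurable_funTS; exact: (measurable_int_itv m1 p1).
- by move=> x _; apply: integral_ge0 => y _; rewrite lee_fin.
- by apply: measurable_funTS; exact: (measurable_int_itv m2 p2).
Qed.

Lemma int_drift j k m x0 : (j <= k)%N ->
  \int[leb]_(x in ico x0 (s j)) drift m k x <=
   (\int[leb]_(y in hull j x0) (`|inc k y|%:E * spill k y) +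
    \int[leb]_(y in hull j x0) (`|inc k y|%:E * spill k y)) +
   (\int[leb]_(y in hull j x0) `|lost m k y|%:E + (144 * eta * s k)%:E).
Proof.
move=> jk; have mL : measurable_fun [set: R] (fun y => `|lost m k y|%R).
  by apply: measurableT_comp => //; exact: measurable_lost.
pose L p : R := (gk (sg k) p.1 p.2 * `|lost m k p.2|)%R.
have m2 : measurable_fun [set: R * R] L.
  apply: measurable_funM; first exact: (measurable_gk2 (sg_gt0 k)).
  exact: (measurableT_comp mL).
have L0 p : (0 <= L p)%R by rewrite mulr_ge0 ?gk_ge0.
have -> : \int[leb]_(x in ico x0 (s j)) drift m k x =
  \int[leb]_(x in ico x0 (s j)) (\int[leb]_y (gk (sg k) x y * `|inc k x - inc k y|)%:E
    + \int[leb]_y (L (x, y))%:E).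
  apply: eq_integral => x _; rewrite /drift; under eq_integral do rewrite mulrDr.
  rewrite intLD//.
  - exact: (msl x (mA k)).
  - by move=> y; rewrite (A0 k (x, y)).
  - exact: (msl x m2).
  - by move=> y; exact: (L0 (x, y)).
rewrite ge0_integralD//; first last.
- by apply: measurable_funTS; exact: (measurable_int_itv m2 L0).
- by move=> x _; apply: integral_ge0 => y _; rewrite lee_fin.
- by apply: measurable_funTS; exact: (measurable_int_itv (mA k) (A0 k)).
- by move=> x _; apply: integral_ge0 => y _; rewrite lee_fin (A0 k (x, y)).
rewrite (_ : 144 * eta * s k = 6 * 16 * eta * s k + 6 * 8 * eta * s k)%R; last by ring.
apply: leeD_err.
  apply: (le_trans (int_hull_split (M := 16) x0 jk (mA k) _)).
    move=> p; rewrite (A0 k p)/= ler_wpM2l ?gk_ge0// (le_trans (ler_normB _ _))//.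
    by have := inc_le8 o r0 fB k p.1; have := inc_le8 o r0 fB k p.2; lra.
  by apply: leeD2r; exact: int_inc_near.
apply: (le_trans (int_hull_split (M := 8) x0 jk m2 _)).
  by move=> p; rewrite L0/= ler_wpM2l ?gk_ge0//; exact: lost_le8.
by apply: leeD2r; apply: (int_gk_near k (b := fun y => `|lost m k y|%R)).
Qed.

Lemma int_cell_spill k x : \int[leb]_(y in cell k x) (`|inc k y|%:E * spill k y)
  <= (8 * eta)%:E * \int[leb]_(y in cell k x) `|inc k y|%:E.
Proof.
have -> : \int[leb]_(y in cell k x) (`|inc k y|%:E * spill k y) =
   \int[leb]_(y in cell k x) (`|inc k x|%:E * spill k y).
  by apply: eq_integral => y; rewrite inE => /(cellP _ r0) /(inc_const r0 f) ->.
have -> : \int[leb]_(y in cell k x) `|inc k y|%:E = `|inc k x|%:E * (s k)%:E.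
  rewrite -(leb_cell o r0 k x) -intL_cst//; apply: eq_integral => y.
  by rewrite inE => /(cellP _ r0) /(inc_const r0 f) ->.
rewrite ge0_integralZl_EFin//.
- rewrite muleCA; apply: lee_wpmul2l; first by rewrite lee_fin.
  by rewrite -EFinM int_spill.
- by move=> y _; exact: spill_ge0.
- by apply: measurable_funTS; exact: measurable_spill.
Qed.

(** Three sums over hulls, each at most 4 * 448 * eta * s j, and the far parts, at most 144 * eta *
    s j: 3 * 1792 + 144 = 5520. *)
Lemma sum_int_drift j n m x0 : (2 ^- m <= eta)%R ->
  \sum_(j.+1 <= k < (j + n).+1) \int[leb]_(x in ico x0 (s j)) drift m k x
   <= (5520 * eta * s j)%:E.
Proof.
move=> meta.
have mS k : measurable_fun [set: R] (fun y => `|inc k y|%:E * spill k y).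
  by apply: emeasurable_funM; [exact/measurable_EFinP|exact: measurable_spill].
have S0 k y : 0 <= `|inc k y|%:E * spill k y by rewrite mule_ge0// spill_ge0.
have mL k : measurable_fun [set: R] (fun y => `|lost m k y|%:E).
  by apply/measurable_EFinP; apply: measurableT_comp => //; exact: measurable_lost.
have hS : \sum_(j.+1 <= k < (j + n).+1)
    \int[leb]_(y in hull j x0) (`|inc k y|%:E * spill k y) <= (4 * (448 * eta * s j))%:E.
  apply: (@sum_hull j x0 (index_iota j.+1 (j + n).+1) (fun k y => `|inc k y|%:E * spill k y)
    (448 * eta * s j) mS S0) => z.
  apply: (@le_trans _ _ (\sum_(j.+1 <= k < (j + n).+1)
      ((8 * eta)%:E * \int[leb]_(y in cell j z) `|inc k y|%:E))).
    rewrite big_nat [leRHS]big_nat; apply: lee_sum => k /andP[jk _].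
    apply: (@cell_lift _ _ o r0 j (k - j)) => //.
    - by apply/measurable_EFinP.
    - by rewrite mulr_ge0// ltW.
    - by move=> w; rewrite subnKC ?(ltnW jk)//; exact: int_cell_spill.
  rewrite -ge0_sume_distrr; last by move=> k _; rewrite integral_ge0.
  rewrite (_ : (448 * eta * s j)%R = (8 * eta * (56 * s j))%R); last by ring.
  by rewrite [leRHS]EFinM lee_wpmul2l ?lee_fin ?mulr_ge0 ?(ltW e0)// sum_int_inc.
have hL : \sum_(j.+1 <= k < (j + n).+1)
    \int[leb]_(y in hull j x0) `|lost m k y|%:E <= (4 * (448 * eta * s j))%:E.
  apply: (@sum_hull j x0 (index_iota j.+1 (j + n).+1) (fun k y => `|lost m k y|%:E)
    (448 * eta * s j) mL) => // z.
  apply: (le_trans (sum_int_lost o r0 fB m j n z)); rewrite lee_fin ler_pM2r//.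
  exact: (ler_wpM2l (ler0n _ 448) meta).
apply: (@le_trans _ _ (\sum_(j.+1 <= k < (j + n).+1)
   ((\int[leb]_(y in hull j x0) (`|inc k y|%:E * spill k y) +
    \int[leb]_(y in hull j x0) (`|inc k y|%:E * spill k y)) +
   (\int[leb]_(y in hull j x0) `|lost m k y|%:E + (144 * eta * s k)%:E)))).
  rewrite big_nat [leRHS]big_nat; apply: lee_sum => k /andP[jk _].
  by apply: int_drift; exact: ltnW.
apply: (le_trans (sume_le3 (fun k => 144 * eta * s k)%R hS hL)).
rewrite lee_fin -mulr_sumr; have := sum_scale j n.
have : (0 <= 144 * eta)%R by rewrite mulr_ge0// ltW.
by move=> h1 /(ler_wpM2l h1); lra.
Qed.

(** A pointwise bound. The Gaussian is at most (eta^2 * s k)^-1, and the lost jumps have mass at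
    most 256 * eta^3 * s k on the hull, which leaves 256 * eta; the tail outside the hull adds 48 *
    eta. The cube in the hypothesis on m pays for the height of the Gaussian. *)
Lemma int_gk_lost k m x : (2 ^- m <= eta ^+ 3)%R ->
  \int[leb]_y (gk (sg k) x y * `|lost m k y|)%:E <= (304 * eta)%:E.
Proof.
move=> meta; have mL : measurable_fun [set: R] (fun y => `|lost m k y|%R).
  by apply: measurableT_comp => //; exact: measurable_lost.
have mC : measurable (~` hull k x) by exact: measurableC.
have mg := measurable_gk (sg k) x.
rewrite -(setUv (hull k x)) ge0_integral_setU//; last 3 first.
- by rewrite setUv; apply/measurable_EFinP; exact: measurable_funM.
- by move=> y _; rewrite lee_fin mulr_ge0 ?gk_ge0.
- exact/disj_setPCl.
rewrite (_ : 304 * eta = 256 * eta + 48 * eta)%R; last by lra.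
rewrite EFinD; apply: leeD.
  apply: (@le_trans _ _ (\int[leb]_(y in hull k x) ((sg k)^-1 * `|lost m k y|)%:E)).
    apply: le_intL => //.
    - exact: measurable_funM.
    - exact: measurable_funM.
    - by move=> y _; rewrite mulr_ge0 ?gk_ge0//= ler_wpM2r// gk_ub.
  rewrite intLZ// ?invr_ge0 ?(ltW (sg_gt0 k))//.
  have hh : \int[leb]_(y in hull k x) `|lost m k y|%:E <= (4 * (64 * eta ^+ 3 * s k))%:E.
    have := @sum_hull k x [:: k] (fun k y => `|lost m k y|%:E) (64 * eta ^+ 3 * s k).
    rewrite big_seq1; apply.
    - move=> k'; apply/measurable_EFinP; apply: measurableT_comp => //.
      exact: measurable_lost.
    - by [].
    - move=> z; rewrite big_seq1; apply: (le_trans (int_lost o r0 fB m k z)).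
      by rewrite lee_fin ler_pM2r// ler_pM2l.
  apply: (@le_trans _ _ ((sg k)^-1%:E * (4 * (64 * eta ^+ 3 * s k))%:E)).
    by rewrite lee_wpmul2l// lee_fin invr_ge0 ltW.
  rewrite -EFinM lee_fin /sg le_eqVlt; apply/orP; left; apply/eqP.
  by field; rewrite !gt_eqF.
apply: (@le_trans _ _ (\int[leb]_(y in ~` hull k x) (8 * gk (sg k) x y)%:E)).
  apply: le_intL => //.
  - exact: measurable_funM.
  - exact: measurable_funM.
  - by move=> y _; rewrite mulr_ge0 ?gk_ge0//= mulrC ler_wpM2r ?gk_ge0 ?lost_le8.
rewrite intLZ//.
apply: (@le_trans _ _ (8%:E * (6 * (sg k / s k) ^+ 2)%:E)).
  rewrite lee_wpmul2l ?lee_fin//; apply: int_gk_tail => // y; apply: hull_far.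
  by rewrite /ico/= in_itv/= lexx/= ltrDl s0.
rewrite -EFinM lee_fin /sg mulfK ?gt_eqF// mulrA -natrM ler_pM2l//.
by rewrite -exprM exprS ler_piMr ?(ltW e0)// exprn_ile1// ltW.
Qed.

End single_grid_tail.

(** * Averaging over translated grids *)

Section ssum.
Context {R : realType}.
Implicit Types (u : nat -> R).

(* a choice of the sum of a series that is measurable in a parameter; junk when
   the series diverges *)
Definition ssum u : R := fine (limn_esup (fun n => (\sum_(0 <= k < n) u k)%:E)).

Lemma ssum_lim u (l : R) : \sum_(0 <= k < n) u k @[n --> \oo] --> l -> ssum u = l.
Proof.
move=> ul; have := @cvg_limn_einf_sup _ (fun n => (\sum_(0 <= k < n) u k)%:E) l%:E.
case; first by apply: cvg_EFin => //; exact: nearW.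
by rewrite /ssum => _ ->.
Qed.

Lemma ssum_cvg u : (\sum_(0 <= k <oo) `|u k|%:E < +oo)%E ->
  \sum_(0 <= k < n) u k @[n --> \oo] --> ssum u.
Proof.
move=> h; have : cvgn (series u).
  by apply: (@normed_cvg R R^o u); apply: (@nnseries_is_cvg R (fun k => `|u k|)).
by move=> /cvg_ex[l ul]; rewrite (ssum_lim ul).
Qed.

(** Valid without convergence: if the series of absolute values diverges, so does its tail, and the
    right-hand side is infinite. *)
Lemma ssum_dist u j :
  (`|ssum u - \sum_(0 <= k < j) u k|%:E <= \sum_(j <= k <oo) `|u k|%:E)%E.
Proof.
have [h|] := ltP (\sum_(0 <= k <oo) `|u k|%:E)%E +oo%E; last first.
  rewrite leye_eq (nneseries_split 0 j)//= add0n => /eqP.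
  rewrite sumEFin; case: (\big[_/_]_(_ <= _ <oo) _)%E => //=; by rewrite leey.
have cu := ssum_cvg h.
have c2 : (`|(\sum_(0 <= k < n) u k) - \sum_(0 <= k < j) u k|%:E @[n --> \oo] -->
    `|ssum u - \sum_(0 <= k < j) u k|%:E)%E.
  apply: cvg_EFin; first exact: nearW.
  by apply: cvg_norm; apply: cvgB => //; exact: cvg_cst.
rewrite -(cvg_lim _ c2)//; apply: lime_le; first by apply/cvg_ex; eexists; exact: c2.
near=> n; have jn : (j <= n)%N by near: n; exact: nbhs_infty_ge.
have -> : \sum_(0 <= k < n) u k = \sum_(0 <= k < j) u k + \sum_(j <= k < n) u k.
  by rewrite -big_cat_nat.
rewrite addrC addKr.
apply: (@le_trans _ _ (\sum_(j <= k < n) `|u k|%:E)%E).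
  by rewrite sumEFin lee_fin ler_norm_sum.
by apply: nneseries_lim_ge => k _ _; rewrite lee_fin.
Unshelve. all: by end_near. Qed.

Lemma measurable_ssum d (T : measurableType d) (u : nat -> T -> R) :
  (forall k, measurable_fun [set: T] (u k)) ->
  measurable_fun [set: T] (fun x => ssum (u ^~ x)).
Proof.
move=> mu; apply: measurableT_comp => //.
apply: measurable_fun_limn_esup => n; apply/measurable_EFinP.
exact: measurable_sum.
Qed.

End ssum.

Section grid_average.
Context {R : realType} (r : R) (r0 : 0 < r) (N : nat) (N_odd : odd N).
Implicit Types (x y : R) (k : nat).

Let N0 : (0 : R) < N%:R. Proof. by rewrite ltr0n; case: N N_odd. Qed.

Definition gavg (F : R -> R) : R := N%:R^-1 * \sum_(i < N) F (goff r i).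

Lemma gavgE F : gavg F = N%:R^-1 * \sum_(i < N) F (goff r i). Proof. by []. Qed.

Lemma gavg_cst (c : R) : gavg (fun=> c) = c.
Proof.
by rewrite /gavg sumr_const card_ord -[X in _ * X]mulr_natl mulrA mulVf ?mul1r// gt_eqF.
Qed.

Lemma gavg_le F G : (forall o, F o <= G o) -> gavg F <= gavg G.
Proof. by move=> h; rewrite ler_wpM2l ?invr_ge0 ?(ltW N0)// ler_sum. Qed.

Lemma gavg_norm F : `|gavg F| <= gavg (fun o => `|F o|).
Proof.
rewrite /gavg normrM ger0_norm ?invr_ge0 ?(ltW N0)//.
by rewrite ler_wpM2l ?invr_ge0 ?(ltW N0)// ler_norm_sum.
Qed.

Lemma gavgB F G : gavg (fun o => F o - G o) = gavg F - gavg G.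
Proof. by rewrite /gavg sumrB mulrBr. Qed.

Lemma gavg_sum (rg : seq nat) (F : nat -> R -> R) :
  gavg (fun o => \sum_(k <- rg) F k o) = \sum_(k <- rg) gavg (F k).
Proof. by rewrite /gavg exchange_big/= mulr_sumr. Qed.

Lemma gavg_norm_le F c : (forall o, `|F o| <= c) -> `|gavg F| <= c.
Proof.
by move=> h; rewrite (le_trans (gavg_norm _))// -[leRHS]gavg_cst gavg_le.
Qed.

Lemma measurable_gavg d (T : measurableType d) (F : R -> T -> R) :
  (forall o, measurable_fun [set: T] (F o)) ->
  measurable_fun [set: T] (fun p => gavg (fun o => F o p)).
Proof. by move=> mF; apply: measurable_funM => //; exact: measurable_sum. Qed.

(** A grid contributes only if it separates x and y, and by the count of nodes a fraction of at most
    |x - y| / scale r k + 1 / N of the grids does. *)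
Lemma gavg_cell k (F : R -> R) x y (M : R) : 0 <= M ->
  (forall o, `|F o| <= M * (cidx r o k x != cidx r o k y)%:R) ->
  `|gavg F| <= M * (`|x - y| / scale r k + N%:R^-1).
Proof.
move=> M0 h; apply: (le_trans (gavg_norm _)); apply: (le_trans (gavg_le h)).
rewrite /gavg -mulr_sumr mulrCA ler_wpM2l// ler_pdivrMl//.
rewrite mulrDr divff ?gt_eqF// mulrA.
exact: grid_countC.
Qed.

End grid_average.

Section step.
Context {R : realType} (r : R) (r0 : 0 < r) (f : R -> R) (fB : lbmo r 1 f).
Variables (eta : R) (eta01 : 0 < eta <= 1) (N : nat) (N_odd : odd N).
Variables (m q : nat).
Hypotheses (N_eta : N%:R^-1 <= eta) (m_eta : 2 ^- m <= eta ^+ 3)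
  (q_eta : 2 ^- q <= eta ^+ 3).
Implicit Types (x y : R) (j k n : nat).
Local Notation leb := (@lebesgue_measure R).
Local Notation s := (scale r).
Local Notation sg := (sg r eta).
Local Notation gavg := (gavg r N).
#[local] Hint Extern 0 (measurable (ico _ _)) => solve [exact: measurable_ico] : core.

Let s0 k : 0 < s k. Proof. exact: scale_gt0. Qed.
Let e0 : 0 < eta. Proof. by case/andP: eta01. Qed.
Let e1 : eta <= 1. Proof. by case/andP: eta01. Qed.
Let sg0 k : 0 < sg k. Proof. exact: sg_gt0. Qed.
Let e3 : eta ^+ 3 <= eta.
Proof. by rewrite exprS ler_piMr ?(ltW e0)// exprn_ile1// ltW. Qed.
Let N0 : (0 : R) < N%:R. Proof. by rewrite ltr0n; case: N N_odd. Qed.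
Definition jumps k x : R := gavg (fun o => inc r o f k x).
Definition atoms k x : R := gavg (fun o => kept r o f m k x).
Definition resid k x : R := jumps k x - gconv (sg k) (atoms k) x.

Lemma measurable_jumps k : measurable_fun [set: R] (jumps k).
Proof. by apply: measurable_gavg => o; exact: measurable_inc. Qed.

Lemma measurable_atoms k : measurable_fun [set: R] (atoms k).
Proof. by apply: measurable_gavg => o; exact: measurable_kept. Qed.

Lemma atoms_le8 k x : `|atoms k x| <= 8.
Proof. by apply: gavg_norm_le => // o; exact: kept_le8. Qed.

Lemma sum_atoms n x : \sum_(1 <= k < n.+1) `|atoms k x| <= 8 * m%:R.
Proof.
apply: (@le_trans _ _ (\sum_(1 <= k < n.+1) gavg (fun o => `|kept r o f m k x|))).
  by apply: ler_sum => k _; exact: gavg_norm.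
rewrite -gavg_sum; apply: (le_trans (ler_norm _)).
apply: gavg_norm_le => // o; rewrite ger0_norm ?sumr_ge0//.
exact: sum_kept.
Qed.

Lemma measurable_resid k : measurable_fun [set: R] (resid k).
Proof.
apply: measurable_funB; first exact: measurable_jumps.
by apply: (measurable_gconv (sg0 k) (measurable_atoms k) (atoms_le8 k)).
Qed.

Lemma resid_le k x : (`|resid k x|%:E <=
  \int[leb]_y (gk (sg k) x y * `|jumps k x - atoms k y|)%:E)%E.
Proof. exact: (gconv_dist x _ (sg0 k) (measurable_atoms k) (atoms_le8 k)). Qed.

Lemma resid_drift k x : (`|resid k x|%:E <=
  \sum_(i < N) N%:R^-1%:E * drift r (goff r i) f eta m k x)%E.
Proof.
apply: (le_trans (resid_le k x)).
have mA := measurable_atoms k.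
have mi (i : 'I_N) := measurable_inc (goff r i) r0 f k.
have ml (i : 'I_N) := measurable_lost (goff r i) r0 f m k.
pose D (i : 'I_N) y : R := gk (sg k) x y *
  (`|inc r (goff r i) f k x - inc r (goff r i) f k y| + `|lost r (goff r i) f m k y|).
have mD i : measurable_fun [set: R] (D i).
  apply: measurable_funM; first exact: measurable_gk.
  apply: measurable_funD; last exact: measurableT_comp.
  by apply: measurableT_comp => //; exact: measurable_funB.
have D0 i y : 0 <= D i y by rewrite mulr_ge0 ?gk_ge0 ?addr_ge0.
apply: (@le_trans _ _ (\int[leb]_y (\sum_(i < N) (N%:R^-1 * D i y)%:E))%E).
  under [leRHS]eq_integral do rewrite sumEFin.
  apply: le_intL => //.
  - apply: measurable_funM; first exact: measurable_gk.
    by apply: measurableT_comp => //; exact: measurable_funB.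
  - by apply: measurable_sum => i; exact: measurable_funM.
  - move=> y _; rewrite mulr_ge0 ?gk_ge0//=.
    rewrite /D; under eq_bigr do rewrite mulrCA.
    rewrite -mulr_sumr ler_wpM2l ?gk_ge0//.
    rewrite -gavgB; apply: le_trans; first exact: gavg_norm.
    rewrite -mulr_sumr ler_wpM2l// ler_sum// => i _.
    rewrite (_ : _ - _ = (inc r (goff r i) f k x - inc r (goff r i) f k y)
      + lost r (goff r i) f m k y); first exact: ler_normD.
    by rewrite (kept_lost r (goff r i) f m k y); ring.
rewrite ge0_integral_sum//; last 2 first.
- by move=> i; apply: measurable_funEFin; apply: measurable_funM => //; exact: mD.
- by move=> i y _; rewrite lee_fin mulr_ge0.
by apply: lee_sum => i _; rewrite intLZ.
Qed.

Lemma resid_tail j n x0 :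
  (\sum_(j.+1 <= k < (j + n).+1) \int[leb]_(x in ico x0 (s j)) `|resid k x|%:E
    <= (2 ^+ 13 * eta * s j)%:E)%E.
Proof.
(* Constants are rounded up to powers of 2, which keeps the final choice of [eta] simple. *)
have c : 5520 * eta * s j <= 2 ^+ 13 * eta * s j.
  by rewrite !ler_pM2r// -natrX ler_nat.
rewrite -lee_fin in c; apply: le_trans c.
apply: (@le_trans _ _ (\sum_(j.+1 <= k < (j + n).+1) \sum_(i < N)
    N%:R^-1%:E * \int[leb]_(x in ico x0 (s j)) drift r (goff r i) f eta m k x)%E).
  apply: lee_sum => k _.
  have md (i : 'I_N) := measurable_drift (goff r i) r0 f eta01 m k.
  have d0 (i : 'I_N) := drift_ge0 r (goff r i) f eta m k.
  apply: (@le_trans _ _ (\int[leb]_(x in ico x0 (s j))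
     (\sum_(i < N) N%:R^-1%:E * drift r (goff r i) f eta m k x))%E).
    apply: ge0_le_integral => //.
    - apply: measurable_funTS; apply: measurable_funEFin; apply: measurableT_comp => //.
      exact: measurable_resid.
    - apply: measurable_funTS; apply: emeasurable_sum => i _.
      by apply: emeasurable_funM => //; exact: md.
    - by move=> x _; exact: resid_drift.
  rewrite ge0_integral_sum//.
  - apply: lee_sum => i _; rewrite ge0_integralZl_EFin//.
      by apply: measurable_funTS; exact: md.
  - by move=> i; apply: measurable_funTS; apply: emeasurable_funM => //; exact: md.
  - by move=> i x _; rewrite mule_ge0// lee_fin.
rewrite exchange_big/=.
apply: (@le_trans _ _ (\sum_(i < N) (N%:R^-1 * (5520 * eta * s j))%:E)%E).
  apply: lee_sum => i _; rewrite -ge0_sume_distrr; last first.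
    by move=> k _; apply: integral_ge0 => x _; exact: drift_ge0.
  rewrite EFinM lee_wpmul2l ?lee_fin//; apply: sum_int_drift => //.
  exact: le_trans e3.
by rewrite sumEFin lee_fin sumr_const card_ord -[leLHS]mulr_natl mulrA mulfV ?mul1r// gt_eqF.
Qed.

Lemma jumps_cell k x y : `|jumps k x - jumps k y| <= 16 * (`|x - y| / s k + eta).
Proof.
rewrite -gavgB; apply: le_trans.
  apply: (@gavg_cell _ r r0 N N_odd k _ x y 16) => //.
  move=> o; have [xy|_] := eqVneq (cidx r o k x) (cidx r o k y).
    by rewrite (inc_const r0 f xy) subrr normr0 mulr0.
  rewrite mulr1 (le_trans (ler_normB _ _))//.
  by have := inc_le8 o r0 fB k x; have := inc_le8 o r0 fB k y; lra.
by rewrite ler_pM2l// lerD2l.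
Qed.

Lemma jumps_le8 k x : `|jumps k x| <= 8.
Proof. by apply: gavg_norm_le => // o; exact: inc_le8. Qed.

(** Within distance eta * s k the averaged jumps vary by at most 32 * eta; beyond it they vary by at
    most 16, on a Gaussian tail of at most 6 * eta; the lost jumps add 304 * eta. The total is 432 *
    eta. *)
Lemma resid_sup k x : `|resid k x| <= 2 ^+ 9 * eta.
Proof.
have c : 432 * eta <= 2 ^+ 9 * eta by rewrite ler_pM2r// -natrX ler_nat.
apply: le_trans c.
rewrite -lee_fin; apply: (le_trans (resid_le k x)).
have mJ := measurable_jumps k; have mA := measurable_atoms k.
pose far : set R := [set y | eta * s k <= `|x - y|].
have mf : measurable far.
  rewrite (_ : far = (fun y => `|x - y|) @^-1` `[eta * s k, +oo[).
    have mn : measurable_fun [set: R] (fun y => `|x - y|).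
      by apply: measurableT_comp => //; exact: measurable_funB.
    by rewrite -[X in measurable X]setTI; apply: mn.
  by apply/seteqP; split=> y /=; rewrite in_itv/= andbT.
pose L y : R := gavg (fun o => `|lost r o f m k y|).
have mL : measurable_fun [set: R] L.
  by apply: measurable_gavg => o; apply: measurableT_comp => //; exact: measurable_lost.
have mI : measurable_fun [set: R] (\1_far : R -> R) by exact: measurable_indic.
have mg := measurable_gk (sg k) x.
have I0 y : 0 <= (\1_far y : R) by case/andP: (indic01 far y).
have L0 y : 0 <= L y by rewrite mulr_ge0// sumr_ge0.
have key y : `|jumps k x - atoms k y| <= 32 * eta + (16 * \1_far y + L y).
  rewrite (_ : _ - _ = (jumps k x - jumps k y) + gavg (fun o => lost r o f m k y)); last first.
    rewrite /atoms (_ : gavg (fun o => lost r o f m k y) = jumps k y -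
       gavg (fun o => kept r o f m k y)); first by ring.
    rewrite /jumps -gavgB; congr (gavg _); apply/funext => o.
    by rewrite (kept_lost r o f m k y); ring.
  apply: (le_trans (ler_normD _ _)); rewrite addrA lerD ?gavg_norm//.
  rewrite indicE; case: (boolP (y \in far)) => hy.
    rewrite mulr1; apply: (@le_trans _ _ (8 + 8)); last by have := e0; lra.
    by apply: (le_trans (ler_normB _ _)); rewrite lerD ?jumps_le8.
  rewrite mulr0 addr0; apply: (le_trans (jumps_cell k x y)).
  rewrite (_ : 32 * eta = 16 * (eta + eta)); last by ring.
  rewrite ler_pM2l// lerD2r ler_pdivrMr// ltW// ltNge; apply: contra hy => hy.
  exact/mem_set.
apply: (@le_trans _ _ (\int[leb]_y (32 * eta * gk (sg k) x y +
   (16 * (gk (sg k) x y * \1_far y) + gk (sg k) x y * L y))%:E)%E).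
  apply: le_intL => //.
  - apply: measurable_funM => //.
    by apply: measurableT_comp => //; exact: measurable_funB.
  - apply: measurable_funD; first exact: measurable_funM.
    apply: measurable_funD; last exact: measurable_funM.
    by apply: measurable_funM => //; exact: measurable_funM.
  - move=> y _; rewrite mulr_ge0 ?gk_ge0//=.
    by have := ler_wpM2l (gk_ge0 (sg k) x y) (key y); lra.
have g0 y := gk_ge0 (sg k) x y.
have m1 : measurable_fun [set: R] (fun y => gk (sg k) x y * \1_far y)%R.
  exact: measurable_funM.
have m2 : measurable_fun [set: R] (fun y => gk (sg k) x y * L y)%R.
  exact: measurable_funM.
have e32 : 0 <= 32 * eta by rewrite mulr_ge0// ltW.
have p1 y : 0 <= gk (sg k) x y * \1_far y by exact: mulr_ge0.
have p2 y : 0 <= gk (sg k) x y * L y by exact: mulr_ge0.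
have p3 y : 0 <= 16 * (gk (sg k) x y * \1_far y) by exact: mulr_ge0.
have m3 : measurable_fun [set: R] (fun y => 16 * (gk (sg k) x y * \1_far y)).
  exact: measurable_funM.
rewrite intLD//; last 4 first.
- exact: measurable_funM.
- by move=> y; exact: mulr_ge0.
- exact: measurable_funD.
- by move=> y; exact: addr_ge0.
rewrite intLD// !intLZ//.
rewrite int_gk// mule1.
have h1 : (\int[leb]_y (gk (sg k) x y * \1_far y)%:E <= (6 * eta)%:E)%E.
  have -> : (\int[leb]_y (gk (sg k) x y * \1_far y)%:E =
      \int[leb]_(y in far) (gk (sg k) x y)%:E)%E.
    rewrite [RHS]integral_mkcond; apply: eq_integral => y _.
    by rewrite /patch indicE; case: (y \in far); rewrite ?mulr1 ?mulr0.
  apply: (le_trans (int_gk_tail (d := eta * s k) _ _ _ _)) => //; first exact: mulr_gt0.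
  rewrite lee_fin (_ : sg k / _ = eta).
    by rewrite ler_pM2l// expr2 ler_piMl// ltW.
  by rewrite /Submission.sg; field; rewrite !gt_eqF.
have h2 : (\int[leb]_y (gk (sg k) x y * L y)%:E <= (304 * eta)%:E)%E.
  have ml (i : 'I_N) := measurable_lost (goff r i) r0 f m k.
  have ml' (i : 'I_N) : measurable_fun [set: R] (fun y => gk (sg k) x y * `|lost r (goff r i) f m k y|).
    by apply: measurable_funM => //; exact: measurableT_comp.
  have -> : (\int[leb]_y (gk (sg k) x y * L y)%:E =
     \int[leb]_y \sum_(i < N) (N%:R^-1 * (gk (sg k) x y * `|lost r (goff r i) f m k y|))%:E)%E.
    apply: eq_integral => y _; rewrite sumEFin; congr (_%:E).
    by rewrite /L gavgE mulrCA -mulr_sumr; congr (_ * _); rewrite mulr_sumr.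
  rewrite ge0_integral_sum//; last 2 first.
  - by move=> i; apply: measurable_funEFin; apply: measurable_funM => //; exact: ml'.
  - by move=> i y _; rewrite lee_fin !mulr_ge0.
  apply: (@le_trans _ _ (\sum_(i < N) (N%:R^-1 * (304 * eta))%:E)%E).
    apply: lee_sum => i _; rewrite intLZ//; last by move=> y; rewrite mulr_ge0.
    by rewrite [leRHS]EFinM lee_wpmul2l ?lee_fin//; apply: int_gk_lost.
  by rewrite sumEFin lee_fin sumr_const card_ord -[leLHS]mulr_natl mulrA mulfV ?mul1r// gt_eqF.
apply: (@le_trans _ _ ((32 * eta)%:E + ((16 * (6 * eta))%:E + (304 * eta)%:E))%E).
  apply: leeD => //; apply: leeD => //.
  by rewrite [leRHS]EFinM lee_wpmul2l// lee_fin.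
by rewrite -!EFinD lee_fin; lra.
Qed.

End step.

Lemma sum_shift {R : realType} (n : nat) (F : nat -> R) :
  \sum_(0 <= k < n) F k.+1 = \sum_(1 <= k < n.+1) F k.
Proof. by rewrite big_add1. Qed.

Lemma sume_shift {R : realType} (j n : nat) (F : nat -> \bar R) :
  (\sum_(j.+1 <= k < (j + n).+1) F k = \sum_(0 <= i < n) F (i + j).+1)%E.
Proof.
rewrite -{1}[j.+1]add0n big_addn subSS addKn.
by apply: eq_bigr => i _; rewrite addnS.
Qed.

Lemma sum_dist_split {R : realType} (p j : nat) (u v : nat -> R) (A B : R) :
  (p <= j)%N ->
  `|\sum_(1 <= k < p.+1) u k - \sum_(1 <= k < p.+1) v k| <= A ->
  `|\sum_(p.+1 <= k < j.+1) u k - \sum_(p.+1 <= k < j.+1) v k| <= B ->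
  `|\sum_(1 <= k < j.+1) u k - \sum_(1 <= k < j.+1) v k| <= A + B.
Proof.
move=> pj hA hB.
have split (w : nat -> R) : \sum_(1 <= k < j.+1) w k =
   \sum_(1 <= k < p.+1) w k + \sum_(p.+1 <= k < j.+1) w k by rewrite -big_cat_nat.
by rewrite !split opprD addrACA (le_trans (ler_normD _ _))// lerD.
Qed.

Lemma sum_distB {R : realType} (p : nat) (u v u' v' : nat -> R) (A B : R) :
  `|\sum_(1 <= k < p.+1) u k - \sum_(1 <= k < p.+1) u' k| <= A ->
  `|\sum_(1 <= k < p.+1) (v k - v' k)| <= B ->
  `|\sum_(1 <= k < p.+1) (u k - v k) - \sum_(1 <= k < p.+1) (u' k - v' k)| <= A + B.
Proof.
move=> hA hB.
have -> : \sum_(1 <= k < p.+1) (u k - v k) - \sum_(1 <= k < p.+1) (u' k - v' k) =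
   (\sum_(1 <= k < p.+1) u k - \sum_(1 <= k < p.+1) u' k) -
   \sum_(1 <= k < p.+1) (v k - v' k).
  by rewrite !sumrB; ring.
by rewrite (le_trans (ler_normB _ _))// lerD.
Qed.

Lemma sum_dist_cst {R : realType} (p j q : nat) (u v : nat -> R) (A : R) :
  (j - p <= q)%N -> 0 <= A -> (forall k, `|u k| <= A) -> (forall k, `|v k| <= A) ->
  `|\sum_(p.+1 <= k < j.+1) u k - \sum_(p.+1 <= k < j.+1) v k| <= (2 * A) * q%:R.
Proof.
move=> jpq A0 hu hv; rewrite -sumrB; apply: (le_trans (ler_norm_sum _ _ _)).
apply: (@le_trans _ _ (\sum_(p.+1 <= k < j.+1) 2 * A)).
  apply: ler_sum => k _; apply: (le_trans (ler_normB _ _)).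
  by rewrite mulr_natl mulr2n lerD.
by rewrite sumr_const_nat subSS -[leLHS]mulr_natr ler_wpM2l ?mulr_ge0// ler_nat.
Qed.

Lemma integrable_ae_leb {R : realType} (D : set R) (F : R -> \bar R) :
  measurable D -> (@lebesgue_measure R).-integrable D F ->
  {ae (@lebesgue_measure R), forall x, D x -> F x \is a fin_num}.
Proof. by move=> mD hI; exact: (@integrable_ae _ (measurableTypeR R) R lebesgue_measure D mD F hI). Qed.

Lemma scale_small {R : realType} (r l : R) : 0 < r -> 0 < l -> exists n, scale r n < l.
Proof.
move=> r0 l0; pose n := (Num.truncn (r / l)).+1; exists n.
rewrite /scale ltr_pdivrMr ?exprn_gt0// -ltr_pdivrMl// mulrC.
apply: lt_trans (truncnS_gt _) _.
by rewrite -natrX ltr_nat ltn_expl.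
Qed.

(** * The remainder of a step and its oscillation *)

Section step2.
Context {R : realType} (r : R) (r0 : 0 < r) (f : R -> R) (fB : lbmo r 1 f).
Variables (eta : R) (eta01 : 0 < eta <= 1) (N : nat) (N_odd : odd N).
Variables (m q : nat).
Hypotheses (N_eta : N%:R^-1 <= eta) (m_eta : 2 ^- m <= eta ^+ 3)
  (q_eta : 2 ^- q <= eta ^+ 3).
Implicit Types (x y : R) (j k n : nat).
Local Notation leb := (@lebesgue_measure R).
Local Notation s := (scale r).
Local Notation sg := (sg r eta).
Local Notation gavg := (gavg r N).
Local Notation jumps := (jumps r f N).
Local Notation atoms := (atoms r f N m).
Local Notation resid := (resid r f eta N m).
#[local] Hint Extern 0 (measurable (ico _ _)) => solve [exact: measurable_ico] : core.

Let s0 k : 0 < s k. Proof. exact: scale_gt0. Qed.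
Let e0 : 0 < eta. Proof. by case/andP: eta01. Qed.
Let e1 : eta <= 1. Proof. by case/andP: eta01. Qed.
Let sg0 k : 0 < sg k. Proof. exact: sg_gt0. Qed.
Let e3 : eta ^+ 3 <= eta.
Proof. by rewrite exprS ler_piMr ?(ltW e0)// exprn_ile1// ltW. Qed.
Let N0 : (0 : R) < N%:R. Proof. by rewrite ltr0n; case: N N_odd. Qed.

(** At distance at most s p, two points lie in the same cell or in adjacent ones. Adjacent averages
    differ by at most 4, and each value followed is within 5 of its average: 5 + 5 + 4 = 14. *)
Lemma refv_adj o p x y : (0 < p)%N -> `|x - y| <= s p ->
  `|refv r o f p x - refv r o f p y| <= 14 * (cidx r o p x != cidx r o p y)%:R.
Proof.
wlog : x y / cidx r o p x <= cidx r o p y => [H p0 xy|].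
  have [h|h] := leP (cidx r o p x) (cidx r o p y); first exact: H.
  by rewrite distrC eq_sym H ?(ltW h)// distrC.
move=> xy p0 dxy.
have [c|ne] := eqVneq (cidx r o p x) (cidx r o p y).
  by rewrite (refv_const r0 f c) subrr normr0 mulr0.
have {}xy : cidx r o p x < cidx r o p y by rewrite lt_neqAle ne.
rewrite mulr1; have cS : cidx r o p y = cidx r o p x + 1.
  apply/eqP; rewrite eq_le; apply/andP; split; last by rewrite -ltzD1 ltrD2r.
  rewrite -ltzD1 -(ltr_int R).
  have := (cidxP o r0 p x _).1 erefl; have := (cidxP o r0 p y _).1 erefl.
  move=> /andP[a1 _] /andP[_ b2].
  have : y - x <= s p by rewrite (le_trans _ dxy)// distrC ler_norm.
  rewrite -(ltr_pM2r (s0 p)) !intrD !mulrDl; rewrite intrD mulrDl in b2.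
  lra.
have cl : Submission.cleft r o p y = Submission.cleft r o p x + s p.
  by rewrite /Submission.cleft cS intrD mulrDl mul1r addrA.
have h1 := refv_near o r0 fB p x; have h2 := refv_near o r0 fB p y.
have h3 : `|cavg r o f p y - cavg r o f p x| <= 4.
  rewrite /cavg cl; apply: (iavg_adj _ fB) => //.
  by case: (p) p0 => // p' _; rewrite -scaleS; exact: scale_le.
rewrite (_ : _ - _ = (refv r o f p x - cavg r o f p x) - (refv r o f p y - cavg r o f p y)
   - (cavg r o f p y - cavg r o f p x)); last by ring.
rewrite (le_trans (ler_normB _ _))//; have := ler_normB (refv r o f p x - cavg r o f p x)
  (refv r o f p y - cavg r o f p y).
lra.
Qed.

Lemma sum_jumps p x : \sum_(1 <= k < p.+1) jumps k x = gavg (fun o => refv r o f p x).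
Proof.
by rewrite -gavg_sum; congr Submission.gavg; apply/funext => o; rewrite sum_inc.
Qed.

Lemma sum_scaleV p : \sum_(1 <= k < p.+1) (s k)^-1 <= 2 / s p.
Proof.
elim: p => [|p IH]; first by rewrite big_geq// divr_ge0// ltW.
rewrite big_nat_recr//=; rewrite (scaleS r p) in IH.
have h : 2 / (s p.+1 *+ 2) = (s p.+1)^-1.
  by rewrite mulr2n; field; rewrite !gt_eqF.
by rewrite h in IH; lra.
Qed.

(** The q generations up to j are bounded in sup norm. Up to p = j - q, the jumps telescope to the
    grid average of the values followed at p; these differ, by at most 14, only on the grids
    separating x and y, which are few because |x - y| <= eta^3 * s p. The convolutions up to p have
    Lipschitz constants 128 / (eta^2 * s k), a geometric series dominated by its last term, so they
    vary by at most 256 * eta. *)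
Lemma resid_head j x y : `|x - y| <= s j ->
  `|\sum_(1 <= k < j.+1) resid k x - \sum_(1 <= k < j.+1) resid k y|
     <= (2 ^+ 10 * q%:R + 2 ^+ 9) * eta.
Proof.
move=> xy; pose p := (j - q)%N.
have pj : (p <= j)%N by exact: leq_subr.
have jpq : (j - p <= q)%N by rewrite /p; lia.
rewrite mulrDl [leRHS]addrC.
apply: (@sum_dist_split _ p j (fun k => resid k x) (fun k => resid k y)) => //; last first.
  rewrite (_ : 2 ^+ 10 * q%:R * eta = (2 * (2 ^+ 9 * eta)) * q%:R).
    apply: sum_dist_cst => // [|k|k]; last 2 first.
    - exact: (resid_sup r0 fB eta01 N_odd N_eta m_eta k x).
    - exact: (resid_sup r0 fB eta01 N_odd N_eta m_eta k y).
    - by rewrite mulr_ge0 ?exprn_ge0// ltW.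
  by rewrite [2 ^+ 10]exprS mulrAC mulrA.
(* Subtraction is truncated: for j <= q the coarse range is empty. *)
have [p0|p0] := posnP p.
  rewrite p0 !(big_geq (leqnn 1)) subrr normr0.
  by apply: mulr_ge0; [exact: exprn_ge0|exact: ltW].
  have jE : j = (p + q)%N by rewrite /p subnK// ltnW// -subn_gt0.
  have sj : s j = s p * 2 ^- q.
    by rewrite /scale jE exprD invfM mulrA.
  have xyp : `|x - y| / s p <= eta ^+ 3.
    by rewrite ler_pdivrMr// (le_trans xy)// sj mulrC ler_pM2r.
  have e31 : eta ^+ 3 <= 1 by exact: le_trans e1.
  have h1 : `|\sum_(1 <= k < p.+1) jumps k x - \sum_(1 <= k < p.+1) jumps k y| <= 28 * eta.
    rewrite !sum_jumps -gavgB.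
    apply: (@le_trans _ _ (14 * (`|x - y| / s p + N%:R^-1))).
      apply: (@gavg_cell _ r r0 N N_odd p _ x y 14) => // o; apply: refv_adj => //.
      by rewrite -[leRHS]mul1r -ler_pdivrMr// (le_trans xyp).
    by have := le_trans xyp e3; have := N_eta; lra.
  have h2 : `|\sum_(1 <= k < p.+1) (gconv (sg k) (atoms k) x - gconv (sg k) (atoms k) y)|
      <= 256 * eta.
    apply: (le_trans (ler_norm_sum _ _ _)).
    apply: (@le_trans _ _ (\sum_(1 <= k < p.+1) (128 * `|x - y| / eta ^+ 2) * (s k)^-1)).
      apply: ler_sum => k _.
      have ma : measurable_fun [set: R] (atoms k) by exact: measurable_atoms.
      have a8 z : `|atoms k z| <= 8 by exact: atoms_le8.
      apply: (le_trans (gconv_lip x y (sg0 k) ma a8)).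
      rewrite le_eqVlt; apply/orP; left; apply/eqP; rewrite /Submission.sg; field.
      by rewrite !gt_eqF// s0.
    rewrite -mulr_sumr.
    apply: (@le_trans _ _ ((128 * `|x - y| / eta ^+ 2) * (2 / s p))).
      apply: ler_wpM2l; last exact: sum_scaleV.
      by rewrite divr_ge0 ?mulr_ge0 ?exprn_ge0// ltW.
    rewrite (_ : _ * _ = 256 * ((`|x - y| / s p) / eta ^+ 2)); last first.
      by field; rewrite !gt_eqF.
    rewrite ler_pM2l//; apply: (@le_trans _ _ (eta ^+ 3 / eta ^+ 2)).
      by rewrite ler_pM2r ?invr_gt0 ?exprn_gt0.
    by rewrite (exprS eta 2) mulfK// expf_neq0// gt_eqF.
  have h3 : 28 * eta + 256 * eta <= 2 ^+ 9 * eta.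
    by rewrite -mulrDl ler_pM2r// -natrX -natrD ler_nat.
  apply: le_trans h3; exact: (@sum_distB _ p (fun k => jumps k x) (fun k => gconv (sg k) (atoms k) x)
    (fun k => jumps k y) (fun k => gconv (sg k) (atoms k) y)).
Qed.

Definition rest x : R := ssum (fun k => resid k.+1 x).

Lemma measurable_resid' k : measurable_fun [set: R] (resid k).
Proof. exact: (measurable_resid r0 fB eta01 N_odd m k). Qed.

Lemma measurable_rest : measurable_fun [set: R] rest.
Proof.
apply: (measurable_ssum (u := fun k x => resid k.+1 x)) => k.
exact: measurable_resid'.
Qed.

Lemma int_tail j x0 : (\int[leb]_(x in ico x0 (s j))
    (\sum_(j <= k <oo) `|resid k.+1 x|%:E) <= (2 ^+ 13 * eta * s j)%:E)%E.
Proof.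
have mr k : measurable_fun [set: R] (fun x => `|resid k x|%:E).
  apply: measurable_funEFin; apply: measurableT_comp => //; exact: measurable_resid'.
under eq_integral do rewrite -nneseries_addn//.
rewrite integral_nneseries//; last by move=> n; apply: measurable_funTS; exact: mr.
apply: lime_le.
  by apply: is_cvg_nneseries => n _ _; apply: integral_ge0.
apply: nearW => n.
have := resid_tail r0 fB eta01 N_odd m_eta j n x0.
by rewrite sume_shift.
Qed.

Lemma rest_dist j x0 x : `|x - x0| <= s j ->
  (`|rest x - \sum_(0 <= k < j) resid k.+1 x0|%:E <=
   \sum_(j <= k <oo) `|resid k.+1 x|%:E + ((2 ^+ 10 * q%:R + 2 ^+ 9) * eta)%:E)%E.
Proof.
move=> xx; have h1 := ssum_dist (fun k => resid k.+1 x) j.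
have h2 := resid_head xx.
have e z : \sum_(0 <= k < j) resid k.+1 z = \sum_(1 <= k < j.+1) resid k z.
  exact: (sum_shift j (fun k => resid k z)).
rewrite -!e in h2; apply: (@le_trans _ _ (`|rest x - \sum_(0 <= k < j) resid k.+1 x|%:E +
   `|\sum_(0 <= k < j) resid k.+1 x - \sum_(0 <= k < j) resid k.+1 x0|%:E)%E).
  by rewrite -EFinD lee_fin; exact: ler_distD.
by apply: leeD; [exact: h1|rewrite lee_fin].
Qed.

(** For l between s j.+1 and s j, the constant subtracted is the sum at x0 of the first j residuals.
    The head is controlled pointwise and the tail in L^1, where s j < 2 * l turns 2^13 into 2^14;
    finally 2^14 + 2^9 <= 2^15. *)
Lemma lbmo_rest c : (2 ^+ 10 * q%:R + 2 ^+ 15) * eta <= c -> lbmo r c rest.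
Proof.
move=> hc; have mr k : measurable_fun [set: R] (fun x => `|resid k x|%:E).
  apply: measurable_funEFin; apply: measurableT_comp => //; exact: measurable_resid'.
have mt j : measurable_fun [set: R] (fun x => (\sum_(j <= k <oo) `|resid k.+1 x|%:E)%E).
  under eq_fun do rewrite -nneseries_addn//.
  by apply: ge0_emeasurable_sum => // k _; exact: mr.
have t0 j x : (0 <= \sum_(j <= k <oo) `|resid k.+1 x|%:E)%E by apply: nneseries_ge0.
have H0 : 0 <= (2 ^+ 10 * q%:R + 2 ^+ 9) * eta.
  by rewrite mulr_ge0 ?(ltW e0)// addr_ge0 ?mulr_ge0 ?exprn_ge0.
have e13 : 0 <= 2 ^+ 13 * eta by rewrite mulr_ge0 ?exprn_ge0// ltW.
have q0 : 0 <= 2 ^+ 10 * q%:R :> R by rewrite mulr_ge0 ?exprn_ge0.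
have mR := measurable_rest.
split=> //.
- move=> x0 l /andP[l0 lr].
  have [j jl1 jl2] : exists2 j, s j.+1 < l & l <= s j.
    have ex := scale_small r0 l0.
    case: (ex_minnP ex) => -[|j] hj hmin.
      by move: hj; rewrite scale0 ltNge lr.
    exists j => //; rewrite leNgt; apply/negP => /hmin; by rewrite ltnn.
  have s2 : s j < 2 * l by rewrite scaleS mulr2n; lra.
  exists (\sum_(0 <= k < j) resid k.+1 x0).
  apply: (@le_trans _ _ (\int[leb]_(x in ico x0 l)
     (\sum_(j <= k <oo) `|resid k.+1 x|%:E + ((2 ^+ 10 * q%:R + 2 ^+ 9) * eta)%:E))%E).
    apply: ge0_le_integral => //.
    + apply: measurable_funTS; apply: measurable_funEFin; apply: measurableT_comp => //.
      exact: measurable_funB.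
    + by apply: measurable_funTS; apply: emeasurable_funD => //; exact: mt.
    + move=> x; rewrite /ico/= in_itv/= => /andP[xa xb]; apply: rest_dist.
      by rewrite ger0_norm ?subr_ge0//; lra.
  rewrite ge0_integralD//; last by apply: measurable_funTS; exact: mt.
  rewrite intL_cst// leb_itv ?(ltW l0)//.
  apply: (@le_trans _ _ ((2 ^+ 13 * eta * s j)%:E + ((2 ^+ 10 * q%:R + 2 ^+ 9) * eta)%:E * l%:E)%E).
    apply: leeD => //; apply: le_trans (int_tail j x0).
    apply: ge0_subset_integral => //; first by apply: measurable_funTS; exact: mt.
    by apply: subset_itvl; rewrite bnd_simp lerD2l.
  rewrite -EFinM -EFinD lee_fin.
  have h1 : (2 ^+ 10 * q%:R + 2 ^+ 15) * eta * l <= c * l by rewrite ler_pM2r.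
  have h2 : 2 ^+ 13 * eta * s j <= 2 ^+ 13 * eta * (2 * l).
    exact: ler_wpM2l (ltW s2).
  apply: le_trans h1; apply: le_trans (lerD h2 (lexx _)) _.
  rewrite (_ : _ * (2 * l) + _ = (2 ^+ 10 * q%:R + (2 ^+ 14 + 2 ^+ 9)) * eta * l).
    have : 2 ^+ 9 <= 2 ^+ 14 :> R by rewrite ler_weXn2l// ler1n.
    by move=> h; rewrite !ler_pM2r// lerD2l [2 ^+ 15]exprS; lra.
  by rewrite [2 ^+ 14]exprS; ring.
- move=> x0; apply: (@le_trans _ _ (\int[leb]_(x in ico x0 (s 0)) (\sum_(0 <= k <oo) `|resid k.+1 x|%:E))%E).
    rewrite scale0; apply: ge0_le_integral => //.
    + by apply: measurable_funTS; apply: measurable_funEFin; apply: measurableT_comp.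
    + by apply: measurable_funTS; exact: mt.
    + move=> x _; have := ssum_dist (fun k => resid k.+1 x) 0.
      by rewrite big_geq// subr0.
  apply: (le_trans (int_tail 0 x0)); rewrite scale0 lee_fin ler_pM2r//.
  apply: le_trans hc; rewrite ler_pM2r//.
  by apply: ler_wpDl => //; rewrite ler_weXn2l// ler1n.
Qed.

(** For almost every x the finitely many grids have all stabilised after some generation, so the
    partial sums of the averaged jumps are eventually constant, not merely convergent. *)
Lemma sum_jumps_ae : {ae leb, forall x, exists K G,
  (forall n, (K <= n)%N -> \sum_(0 <= k < n) jumps k.+1 x = G) /\ `|f x - G| <= 5}.
Proof.
have := @ae_leb_forall R (fun i x => exists K, forall k, (K <= k)%N ->
  refv r (i%:R * r / N%:R) f k x = refv r (i%:R * r / N%:R) f K x /\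
  `|f x - refv r (i%:R * r / N%:R) f K x| <= 5).
move=> /(_ (fun i => refv_eventually _ r0 fB)) H; apply: (ae_leb_impl H) => x {H}.
move=> /choice[K hK]; pose M := (\max_(i < N) K i)%N.
have KM (i : 'I_N) : (K i <= M)%N by exact: leq_bigmax.
exists M, (gavg (fun o => refv r o f M x)); split.
  move=> n Mn; rewrite (sum_shift n (fun k => jumps k x)) sum_jumps.
  rewrite !gavgE; congr (_ * _); apply: eq_bigr => i _.
  have [-> _] := hK i n (leq_trans (KM i) Mn).
  by have [-> _] := hK i M (KM i).
rewrite -[f x](gavg_cst r N_odd) -gavgB; apply: (le_trans (gavg_norm r _ _)) => //.
rewrite -[leRHS](gavg_cst r N_odd) !gavgE ler_wpM2l ?invr_ge0 ?(ltW N0)//.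
apply: ler_sum => i _; have [-> h] := hK i M (KM i).
exact: h.
Qed.

Lemma ae_cover (P : R -> Prop) :
  (forall u, {ae leb, forall x, ico u r x -> P x}) -> {ae leb, forall x, P x}.
Proof.
move=> h; have h1 n : {ae leb, forall x, forall p : nat, ico ((p%:R - n%:R) * r) r x -> P x}.
  exact: (ae_leb_forall (fun p => h _)).
apply: (ae_leb_impl (ae_leb_forall h1)) => x hx.
have hf := (cidxP 0 r0 0 x (cidx r 0 0 x)).1 erefl.
have key p n : (cidx r 0 0 x)%:~R = p%:R - n%:R :> R -> P x.
  move=> e; apply: (hx n p); rewrite /ico/= in_itv/= -e.
  move: hf; rewrite scale0 subr0 intrD mulrDl mul1r.
  by [].
case E : (cidx r 0 0 x) => [p|n].
  by apply: (key p 0%N); rewrite E subr0.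
by apply: (key 0%N n.+1); rewrite E NegzE mulrNz sub0r.
Qed.

Lemma resid_sum_ae : {ae leb, forall x, (\sum_(0 <= k <oo) `|resid k.+1 x|%:E < +oo)%E}.
Proof.
apply: ae_cover => u; have mr k : measurable_fun [set: R] (fun x => `|resid k x|%:E).
  apply: measurable_funEFin; apply: measurableT_comp => //; exact: measurable_resid'.
have mt : measurable_fun [set: R] (fun x => (\sum_(0 <= k <oo) `|resid k.+1 x|%:E)%E).
  by apply: ge0_emeasurable_sum => // k _; exact: mr.
have t0 x : (0 <= \sum_(0 <= k <oo) `|resid k.+1 x|%:E)%E by apply: nneseries_ge0.
have : leb.-integrable (ico u r) (fun x => (\sum_(0 <= k <oo) `|resid k.+1 x|%:E)%E).
  apply/integrableP; split; first exact: measurable_funTS.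
  under eq_integral do rewrite gee0_abs//.
  rewrite -[X in ico u X]scale0.
  by apply: (le_lt_trans (int_tail 0 u)); rewrite ltry.
move=> hI; have H := integrable_ae_leb (measurable_ico u r) hI; apply: (ae_leb_impl H) => x hx /hx.
by rewrite ge0_fin_numE.
Qed.

Definition osc x : R := f x - ssum (fun k => jumps k.+1 x).
(** Equal to [osc] almost everywhere; the truncation makes the bound 5 hold at every point. *)
Definition bdd x : R := osc x * \1_[set x | `|osc x| <= 5] x.

Lemma measurable_osc : measurable_fun [set: R] osc.
Proof.
apply: measurable_funB; first by case: fB.
by apply: (measurable_ssum (u := fun k x => jumps k.+1 x)) => k; exact: measurable_jumps.
Qed.

Lemma measurable_bdd : measurable_fun [set: R] bdd.
Proof.
apply: measurable_funM; first exact: measurable_osc.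
apply: measurable_indic; rewrite -[X in measurable X]setTI.
have mo : measurable_fun [set: R] (fun x => `|osc x|).
  by apply: measurableT_comp => //; exact: measurable_osc.
rewrite (_ : [set x | _] = (fun x => `|osc x|) @^-1` `]-oo, 5]); first exact: mo.
by apply/seteqP; split=> x /=; rewrite in_itv.
Qed.

Lemma bdd_le5 x : `|bdd x| <= 5.
Proof.
rewrite /bdd indicE; case: (boolP (x \in _)) => [/set_mem/= h|_].
  by rewrite mulr1.
by rewrite mulr0 normr0.
Qed.

Lemma atoms_cvg_ae : {ae leb, forall x,
  \sum_(0 <= k < n) gconv (sg k.+1) (atoms k.+1) x @[n --> \oo] --> f x - bdd x - rest x}.
Proof.
apply: (ae_leb_impl2 sum_jumps_ae resid_sum_ae) => x [K [G [hG fG]]] /ssum_cvg hr.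
have cJ : \sum_(0 <= k < n) jumps k.+1 x @[n --> \oo] --> G.
  apply: cvg_near_cst; near=> n; apply: hG; near: n; exact: nbhs_infty_ge.
have oE : osc x = f x - G by rewrite /osc (ssum_lim cJ).
have -> : f x - bdd x - rest x = G - rest x.
  rewrite /bdd indicE mem_set /=; last by rewrite oE.
  by rewrite mulr1 oE; ring.
rewrite (_ : (fun n => _) = (fun n => \sum_(0 <= k < n) jumps k.+1 x -
   \sum_(0 <= k < n) resid k.+1 x)); first exact: (cvgB cJ hr).
apply/funext => n; rewrite -[RHS]sumrB; apply: eq_bigr => k _.
by rewrite /Submission.resid opprB addrC subrK.
Unshelve. all: by end_near. Qed.

End step2.

(** [eta] and A are chosen before r and f, so the same Gaussian widths serve every step of the
    iteration and the bounds of successive steps form a geometric series once weighted. *)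
Lemma lbmo_step {R : realType} : exists eta A : R, [/\ 0 < eta <= 1, 0 <= A &
  forall (r : R) (f : R -> R), 0 < r -> lbmo r 1 f -> exists (g h : R -> R) (b : nat -> R -> R),
  [/\ measurable_fun [set: R] g, forall x, `|g x| <= 5, lbmo r 2^-1 h &
   [/\ forall k, measurable_fun [set: R] (b k),
       forall n x, \sum_(0 <= k < n) `|b k x| <= A &
       {ae (@lebesgue_measure R), forall x,
         \sum_(0 <= k < n) gconv (sg r eta k.+1) (b k) x @[n --> \oo]
           --> f x - g x - h x}]]].
Proof.
(* The parameters are eta = 2^-20, N = 2^20 + 1 and m = q = 60. Then 1 / N <= eta, 2^-60 = eta^3,
   and (2^10 * 60 + 2^15) * eta <= (2^16 + 2^15) / 2^20 < 1 / 2. *)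
have p20 : (0 : R) < 2 ^- 20 <= (1 : R).
  by rewrite invr_gt0 exprn_gt0//= invf_le1 ?exprn_gt0// exprn_ege1// ler1n.
have p60 : 2 ^- 60 <= (2 ^- 20) ^+ 3 :> R by rewrite exprVn -exprM.
have [N oN hN] : exists2 N, odd N & N%:R^-1 <= 2 ^- 20 :> R.
  exists (2 ^ 20).+1; first by rewrite oddS oddX.
  by rewrite lef_pV2 ?posrE ?exprn_gt0// -natrX ler_nat leqnSn.
exists (2 ^- 20), (8 * 60%:R); split => // r f r0 fB.
exists (bdd r f N), (rest r f (2 ^- 20) N 60), (fun k => atoms r f N 60 k.+1).
split.
- exact: measurable_bdd.
- exact: bdd_le5.
- apply: (lbmo_rest r0 fB p20 oN hN p60 p60).
  rewrite ler_pdivrMr ?exprn_gt0// ler_pdivlMl//.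
  apply: (@le_trans _ _ (2 * (2 ^+ 10 * 2 ^+ 6 + 2 ^+ 15))).
    by rewrite ler_pM2l// lerD2r ler_pM2l ?exprn_gt0// -natrX ler_nat.
  rewrite -exprD mulrDr -!exprS addSn -[leLHS]/(2 ^+ 17 + 2 ^+ 16).
  apply: (@le_trans _ _ (2 ^+ 17 + 2 ^+ 17)); first by rewrite lerD2l ler_weXn2l// ler1n.
  by rewrite -mulr2n -[leLHS]mulr_natl -exprS ler_weXn2l// ler1n.
- split.
  + by move=> k; exact: measurable_atoms.
  + move=> n x; rewrite (sum_shift n (fun k => `|atoms r f N 60 k x|)).
    exact: sum_atoms.
  + exact: atoms_cvg_ae.
Qed.

(** * Decomposition on the real line *)

Section halving.
Context {R : realType}.
Implicit Types (A : R) (u : nat -> R).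

Lemma sum_half_tail A M P : 0 <= A ->
  \sum_(M <= n < P) A * 2 ^- n <= 2 * A * 2 ^- M.
Proof.
move=> A0; have [MP|PM] := leqP M P; last first.
  by rewrite big_geq ?(ltnW PM)// !mulr_ge0// invr_ge0 exprn_ge0.
suff -> : \sum_(M <= n < P) A * 2 ^- n = 2 * A * 2 ^- M - 2 * A * 2 ^- P.
  by rewrite gerBl !mulr_ge0// invr_ge0 exprn_ge0.
rewrite -(subnKC MP); elim: (P - M)%N => [|n IH]; first by rewrite addn0 big_geq ?subrr.
rewrite addnS big_nat_recr/= ?leq_addr// IH exprS invfM.
rewrite -addrA; congr (_ + _); set z := 2 ^- _.
by rewrite (_ : 2 * A * (2^-1 * z) = A * z); [ring|field].
Qed.

Lemma nneseries_half_tail A M (v : nat -> R) : (forall n, 0 <= v n <= A * 2 ^- n) ->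
  (\sum_(M <= n <oo) (v n)%:E <= (2 * A * 2 ^- M)%:E)%E.
Proof.
move=> hv; have A0 : 0 <= A.
  by have /andP[a b] := hv 0%N; have := le_trans a b; rewrite expr0 invr1 mulr1.
apply: lime_le.
  by apply: is_cvg_nneseries => n _ _; rewrite lee_fin; case/andP: (hv n).
apply: nearW => P; rewrite sumEFin lee_fin.
apply: (le_trans (ler_sum _ (fun n _ => (andP (hv n)).2))).
exact: sum_half_tail.
Qed.

Lemma ssum_half_tail A M u : (forall n, `|u n| <= A * 2 ^- n) ->
  `|ssum u - \sum_(0 <= n < M) u n| <= 2 * A * 2 ^- M.
Proof.
move=> hu; rewrite -lee_fin; apply: (le_trans (ssum_dist _ _)).
by apply: nneseries_half_tail => n; rewrite normr_ge0/=.
Qed.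

(** Exchanging the sum over k with the series in n keeps the sum over all k of the absolute values
    bounded when the steps are superposed, instead of only each term. *)
Lemma sum_ssum_half_tail A M K (u : nat -> nat -> R) :
  (forall n, \sum_(0 <= k < K) `|u n k| <= A * 2 ^- n) ->
  \sum_(0 <= k < K) `|ssum (fun n => u n k) - \sum_(0 <= n < M) u n k|
    <= 2 * A * 2 ^- M.
Proof.
move=> hu; rewrite -lee_fin -sumEFin.
apply: (@le_trans _ _ (\sum_(0 <= k < K) \sum_(M <= n <oo) `|u n k|%:E)%E).
  by apply: lee_sum => k _; exact: ssum_dist.
rewrite -nneseries_sum//; under eq_eseriesr do rewrite sumEFin.
by apply: nneseries_half_tail => n; rewrite hu sumr_ge0.
Qed.

End halving.

Section gconv_linear.
Context {R : realType}.
Implicit Types (s x M : R) (b : R -> R).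
Local Notation leb := (@lebesgue_measure R).

Lemma gconvD s x b1 b2 M1 M2 : 0 < s ->
  measurable_fun [set: R] b1 -> measurable_fun [set: R] b2 ->
  (forall y, `|b1 y| <= M1) -> (forall y, `|b2 y| <= M2) ->
  gconv s (fun y => b1 y + b2 y) x = gconv s b1 x + gconv s b2 x.
Proof.
move=> s0 m1 m2 h1 h2; rewrite /gconv -RintegralD//.
- by apply: eq_Rintegral => y _; rewrite mulrDr.
- exact: (integrable_gk_mul x s0 m1 h1).
- exact: (integrable_gk_mul x s0 m2 h2).
Qed.

Lemma gconvZ s x b M c : 0 < s -> measurable_fun [set: R] b ->
  (forall y, `|b y| <= M) -> gconv s (fun y => c * b y) x = c * gconv s b x.
Proof.
move=> s0 m h; rewrite /gconv -RintegralZl//.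
  by apply: eq_Rintegral => y _; rewrite mulrCA.
exact: (integrable_gk_mul x s0 m h).
Qed.

Lemma gconv0 s x : gconv s (fun=> 0) x = 0.
Proof.
by rewrite /gconv /Rintegral; under eq_integral do rewrite mulr0; rewrite integral0.
Qed.

Lemma gconv_sum s x (b : nat -> R -> R) (M : nat -> R) n : 0 < s ->
  (forall k, measurable_fun [set: R] (b k)) -> (forall k y, `|b k y| <= M k) ->
  gconv s (fun y => \sum_(0 <= k < n) b k y) x = \sum_(0 <= k < n) gconv s (b k) x.
Proof.
move=> s0 mb bM; elim: n => [|n IH].
  by rewrite big_geq//; under eq_fun do rewrite big_geq//; exact: gconv0.
rewrite big_nat_recr//= -IH; under eq_fun do rewrite big_nat_recr//=.
apply: (@gconvD _ _ _ _ (\sum_(0 <= k < n) M k) (M n)) => //.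
- exact: measurable_sum.
- by move=> y; rewrite (le_trans (ler_norm_sum _ _ _))// ler_sum.
Qed.

End gconv_linear.

Section heat_sum.
Context {R : realType} (r : R) (r0 : 0 < r) (eta : R) (eta01 : 0 < eta <= 1).
Local Notation leb := (@lebesgue_measure R).
Local Notation sg := (sg r eta).
#[local] Hint Extern 0 (measurable (ico _ _)) => solve [exact: measurable_ico] : core.
Implicit Types (b : nat -> R -> R) (x y u : R).

Let sg0 k : 0 < sg k. Proof. exact: sg_gt0. Qed.

(** A bound on the sum of the |b k| does not by itself make the series of convolutions converge at a
    point. Finiteness of this majorant gives absolute convergence, and later integrability of the
    heat kernel against the measure. *)
Definition heat_sum b x : \bar R :=
  (\sum_(0 <= k <oo) \int[leb]_y (gk (sg k.+1) x y * `|b k y|)%:E)%E.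

Variables (b : nat -> R -> R) (M : R).
Hypotheses (mb : forall k, measurable_fun [set: R] (b k))
  (bM : forall n y, \sum_(0 <= k < n) `|b k y| <= M).

Lemma heat_sum_ge0 x : (0 <= heat_sum b x)%E.
Proof.
apply: nneseries_ge0 => k _ _; apply: integral_ge0 => y _.
by rewrite lee_fin mulr_ge0 ?gk_ge0.
Qed.

Lemma term_le k y : `|b k y| <= M.
Proof.
apply: le_trans (bM k.+1 y); rewrite big_nat_recr//= lerDr.
exact: sumr_ge0.
Qed.

Let mh k : measurable_fun [set: R * R] (fun p => gk (sg k.+1) p.1 p.2 * `|b k p.2|).
Proof.
apply: measurable_funM; first exact: (measurable_gk2 (sg0 k.+1)).
by apply: measurableT_comp => //; exact: (measurableT_comp (mb k)).
Qed.

Let h0 k p : 0 <= gk (sg k.+1) p.1 p.2 * `|b k p.2|.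
Proof. by rewrite mulr_ge0 ?gk_ge0. Qed.

Let mterm k : measurable_fun [set: R] (fun x => \int[leb]_y (gk (sg k.+1) x y * `|b k y|)%:E)%E.
Proof. exact: (measurable_int_itv (mh k) (h0 k) measurableT). Qed.

Lemma measurable_heat_sum : measurable_fun [set: R] (heat_sum b).
Proof.
apply: ge0_emeasurable_sum => [k x _ _|k _]; last exact: mterm.
by apply: integral_ge0 => y _; rewrite lee_fin (h0 k (x, y)).
Qed.

(** The near parts integrate to at most M times the length 4 * r of the hull, the far parts to at
    most 6 * M * r in all. *)
Lemma int_heat_sum u : (\int[leb]_(x in ico u r) heat_sum b x <= (10 * r * M)%:E)%E.
Proof.
have M0 : 0 <= M by exact: le_trans (normr_ge0 _) (term_le 0 0).
have [e0 e1] := andP eta01.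
rewrite integral_nneseries//; first last.
- by move=> k x _; apply: integral_ge0 => y _; rewrite lee_fin (h0 k (x, y)).
- by move=> k; apply: measurable_funTS; exact: mterm.
have i0 k : (0 <= \int[leb]_(x in ico u r) \int[leb]_y (gk (sg k.+1) x y * `|b k y|)%:E)%E.
  by apply: integral_ge0 => x _; apply: integral_ge0 => y _; rewrite lee_fin (h0 k (x, y)).
apply: lime_le; first by apply: is_cvg_nneseries => k _ _; exact: i0.
apply: nearW => n; have mH : measurable (hull r 0 0 u) by exact: measurable_hull.
have mab k : measurable_fun [set: R] (fun y => `|b k y|) by exact: measurableT_comp.
apply: (@le_trans _ _ (\sum_(0 <= k < n) ((\int[leb]_(y in hull r 0 0 u) `|b k y|%:E)
     + (6 * M * eta * scale r k.+1)%:E))%E).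
  apply: lee_sum => k _; rewrite -{1}(scale0 r).
  apply: (le_trans (@int_hull_split R r 0 r0 eta eta01 0 k.+1 u
    (fun p => gk (sg k.+1) p.1 p.2 * `|b k p.2|) M _ (mh k) _)) => //.
    by move=> p; rewrite h0/= ler_wpM2l ?gk_ge0// term_le.
  apply: leeD2r.
  exact: (@int_gk_near R r r0 eta eta01 _ _ k.+1 (fun y => `|b k y|) (measurable_ico _ _) mH (mab k)).
rewrite big_split/= -ge0_integral_sum//; last first.
  by move=> k; apply: measurable_funTS; apply: measurable_funEFin; exact: mab.
rewrite sumEFin -mulr_sumr (_ : 10 * r * M = M * (4 * r) + 6 * M * r); last by ring.
rewrite EFinD; apply: leeD.
  apply: (@le_trans _ _ (\int[leb]_(y in hull r 0 0 u) M%:E)%E).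
    under eq_integral do rewrite sumEFin.
    apply: le_intL => //; first exact: measurable_sum.
    by move=> y _; rewrite sumr_ge0//= bM.
  by rewrite intL_cst// /hull leb_itv scale0 ?mulr_ge0// ltW.
rewrite lee_fin (sum_shift n (fun k => scale r k)).
have hs := sum_scale r0 0 n; rewrite !add0n scale0 in hs.
have c1 : 6 * M * eta <= 6 * M by rewrite ler_piMr// mulr_ge0.
have c0 : 0 <= 6 * M * eta by rewrite !mulr_ge0// ltW.
apply: ler_pM => //; rewrite sumr_ge0// => k _; apply: ltW; exact: scale_gt0.
Qed.

Lemma heat_sum_ae : {ae leb, forall x, (heat_sum b x < +oo)%E}.
Proof.
apply: (ae_cover r0) => u.
have hI : leb.-integrable (ico u r) (heat_sum b).
  apply/integrableP; split; first by apply: measurable_funTS; exact: measurable_heat_sum.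
  under eq_integral do rewrite gee0_abs ?heat_sum_ge0//.
  by apply: (le_lt_trans (int_heat_sum u)); rewrite ltry.
have H := integrable_ae_leb (measurable_ico u r) hI.
apply: (ae_leb_impl H) => x hx /hx.
by rewrite ge0_fin_numE ?heat_sum_ge0.
Qed.

Lemma heat_sum_cvg x : (heat_sum b x < +oo)%E ->
  \sum_(0 <= k < n) gconv (sg k.+1) (b k) x @[n --> \oo]
     --> ssum (fun k => gconv (sg k.+1) (b k) x) /\
  (`|ssum (fun k => gconv (sg k.+1) (b k) x)|%:E <= heat_sum b x)%E.
Proof.
move=> hx; have hs : (\sum_(0 <= k <oo) `|gconv (sg k.+1) (b k) x|%:E <= heat_sum b x)%E.
  by apply: lee_nneseries => // k _; exact: (gconv_le x (sg0 _) (mb k) (term_le k)).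
split; first by apply: ssum_cvg; exact: le_lt_trans hx.
have := ssum_dist (fun k => gconv (sg k.+1) (b k) x) 0.
by rewrite big_geq// subr0 => /le_trans; apply.
Qed.

End heat_sum.

Lemma lbmo_double {R : realType} (r : R) (h : R -> R) :
  lbmo r 2^-1 h -> lbmo r 1 (fun x => 2 * h x).
Proof.
move=> [mh h1 h2]; have m2 a : measurable_fun [set: R] (fun y => `|h y - a|).
  by apply: measurableT_comp => //; exact: measurable_funB.
have e (l : R) : (1 * l)%:E = (2%:E * (2^-1 * l)%:E)%E.
  by rewrite -EFinM mulrA divff.
split.
- exact: measurable_funM.
- move=> x l hl; have [m hm] := h1 x l hl; exists (2 * m).
  under eq_integral do rewrite -mulrBr normrM ger0_norm//.
  rewrite intLZ//; last exact: measurable_ico.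
  by rewrite e lee_wpmul2l// lee_fin.
- move=> x; under eq_integral do rewrite normrM ger0_norm//.
  rewrite intLZ//; [|exact: measurable_ico|exact: measurableT_comp].
  by rewrite e lee_wpmul2l// lee_fin.
Qed.

Lemma cvg_lincomb {R : realType} (M : nat) (c : nat -> R) (u : nat -> nat -> R) (l : nat -> R) :
  (forall n, u n K @[K --> \oo] --> l n) ->
  \sum_(0 <= n < M) c n * u n K @[K --> \oo] --> \sum_(0 <= n < M) c n * l n.
Proof.
move=> hu; elim: M => [|M IH].
  rewrite (_ : (fun K => _) = fun=> 0); first by rewrite big_geq//; exact: cvg_cst.
  by apply/funext => K; rewrite big_geq.
rewrite (_ : (fun K => _) = fun K => \sum_(0 <= n < M) c n * u n K + c M * u M K).
  by rewrite big_nat_recr//=; apply: cvgD => //; apply: cvgMr; exact: hu.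
by apply/funext => K; rewrite big_nat_recr.
Qed.

Section iteration.
Context {R : realType} (eta A : R) (eta01 : 0 < eta <= 1) (A0 : 0 <= A).
Variables (r : R) (r0 : 0 < r).
Local Notation leb := (@lebesgue_measure R).
Local Notation sg := (sg r eta).
Implicit Types (x y : R) (n k M K : nat).
#[local] Hint Extern 0 (measurable (ico _ _)) => solve [exact: measurable_ico] : core.

Variables (F g : nat -> R -> R) (b : nat -> nat -> R -> R).
Hypotheses (FB : forall n, lbmo r 1 (F n))
  (mg : forall n, measurable_fun [set: R] (g n)) (g5 : forall n x, `|g n x| <= 5)
  (mb : forall n k, measurable_fun [set: R] (b n k))
  (bA : forall n K x, \sum_(0 <= k < K) `|b n k x| <= A)
  (Fcvg : forall n, {ae leb, forall x,
     \sum_(0 <= k < K) gconv (sg k.+1) (b n k) x @[K --> \oo]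
        --> F n x - g n x - F n.+1 x / 2}).

Let sg0 k : 0 < sg k. Proof. exact: sg_gt0. Qed.

Let gs n x : R := 2 ^- n * g n x.
Let bs n k x : R := 2 ^- n * b n k x.
Definition good x : R := ssum (fun n => gs n x).
Definition atom k x : R := ssum (fun n => bs n k x).
Let part M k x : R := \sum_(0 <= n < M) bs n k x.

Let p2 n : 0 <= 2 ^- n :> R. Proof. by rewrite invr_ge0 exprn_ge0. Qed.

Let gsE n x : `|gs n x| <= 5 * 2 ^- n.
Proof. by rewrite normrM ger0_norm// mulrC ler_wpM2r. Qed.

Let bsE K n x : \sum_(0 <= k < K) `|bs n k x| <= A * 2 ^- n.
Proof.
under eq_bigr do rewrite normrM ger0_norm//.
by rewrite -mulr_sumr mulrC ler_wpM2r.
Qed.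

Let mgs n : measurable_fun [set: R] (gs n). Proof. exact: measurable_funM. Qed.
Let mbs n k : measurable_fun [set: R] (bs n k). Proof. exact: measurable_funM. Qed.

Lemma measurable_good : measurable_fun [set: R] good.
Proof. exact: measurable_ssum. Qed.

Lemma measurable_atom k : measurable_fun [set: R] (atom k).
Proof. by apply: (measurable_ssum (u := fun n x => bs n k x)). Qed.

Let good_tail M x : `|good x - \sum_(0 <= n < M) gs n x| <= 10 * 2 ^- M.
Proof.
have := ssum_half_tail M (fun n => gsE n x).
by rewrite (_ : 2 * 5 = 10)//; ring.
Qed.

Let atom_tail M K x : \sum_(0 <= k < K) `|atom k x - part M k x| <= 2 * A * 2 ^- M.
Proof. exact: (@sum_ssum_half_tail R A M K (fun n k => bs n k x) (fun n => bsE K n x)). Qed.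

Lemma good_le x : `|good x| <= 10.
Proof. by have := good_tail 0 x; rewrite big_geq// subr0 expr0 invr1 mulr1. Qed.

Lemma sum_atom K x : \sum_(0 <= k < K) `|atom k x| <= 2 * A.
Proof.
have := atom_tail 0 K x; rewrite expr0 invr1 mulr1; apply: le_trans.
by apply: ler_sum => k _; rewrite /part big_geq// subr0.
Qed.

Let mpart M k : measurable_fun [set: R] (part M k).
Proof. exact: measurable_sum. Qed.

Let diff M k y : R := atom k y - part M k y.

Let mdiff M k : measurable_fun [set: R] (diff M k).
Proof. by apply: measurable_funB; [exact: measurable_atom|]. Qed.

Let bsA n k y : `|bs n k y| <= A * 2 ^- n.
Proof.
have := bsE k.+1 n y; rewrite big_nat_recr//=; apply: le_trans.
by rewrite lerDr sumr_ge0.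
Qed.

Let part_cvg M : {ae leb, forall x,
  \sum_(0 <= k < K) gconv (sg k.+1) (part M k) x @[K --> \oo]
    --> F 0 x - \sum_(0 <= n < M) gs n x - 2 ^- M * F M x}.
Proof.
apply: (ae_leb_impl (ae_leb_forall Fcvg)) => x hx.
have e K : \sum_(0 <= k < K) gconv (sg k.+1) (part M k) x =
   \sum_(0 <= n < M) 2 ^- n * \sum_(0 <= k < K) gconv (sg k.+1) (b n k) x.
  under eq_bigr => k _ do rewrite (@gconv_sum _ _ _ (fun n => bs n k) (fun n => A * 2 ^- n))//.
  rewrite exchange_big/=; apply: eq_bigr => n _; rewrite mulr_sumr.
  apply: eq_bigr => k _; apply: (@gconvZ _ _ _ _ A) => // y.
  have := bA n k.+1 y; rewrite big_nat_recr//=; apply: le_trans.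
  by rewrite lerDr sumr_ge0.
under eq_fun do rewrite e.
have t : \sum_(0 <= n < M) 2 ^- n * (F n x - g n x - F n.+1 x / 2) =
    F 0 x - \sum_(0 <= n < M) gs n x - 2 ^- M * F M x.
  elim: M {e} => [|M IH]; first by rewrite !big_geq// expr0 invr1 mul1r subr0 subrr.
  by rewrite !big_nat_recr//= IH /gs exprSr invfM; ring.
rewrite -t; exact: (@cvg_lincomb _ M (fun n => 2 ^- n)
  (fun n K => \sum_(0 <= k < K) gconv (sg k.+1) (b n k) x) _ hx).
Qed.

Let diff_term M k x : gconv (sg k.+1) (atom k) x =
  gconv (sg k.+1) (part M k) x + gconv (sg k.+1) (diff M k) x.
Proof.
have hp y : `|part M k y| <= \sum_(0 <= n < M) (A * 2 ^- n).
  by rewrite (le_trans (ler_norm_sum _ _ _))// ler_sum.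
rewrite -(gconvD x (sg0 k.+1) (mpart M k) (mdiff M k) hp
  (term_le (fun K y => atom_tail M K y) k)).
by congr (gconv _ _ x); apply/funext => y; rewrite /diff addrC subrK.
Qed.

(** The remainder 2^-M * F M and the convolutions of the tails [diff] are controlled in L^1 on
    intervals of length r, not pointwise. So the defect is bounded, for each M, by a function whose
    integral over such an interval is of order 2^-M, and it must vanish almost everywhere. *)
Let err x : R := F 0 x - good x - ssum (fun k => gconv (sg k.+1) (atom k) x).

Let err_le M : {ae leb, forall x, (`|err x|%:E <=
  (10 * 2 ^- M)%:E + ((2 ^- M * `|F M x|)%:E + heat_sum r eta (diff M) x))%E}.
Proof.
apply: (ae_leb_impl (part_cvg M)) => x hx.
have [hf|] := ltP (heat_sum r eta (diff M) x) +oo%E; last first.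
  by case: (heat_sum r eta (diff M) x) => // _; rewrite addeC/= leey.
have [c1 c2] := @heat_sum_cvg R r r0 eta eta01 (diff M) _ (mdiff M) (fun K y => atom_tail M K y) x hf.
have e : ssum (fun k => gconv (sg k.+1) (atom k) x) =
   F 0 x - \sum_(0 <= n < M) gs n x - 2 ^- M * F M x + ssum (fun k => gconv (sg k.+1) (diff M k) x).
  apply: ssum_lim; rewrite (_ : (fun n => _) = (fun n =>
    \sum_(0 <= k < n) gconv (sg k.+1) (part M k) x + \sum_(0 <= k < n) gconv (sg k.+1) (diff M k) x)).
    exact: (cvgD hx c1).
  by apply/funext => n; rewrite -big_split/=; apply: eq_bigr => k _; exact: diff_term.
rewrite /err e; set D := ssum _ in c2 *; have gt := good_tail M x.
apply: (@le_trans _ _ ((10 * 2 ^- M)%:E + ((2 ^- M * `|F M x|)%:E + `|D|%:E))%E); last first.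
  by rewrite leeD// leeD.
rewrite -!EFinD lee_fin.
rewrite (_ : _ - _ = - (good x - \sum_(0 <= n < M) gs n x) + (2 ^- M * F M x - D)); last by ring.
rewrite (le_trans (ler_normD _ _))// normrN lerD// (le_trans (ler_normB _ _))//.
by rewrite normrM ger0_norm.
Qed.

Let merr : measurable_fun [set: R] err.
Proof.
apply: measurable_funB; first by apply: measurable_funB; [case: (FB 0)|exact: measurable_good].
apply: (measurable_ssum (u := fun k x => gconv (sg k.+1) (atom k) x)) => k.
apply: (measurable_gconv (M := 2 * A)) => //; first exact: measurable_atom.
by move=> y; exact: (term_le sum_atom k).
Qed.

Let int_err u M : (\int[leb]_(x in ico u r) `|err x|%:E <= ((11 + 20 * A) * r * 2 ^- M)%:E)%E.
Proof.
have mF : measurable_fun [set: R] (fun x => `|F M x|).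
  by apply: measurableT_comp => //; case: (FB M).
have mhs : measurable_fun [set: R] (heat_sum r eta (diff M)).
  exact: measurable_heat_sum.
have hs0 x : (0 <= heat_sum r eta (diff M) x)%E by exact: heat_sum_ge0.
apply: (@le_trans _ _ (\int[leb]_(x in ico u r)
   ((10 * 2 ^- M)%:E + ((2 ^- M * `|F M x|)%:E + heat_sum r eta (diff M) x)))%E).
  apply: ae_ge0_le_integral => //.
  - by apply: measurable_funTS; apply: measurable_funEFin; exact: measurableT_comp.
  - by move=> x _; rewrite !adde_ge0 ?lee_fin ?mulr_ge0.
  - apply: measurable_funTS; apply: emeasurable_funD => //; apply: emeasurable_funD => //.
    by apply: measurable_funEFin; exact: measurable_funM.
  - by apply: (ae_leb_impl (err_le M)) => x h _.
have m1 : measurable_fun [set: R] (fun x => (2 ^- M * `|F M x|)%:E).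
  by apply: measurable_funEFin; exact: measurable_funM.
have f0 x : (0 <= (2 ^- M * `|F M x|)%:E)%E by rewrite lee_fin mulr_ge0.
rewrite ge0_integralD//; first last.
- by apply: measurable_funTS; apply: emeasurable_funD.
- by move=> x _; rewrite adde_ge0.
rewrite ge0_integralD//; last 2 first.
- exact: measurable_funTS.
- exact: measurable_funTS.
rewrite intL_cst// ?mulr_ge0// leb_itv ?(ltW r0)// intLZ//.
rewrite (_ : (11 + 20 * A) * r * 2 ^- M = 10 * 2 ^- M * r + (2 ^- M * (1 * r) +
   10 * r * (2 * A * 2 ^- M))); last by ring.
rewrite EFinD; apply: leeD; first by rewrite EFinM.
rewrite EFinD; apply: leeD; last first.
  exact: (@int_heat_sum R r r0 eta eta01 (diff M) _ (mdiff M) (fun K y => atom_tail M K y) u).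
by rewrite [leRHS]EFinM lee_wpmul2l ?lee_fin//; case: (FB M).
Qed.

Let err0 : {ae leb, forall x, err x = 0}.
Proof.
apply: (ae_cover r0) => u.
have z : (\int[leb]_(x in ico u r) `|(err x)%:E| = 0)%E.
  apply/eqP; rewrite eq_le integral_ge0// andbT.
  apply/lee_addgt0Pr => e e0; rewrite add0e.
  pose C := (11 + 20 * A) * r.
  have C0 : 0 < C by rewrite mulr_gt0// ltr_wpDr// mulr_ge0.
  (* Here scale C M stands for the bound C * 2^-M, not for a length. *)
  have [M hM] := scale_small C0 e0.
  apply: (le_trans (int_err u M)); rewrite lee_fin ltW//.
have me : measurable_fun (ico u r) (fun x => (err x)%:E).
  by apply: measurable_funTS; exact: measurable_funEFin.
have := (@ae_eq_integral_abs _ (measurableTypeR R) R leb (ico u r) (measurable_ico _ _) _ me).1 z.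
move=> H; apply: (ae_leb_impl H) => x hx /hx.
by move=> [].
Qed.

Lemma iteration_cvg : {ae leb, forall x, (heat_sum r eta atom x < +oo)%E /\
  \sum_(0 <= k < n) gconv (sg k.+1) (atom k) x @[n --> \oo] --> F 0 x - good x}.
Proof.
have ms k : measurable_fun [set: R] (atom k) by exact: measurable_atom.
apply: (ae_leb_impl2 err0 (heat_sum_ae r0 eta01 ms sum_atom)) => x ex hx; split => //.
have [+ _] := heat_sum_cvg r0 eta01 ms sum_atom hx.
suff -> : F 0 x - good x = ssum (fun k => gconv (sg k.+1) (atom k) x) by [].
by move: ex; rewrite /err => /eqP; rewrite subr_eq0 => /eqP.
Qed.

End iteration.

Lemma lbmo_heat {R : realType} : exists eta A : R, [/\ 0 < eta <= 1, 0 <= A &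
  forall (r : R) (f : R -> R), 0 < r -> lbmo r 1 f ->
  exists (g : R -> R) (b : nat -> R -> R),
  [/\ measurable_fun [set: R] g, forall x, `|g x| <= 10,
       forall k, measurable_fun [set: R] (b k),
       forall n x, \sum_(0 <= k < n) `|b k x| <= A &
       {ae (@lebesgue_measure R), forall x, (heat_sum r eta b x < +oo)%E /\
         \sum_(0 <= k < n) gconv (sg r eta k.+1) (b k) x @[n --> \oo] --> f x - g x}]].
Proof.
have [eta [A [eta01 A0 H]]] := @lbmo_step R.
exists eta, (2 * A); split => // [|r f r0 fB]; first exact: mulr_ge0.
(* The class is packed into a subtype so that the step, made into a function by choice, can be
   iterated. Doubling the remainder restores the constant 1, which is where the weights 2^-n come
   from. *)
pose T := {f : R -> R | lbmo r 1 f}.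
have H' (F : T) : exists p : (R -> R) * (R -> R) * (nat -> R -> R),
   [/\ measurable_fun [set: R] p.1.1, forall x, `|p.1.1 x| <= 5, lbmo r 2^-1 p.1.2 &
   [/\ forall k, measurable_fun [set: R] (p.2 k),
       forall n x, \sum_(0 <= k < n) `|p.2 k x| <= A &
       {ae (@lebesgue_measure R), forall x,
         \sum_(0 <= k < n) gconv (sg r eta k.+1) (p.2 k) x @[n --> \oo]
           --> sval F x - p.1.1 x - p.1.2 x}]].
  have [g [h [b hb]]] := H r (sval F) r0 (svalP F).
  by exists (g, h, b).
have [P hP] := choice H'.
pose next (F : T) : T := exist _ _ (lbmo_double (let: And4 _ _ h _ := hP F in h)).
pose F n : T := iter n next (exist _ f fB).
pose g n := (P (F n)).1.1; pose b n := (P (F n)).2.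
have Fc n : {ae (@lebesgue_measure R), forall x,
     \sum_(0 <= k < K) gconv (sg r eta k.+1) (b n k) x @[K --> \oo]
        --> sval (F n) x - g n x - sval (F n.+1) x / 2}.
  have [_ _ _ [_ _ h]] := hP (F n); apply: (ae_leb_impl h) => x.
  suff -> : sval (F n.+1) x / 2 = (P (F n)).1.2 x by [].
  by rewrite /= mulrC mulKf.
have mg n : measurable_fun [set: R] (g n) by have [] := hP (F n).
have g5 n x : `|g n x| <= 5 by have [_ h _ _] := hP (F n); exact: h.
have mb n k : measurable_fun [set: R] (b n k) by have [_ _ _ [h _ _]] := hP (F n); exact: h.
have bA n K x : \sum_(0 <= k < K) `|b n k x| <= A by have [_ _ _ [_ h _]] := hP (F n); exact: h.
exists (good g), (atom b); split.
- exact: measurable_good.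
- by move=> x; exact: good_le.
- by move=> k; exact: measurable_atom.
- by move=> n x; exact: sum_atom.
- exact: (iteration_cvg eta01 A0 r0 (fun n => svalP (F n)) mg g5 mb bA Fc).
Qed.

(** * The Gamma function *)

Section pointwise_derivatives.
Context {R : realType}.
Implicit Types (f g : R -> R) (x a b c : R).

Lemma is_derive_add f g x a b : is_derive x 1 f a -> is_derive x 1 g b ->
  is_derive x 1 (fun t => f t + g t) (a + b).
Proof. exact: is_deriveD. Qed.

Lemma is_derive_sub f g x a b : is_derive x 1 f a -> is_derive x 1 g b ->
  is_derive x 1 (fun t => f t - g t) (a - b).
Proof. exact: is_deriveB. Qed.

Lemma is_derive_mul f g x a b : is_derive x 1 f a -> is_derive x 1 g b ->
  is_derive x 1 (fun t => f t * g t) (f x * b + g x * a).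
Proof. exact: is_deriveM. Qed.

Lemma is_derive_scale c f x a : is_derive x 1 f a ->
  is_derive x 1 (fun t => c * f t) (c * a).
Proof. exact: is_deriveZ. Qed.

Lemma is_derive_exp f x a : is_derive x 1 f a ->
  is_derive x 1 (fun t => expR (f t)) (expR (f x) * a).
Proof. exact: is_derive1_comp. Qed.

Lemma is_derive_ln f x a : 0 < f x -> is_derive x 1 f a ->
  is_derive x 1 (fun t => ln (f t)) (a / f x).
Proof.
move=> fx df; rewrite mulrC; apply: is_derive1_comp; exact: is_derive1_ln.
Qed.

Lemma is_derive_div c f x a : f x != 0 -> is_derive x 1 f a ->
  is_derive x 1 (fun t => c / f t) (- c * a / f x ^+ 2).
Proof.
move=> fx df; apply: (is_derive_eq (is_derive_scale c (is_deriveV fx df))).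
by rewrite -[_ *: a]/(_ * a); field.
Qed.

Lemma is_derive_continuous f x a : is_derive x 1 f a -> {for x, continuous f}.
Proof.
by move=> [df _]; apply: differentiable_continuous; apply/derivable1_diffP.
Qed.

End pointwise_derivatives.

Section improper.
Context {R : realType}.
Local Notation leb := (@lebesgue_measure R).
Implicit Types (f F u w G : R -> R) (s t x a b : R) (n : nat).

Definition pos : set R := `]0, +oo[%classic.

Lemma posP x : pos x <-> 0 < x.
Proof. by rewrite /pos/= in_itv/= andbT. Qed.

Lemma measurable_pos : measurable pos. Proof. exact: measurable_itv. Qed.

(** Compact intervals exhausting the half-line. With exponentials as end points, logarithms and
    powers are explicit when the boundary terms are evaluated. *)
Definition window n : set R := `[expR (- n.+1%:R), expR n.+1%:R]%classic.

Lemma measurable_window n : measurable (window n). Proof. exact: measurable_itv. Qed.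

Lemma window_pos n : window n `<=` pos.
Proof.
move=> x; rewrite /window/= in_itv/= => /andP[h _]; apply/posP.
exact: lt_le_trans (expR_gt0 _) h.
Qed.

Lemma bigcup_window : \bigcup_n window n = pos.
Proof.
apply/seteqP; split=> [x [n _ /window_pos]//|x /posP x0].
pose n := Num.truncn `|ln x|; exists n => //.
have := truncnS_gt `|ln x|; rewrite -/n ltr_norml => /andP[h1 h2].
rewrite /window/= in_itv/=; apply/andP; split.
  by rewrite -[leRHS]lnK ?posrE// ler_expR ltW.
by rewrite -[leLHS]lnK ?posrE// ler_expR ltW.
Qed.

Lemma homo_window : {homo window : n m / (n <= m)%N >-> (n <= m)%O}.
Proof.
move=> n m nm; apply/subsetPset => x; rewrite /window/= !in_itv/= => /andP[a b].
have nm' : n.+1%:R <= m.+1%:R :> R by rewrite ler_nat ltnS.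
by rewrite (le_trans _ a) ?(le_trans b)// ler_expR// lerN2.
Qed.

Lemma continuous_pos_measurable f : (forall x, 0 < x -> {for x, continuous f}) ->
  measurable_fun pos f.
Proof.
move=> cf; apply: open_continuous_measurable_fun; first exact: interval_open.
by move=> x; rewrite inE => /posP; exact: cf.
Qed.

Lemma FTC_window f F n : (forall x, 0 < x -> {for x, continuous f}) ->
  (forall x, 0 < x -> is_derive x 1 F (f x)) ->
  (\int[leb]_(x in window n) (f x)%:E = (F (expR n.+1%:R))%:E - (F (expR (- n.+1%:R)))%:E)%E.
Proof.
move=> cf dF; have cF x : 0 < x -> {for x, continuous F}.
  by move=> x0; apply: is_derive_continuous; exact: dF.
have p x : x \in `[expR (- n.+1%:R), expR n.+1%:R] -> 0 < x.
  by rewrite in_itv/= => /andP[h _]; exact: lt_le_trans (expR_gt0 _) h.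
apply: continuous_FTC2.
- by rewrite ltr_expR (@lt_trans _ _ 0)// oppr_lt0.
- apply: continuous_in_subspaceT => x; rewrite inE => /p; exact: cf.
- split.
  + move=> x xi; have x0 : 0 < x by apply: p; apply: subset_itv_oo_cc xi.
    by case: (dF x x0).
  + by apply: cvg_at_right_filter; apply: cF; exact: expR_gt0.
  + by apply: cvg_at_left_filter; apply: cF; exact: expR_gt0.
- move=> x xi; have x0 : 0 < x by apply: p; apply: subset_itv_oo_cc xi.
  by rewrite derive1E; apply: derive_val; exact: dF.
Qed.

Lemma int_window_cvg f : (forall x, 0 < x -> 0 <= f x) ->
  (forall x, 0 < x -> {for x, continuous f}) ->
  (\int[leb]_(x in window n) (f x)%:E)%E @[n --> \oo] --> (\int[leb]_(x in pos) (f x)%:E)%E.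
Proof.
move=> f0 cf; rewrite -bigcup_window; apply: ge0_nondecreasing_set_cvg_integral.
- exact: homo_window.
- exact: measurable_window.
- move=> n; apply: (measurable_funS measurable_pos (@window_pos n)).
  by apply/measurable_EFinP; exact: continuous_pos_measurable.
- by move=> n x /window_pos/posP x0; rewrite lee_fin f0.
Qed.

Lemma int_pos_bound f F (M : R) : (forall x, 0 < x -> 0 <= f x) ->
  (forall x, 0 < x -> {for x, continuous f}) ->
  (forall x, 0 < x -> is_derive x 1 F (f x)) -> (forall x, 0 < x -> 0 <= F x <= M) ->
  (\int[leb]_(x in pos) (f x)%:E <= M%:E)%E.
Proof.
move=> f0 cf dF FM; have h := int_window_cvg f0 cf.
rewrite -(cvg_lim _ h)//; apply: lime_le; first by apply/cvg_ex; eexists; exact: h.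
apply: nearW => n; rewrite (FTC_window n cf dF) -EFinB lee_fin.
have /andP[_ b1] := FM _ (expR_gt0 (n.+1%:R)); have /andP[a2 _] := FM _ (expR_gt0 (- n.+1%:R)).
by rewrite lerBlDr (le_trans b1)// lerDl.
Qed.

(** Integration by parts in the form used for the recursion of Gamma: the primitive G of u - w
    vanishes at both ends. Finiteness of both integrals lets the equality on each window be
    rearranged. *)
Lemma int_pos_eq u w G : (forall x, 0 < x -> 0 <= u x) -> (forall x, 0 < x -> 0 <= w x) ->
  (forall x, 0 < x -> {for x, continuous u}) -> (forall x, 0 < x -> {for x, continuous w}) ->
  (\int[leb]_(x in pos) (u x)%:E < +oo)%E -> (\int[leb]_(x in pos) (w x)%:E < +oo)%E ->
  (forall x, 0 < x -> is_derive x 1 G (u x - w x)) ->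
  G (expR n.+1%:R) @[n --> \oo] --> 0 -> G (expR (- n.+1%:R)) @[n --> \oo] --> 0 ->
  (\int[leb]_(x in pos) (u x)%:E = \int[leb]_(x in pos) (w x)%:E)%E.
Proof.
move=> u0 w0 cu cw fu fw dG g1 g2.
have hu := int_window_cvg u0 cu; have hw := int_window_cvg w0 cw.
have e n : (\int[leb]_(x in window n) (u x)%:E = \int[leb]_(x in window n) (w x)%:E +
    (G (expR n.+1%:R) - G (expR (- n.+1%:R)))%:E)%E.
  have mu : measurable_fun (window n) u.
    by apply: (measurable_funS measurable_pos (@window_pos n)); exact: continuous_pos_measurable.
  have mw : measurable_fun (window n) w.
    by apply: (measurable_funS measurable_pos (@window_pos n)); exact: continuous_pos_measurable.
  have le_win (h : R -> R) : measurable_fun pos h -> (forall x, 0 < x -> 0 <= h x) ->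
     (\int[leb]_(x in window n) (h x)%:E <= \int[leb]_(x in pos) (h x)%:E)%E.
    move=> mh h0; apply: ge0_subset_integral; [exact: measurable_window|exact: measurable_pos| | |exact: window_pos].
      exact/measurable_EFinP.
    by move=> x /posP; rewrite lee_fin; exact: h0.
  have iu : leb.-integrable (window n) (EFin \o u).
    apply/integrableP; split; first exact/measurable_EFinP.
    have -> : (\int[leb]_(x in window n) `|(EFin \o u) x| = \int[leb]_(x in window n) (u x)%:E)%E.
      by apply: eq_integral => x /set_mem/window_pos/posP x0; rewrite /= ger0_norm ?u0.
    by apply: le_lt_trans fu; apply: le_win => //; exact: continuous_pos_measurable.
  have iw : leb.-integrable (window n) (EFin \o w).
    apply/integrableP; split; first exact/measurable_EFinP.
    have -> : (\int[leb]_(x in window n) `|(EFin \o w) x| = \int[leb]_(x in window n) (w x)%:E)%E.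
      by apply: eq_integral => x /set_mem/window_pos/posP x0; rewrite /= ger0_norm ?w0.
    by apply: le_lt_trans fw; apply: le_win => //; exact: continuous_pos_measurable.
  have cuw x : 0 < x -> {for x, continuous (fun x => u x - w x)}.
    by move=> x0; apply: cvgB; [exact: cu|exact: cw].
  have := FTC_window n cuw dG; under eq_integral do rewrite EFinB.
  rewrite integralB_EFin//; last exact: measurable_window.
  have fw' : (\int[leb]_(x in window n) (w x)%:E)%E \is a fin_num.
    rewrite ge0_fin_numE; last first.
      by apply: integral_ge0 => x /window_pos/posP x0; rewrite lee_fin w0.
    by apply: le_lt_trans fw; apply: le_win => //; exact: continuous_pos_measurable.
  have fu' : (\int[leb]_(x in window n) (u x)%:E)%E \is a fin_num.
    rewrite ge0_fin_numE; last first.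
      by apply: integral_ge0 => x /window_pos/posP x0; rewrite lee_fin u0.
    by apply: le_lt_trans fu; apply: le_win => //; exact: continuous_pos_measurable.
  rewrite -(fineK fu') -(fineK fw') -!EFinB => -[h]; rewrite -EFinD; congr (_%:E).
  lra.
have c2 : (\int[leb]_(x in window n) (u x)%:E)%E @[n --> \oo] -->
   (\int[leb]_(x in pos) (w x)%:E + (0 - 0 : R)%:E)%E.
  under eq_fun do rewrite e.
  apply: cvgeD => //; first by rewrite fin_num_adde_defl.
  by apply: cvg_EFin; [exact: nearW|exact: cvgB].
by have := cvg_unique _ hu c2; rewrite subr0 adde0; apply.
Qed.

End improper.

Section gamma.
Context {R : realType}.
Local Notation leb := (@lebesgue_measure R).
Implicit Types (s t x a b : R) (n : nat).

Lemma exp_cvg0 (u : nat -> R) a c : 0 < a -> (forall n, u n <= c - a * n.+1%:R) ->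
  expR (u n) @[n --> \oo] --> 0.
Proof.
move=> a0 hu; have h : (expR c / a) * harmonic n @[n --> \oo] --> (0 : R).
  by rewrite -[0](mulr0 (expR c / a)); apply: cvgMr; exact: cvg_harmonic.
apply: (squeeze_cvgr _ (cvg_cst 0) h); apply: nearW => n; rewrite expR_ge0/=.
apply: (@le_trans _ _ (expR (c - a * n.+1%:R))); first by rewrite ler_expR.
rewrite expRD -mulrA ler_pM2l ?expR_gt0// expRN /harmonic/= -invfM lef_pV2 ?posrE ?expR_gt0 ?mulr_gt0//.
by rewrite (le_trans _ (expR_ge1Dx _))// lerDr.
Qed.

Lemma powRP x s : 0 < x -> x `^ s = expR (s * ln x).
Proof. by move=> x0; rewrite /powR gt_eqF. Qed.

(** The logarithm lies below its tangent at a; both sides are multiplied by a. *)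
Lemma ln_le_div x a : 0 < x -> 0 < a -> a * ln x <= x + (a * ln a - a).
Proof.
move=> x0 a0; have := @le_ln1Dx R (x / a - 1); rewrite addrCA subrr addr0.
have xa : 0 < x / a by exact: divr_gt0.
rewrite ltrBrDr addrC subrr => /(_ xa); rewrite lnM ?posrE ?invr_gt0// lnV ?posrE//.
by rewrite -(ler_pM2l a0) mulrBr mulrBr mulrCA divff ?gt_eqF// !mulr1; lra.
Qed.

Let gam s t : R := expR ((s - 1) * ln t - t).

Let gamE s t : 0 < t -> t `^ (s - 1) * expR (- t) = gam s t.
Proof. by move=> t0; rewrite powRP// -expRD. Qed.

Let cgam s t : 0 < t -> {for t, continuous (gam s)}.
Proof.
move=> t0; apply: continuous_comp; last exact: continuous_expR.
apply: cvgB; last exact: cvg_id.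
by apply: cvgMr; exact: continuous_ln.
Qed.

(* [(t / (1 + t)) `^ s] is a bounded primitive of [s * t `^ (s - 1) / (1 + t) `^ (s + 1)] *)
Lemma gam_fin s : 0 < s -> (\int[leb]_(t in pos) (gam s t)%:E < +oo)%E.
Proof.
move=> s0; pose c := (s + 1) * ln (s + 1) - (s + 1) + 1.
pose F t := expR (s * (ln t - ln (1 + t))).
pose f t := s * expR ((s - 1) * ln t - (s + 1) * ln (1 + t)).
have s1 : 0 < s + 1 by rewrite addr_gt0.
have cf t : 0 < t -> {for t, continuous f}.
  move=> t0; apply: cvgMr; apply: continuous_comp; last exact: continuous_expR.
  have t1 : 0 < 1 + t by rewrite addr_gt0.
  apply: cvgB; apply: cvgMr; first exact: continuous_ln.
  apply: (@continuous_comp _ _ _ (fun t => 1 + t) (@ln R)); last exact: continuous_ln.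
  by apply: cvgD; [exact: cvg_cst|exact: cvg_id].
have dF t : 0 < t -> is_derive t 1 F (f t).
  move=> t0; have t1 : 0 < 1 + t by rewrite addr_gt0.
  have d1 : is_derive t 1 (fun t => 1 + t) (0 + 1 : R).
    exact: is_derive_add.
  have d2 := is_derive_scale s (is_derive_sub (is_derive1_ln t0) (is_derive_ln t1 d1)).
  apply: (is_derive_eq (is_derive_exp d2)).
  rewrite /f (_ : (s - 1) * _ - _ = s * (ln t - ln (1 + t)) + (- ln t - ln (1 + t))); last by ring.
  rewrite expRD expRD !expRN !lnK ?posrE//.
  by field; rewrite !gt_eqF.
have FM t : 0 < t -> 0 <= F t <= 1.
  move=> t0; rewrite expR_ge0/= -expR0 ler_expR pmulr_rle0// subr_le0 ler_ln ?posrE ?addr_gt0//.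
  by rewrite lerDr.
have f0 t : 0 < t -> 0 <= f t by move=> _; rewrite mulr_ge0 ?expR_ge0// ltW.
have hf := int_pos_bound f0 cf dF FM.
apply: (@le_lt_trans _ _ ((s^-1 * expR c)%:E * \int[leb]_(t in pos) (f t)%:E)%E); last first.
  apply: (@le_lt_trans _ _ ((s^-1 * expR c)%:E * 1%:E)%E); last by rewrite -EFinM ltry.
  by rewrite lee_wpmul2l// lee_fin mulr_ge0 ?expR_ge0// invr_ge0 ltW.
have mf : measurable_fun pos f by exact: continuous_pos_measurable.
rewrite -ge0_integralZl_EFin//; last 4 first.
- exact: measurable_pos.
- by move=> t /posP; rewrite lee_fin; exact: f0.
- exact/measurable_EFinP.
- by rewrite mulr_ge0 ?expR_ge0// invr_ge0 ltW.
apply: ge0_le_integral.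
- exact: measurable_pos.
- by move=> t _; rewrite lee_fin expR_ge0.
- by apply/measurable_EFinP; apply: continuous_pos_measurable => t; exact: cgam.
- by apply/measurable_EFinP; exact: measurable_funM.
- move=> t /posP t0; rewrite -EFinM lee_fin /f mulrACA mulVf ?gt_eqF// mul1r -expRD ler_expR.
  (* Compares exp (- t) with a multiple of (1 + t)^-(s + 1), which turns the Gamma integrand into
     the integrand with a bounded primitive. *)
  have := @ln_le_div (1 + t) (s + 1) (addr_gt0 ltr01 t0) s1.
  by rewrite /c; lra.
Qed.

Lemma Gamma_gam s : (\int[leb]_(t in pos) (gam s t)%:E)%E \is a fin_num ->
  (Gamma s)%:E = (\int[leb]_(t in pos) (gam s t)%:E)%E.
Proof.
move=> h; rewrite /Gamma /Rintegral -/pos.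
have -> : (\int[leb]_(t in pos) (t `^ (s - 1) * expR (- t))%:E = \int[leb]_(t in pos) (gam s t)%:E)%E.
  by apply: eq_integral => t /set_mem/posP t0; rewrite gamE.
by rewrite fineK.
Qed.

Let gam_fin_num s : 0 < s -> (\int[leb]_(t in pos) (gam s t)%:E)%E \is a fin_num.
Proof.
move=> s0; rewrite ge0_fin_numE ?gam_fin// integral_ge0// => t _.
by rewrite lee_fin expR_ge0.
Qed.

Lemma Gamma_gt0 s : 0 < s -> 0 < Gamma s.
Proof.
move=> s0; rewrite -lte_fin Gamma_gam ?gam_fin_num//.
pose c := expR (- `|s - 1| - 2).
have cI := measurable_ico (1 : R) 1.
apply: (@lt_le_trans _ _ (\int[leb]_(t in ico 1%R 1%R) c%:E)%E).
  by rewrite intL_cst ?expR_ge0// leb_itv// mule1 lte_fin expR_gt0.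
have mg : measurable_fun pos (gam s).
  by apply: continuous_pos_measurable => t; exact: cgam.
have sub : ico 1 1 `<=` (pos : set R).
  by move=> t; rewrite /ico/= in_itv/= => /andP[t1 _]; apply/posP; exact: lt_le_trans t1.
apply: (@le_trans _ _ (\int[leb]_(t in ico 1%R 1%R) (gam s t)%:E)%E).
  apply: ge0_le_integral => //.
  - by move=> t _; rewrite lee_fin expR_ge0.
  - by apply/measurable_EFinP; exact: measurable_funS measurable_pos sub mg.
  - move=> t; rewrite /ico/= in_itv/= => /andP[t1 t2]; rewrite lee_fin ler_expR.
    have l0 : 0 <= ln t by rewrite ln_ge0.
    have l1 : ln t <= 1.
      by have := @le_ln1Dx R (t - 1); rewrite addrCA subrr addr0 => h; rewrite (le_trans (h _))//; lra.
    have : - `|s - 1| <= (s - 1) * ln t.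
      rewrite lerNl -mulNr (le_trans (ler_norm _))// normrM normrN (ger0_norm l0).
      by rewrite ler_piMr.
    lra.
apply: ge0_subset_integral => //; first exact: measurable_pos.
  exact/measurable_EFinP.
by move=> t _; rewrite lee_fin expR_ge0.
Qed.

Lemma GammaS s : 0 < s -> Gamma (s + 1) = s * Gamma s.
Proof.
move=> s0; have s1 : 0 < s + 1 by rewrite addr_gt0.
apply: EFin_inj; rewrite Gamma_gam ?gam_fin_num// EFinM Gamma_gam ?gam_fin_num//.
have mg : measurable_fun pos (gam s).
  by apply: continuous_pos_measurable => t; exact: cgam.
have z : (\int[leb]_(t in pos) (s * gam s t)%:E = s%:E * \int[leb]_(t in pos) (gam s t)%:E)%E.
  rewrite -ge0_integralZl_EFin//.
  - exact: measurable_pos.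
  - by move=> t _; rewrite lee_fin expR_ge0.
  - exact/measurable_EFinP.
  - exact: ltW.
rewrite -z; pose G t : R := (- 1) * expR (s * ln t - t).
apply: (@int_pos_eq _ _ _ G).
- by move=> t _; exact: expR_ge0.
- by move=> t _; rewrite mulr_ge0 ?expR_ge0// ltW.
- by move=> t; exact: cgam.
- by move=> t t0; apply: cvgMr; exact: cgam.
- exact: gam_fin.
- rewrite z -(fineK (gam_fin_num s0)) -EFinM; exact: ltry.
- move=> t t0; rewrite /G.
  have d := is_derive_exp (is_derive_sub (is_derive_scale s (is_derive1_ln t0)) (is_derive_id t 1)).
  apply: (is_derive_eq (is_derive_scale (-1) d)).
  rewrite /gam addrK (_ : (s - 1) * ln t - t = - ln t + (s * ln t - t)); last by ring.
  by rewrite [expR (- ln t + _)]expRD expRN lnK ?posrE//; field; rewrite gt_eqF.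
- have h : expR (s * ln (expR n.+1%:R) - expR n.+1%:R) @[n --> \oo] --> (0 : R).
    pose c := (s + 1) * ln (s + 1) - (s + 1).
    apply: (@exp_cvg0 _ 1 c) => // n.
    have := @ln_le_div (expR n.+1%:R) (s + 1) (expR_gt0 _) s1.
    by rewrite expRK /c; lra.
  by rewrite -[0](mulr0 (- 1)); exact: cvgMr h.
- have h : expR (s * ln (expR (- n.+1%:R)) - expR (- n.+1%:R)) @[n --> \oo] --> (0 : R).
    apply: (@exp_cvg0 _ s 0) => // n; rewrite expRK.
    by have := expR_ge0 (- n.+1%:R : R); lra.
  by rewrite -[0](mulr0 (- 1)); exact: cvgMr h.
Qed.

End gamma.

(** * The modified Bessel function *)

Section bessel_series.
Context {R : realType} (c : R) (c0 : 0 < c).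
Implicit Types (s x : R) (k n : nat).

(* The coefficients of 0F1(; c; .): I_nu is a power of z times the value of
   this series at z^2/4, for c = nu + 1. *)
Fixpoint bcoef k : R :=
  if k is k'.+1 then bcoef k' / (k'.+1%:R * (k'%:R + c)) else 1.

Let kc0 k : 0 < k%:R + c. Proof. by rewrite ltr_wpDl. Qed.

Lemma bcoef_gt0 k : 0 < bcoef k.
Proof. by elim: k => [//|k IH] /=; rewrite divr_gt0// mulr_gt0. Qed.

Lemma bcoef_diff k : pseries_diffs bcoef k = bcoef k / (k%:R + c).
Proof.
by rewrite /pseries_diffs /=; field; rewrite !gt_eqF.
Qed.

Lemma bcoef_diff2 k : pseries_diffs (pseries_diffs bcoef) k =
  bcoef k / ((k%:R + c) * (k.+1%:R + c)).
Proof.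
rewrite {1}/pseries_diffs bcoef_diff /=; field.
have := kc0 k; have : 0 <= k%:R :> R by [].
by move=> k0 k1; do ?(apply/andP; split); rewrite gt_eqF//; have := c0; lra.
Qed.

Lemma bcoef_le k : bcoef k <= (c^-1) ^+ k / k`!%:R.
Proof.
elim: k => [|k IH] /=; first by rewrite expr0 fact0 divr1.
rewrite (_ : c^-1 ^+ k.+1 / _ = (c^-1 ^+ k / k`!%:R) * (k.+1%:R * c)^-1); last first.
  by rewrite exprS factS natrM; field; rewrite !gt_eqF// ltr0n fact_gt0.
apply: ler_pM => //; first exact: ltW (bcoef_gt0 k).
  by rewrite invr_ge0 mulr_ge0// ltW.
by rewrite lef_pV2 ?posrE ?mulr_gt0// ler_pM2l// lerDr.
Qed.

(** As bcoef k <= c^-k / k!, an exponential series dominates. The form with a constant C also covers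
    the derived series, whose coefficients are bounded by multiples of [bcoef]. *)
Lemma dominated_pseries (a : nat -> R) (C : R) s : 0 <= s ->
  (forall k, 0 <= a k <= C * bcoef k) -> cvgn (pseries a s).
Proof.
move=> s0 ha; apply: (@series_le_cvg _ _ (fun k => C * exp_coeff (s / c) k)).
- by move=> n; rewrite mulr_ge0 ?exprn_ge0//; case/andP: (ha n).
- have C0 : 0 <= C.
    by have /andP[h1 h2] := ha 0%N; have := le_trans h1 h2; rewrite mulr1.
  by move=> n; rewrite mulr_ge0// exp_coeff_ge0// divr_ge0// ltW.
- move=> n; have /andP[h1 h2] := ha n.
  have C0 : 0 <= C.
    by have /andP[h3 h4] := ha 0%N; have := le_trans h3 h4; rewrite mulr1.
  apply: (@le_trans _ _ (C * bcoef n * s ^+ n)); first by rewrite ler_wpM2r// exprn_ge0.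
  rewrite -mulrA ler_wpM2l// (le_trans (ler_wpM2r (exprn_ge0 n s0) (bcoef_le n)))//.
  by rewrite /exp_coeff/= exprMn exprVn mulrAC [_ * s ^+ n]mulrC.
- rewrite (_ : series _ = (fun n => C * series (exp_coeff (s / c)) n)).
    by apply: is_cvgMr; exact: is_cvg_series_exp_coeff.
  by apply/funext => n; rewrite /series/= mulr_sumr.
Qed.

Lemma cvg_b s : 0 <= s -> cvgn (pseries bcoef s).
Proof.
by move=> s0; apply: (@dominated_pseries _ 1) => // k; rewrite mul1r lexx ltW// bcoef_gt0.
Qed.

Lemma cvg_b1 s : 0 <= s -> cvgn (pseries (pseries_diffs bcoef) s).
Proof.
move=> s0; apply: (@dominated_pseries _ c^-1) => // k; rewrite bcoef_diff.
have b0 := bcoef_gt0 k; rewrite divr_ge0 ?(ltW b0) ?(ltW (kc0 k))//= mulrC.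
by rewrite ler_pM2r// lef_pV2 ?posrE// lerDr.
Qed.

Lemma cvg_b2 s : 0 <= s -> cvgn (pseries (pseries_diffs (pseries_diffs bcoef)) s).
Proof.
move=> s0; apply: (@dominated_pseries _ (c * c)^-1) => // k; rewrite bcoef_diff2.
have b0 := bcoef_gt0 k.
rewrite divr_ge0 ?(ltW b0) ?mulr_ge0 ?(ltW (kc0 _))//= mulrC.
rewrite ler_pM2r// lef_pV2 ?posrE ?mulr_gt0//.
by apply: ler_pM; rewrite ?lerDr// ltW.
Qed.

Definition bsum s : R := limn (pseries bcoef s).
Definition bsum1 s : R := limn (pseries (pseries_diffs bcoef) s).
Definition bsum2 s : R := limn (pseries (pseries_diffs (pseries_diffs bcoef)) s).

(** Differentiating [bsum1] term by term requires the convergence of two further derived series,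
    this being the second. *)
Let cvg_b3 s : 0 <= s ->
  cvgn (pseries (pseries_diffs (pseries_diffs (pseries_diffs bcoef))) s).
Proof.
move=> s0; apply: (@dominated_pseries _ (c * c * c)^-1) => // k.
rewrite -[pseries_diffs _ k]/(k.+1%:R * pseries_diffs (pseries_diffs bcoef) k.+1).
rewrite bcoef_diff2 /=.
rewrite (_ : _ * _ = bcoef k / ((k%:R + c) * (k.+1%:R + c) * (k.+2%:R + c))); last first.
  field; have := kc0 k; have : 0 <= k%:R :> R by [].
by move=> k0 k1; do ?(apply/andP; split); rewrite gt_eqF//; have := c0; lra.
have b0 := bcoef_gt0 k.
rewrite divr_ge0 ?(ltW b0) ?mulr_ge0 ?(ltW (kc0 _))//= mulrC.
rewrite ler_pM2r// lef_pV2 ?posrE ?mulr_gt0//.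
by apply: ler_pM; rewrite ?mulr_ge0 ?lerDr ?(ltW c0)//; apply: ler_pM; rewrite ?lerDr// ltW.
Qed.

Lemma is_derive_bsum s : 0 <= s -> is_derive s 1 bsum (bsum1 s).
Proof.
move=> s0; have s1 : 0 <= s + 1 by rewrite addr_ge0.
apply: (@pseries_snd_diffs _ _ (s + 1)).
- exact: cvg_b.
- exact: cvg_b1.
- exact: cvg_b2.
- by rewrite !ger0_norm// ltrDl.
Qed.

Lemma is_derive_bsum1 s : 0 <= s -> is_derive s 1 bsum1 (bsum2 s).
Proof.
move=> s0; have s1 : 0 <= s + 1 by rewrite addr_ge0.
apply: (@pseries_snd_diffs _ _ (s + 1)).
- exact: cvg_b1.
- exact: cvg_b2.
- exact: cvg_b3.
- by rewrite !ger0_norm// ltrDl.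
Qed.

(** The differential equation of 0F1, that is, the recursion (k + 1) (k + c) bcoef (k + 1) = bcoef k
    read on series. The shift of index is handled on partial sums before the limit. *)
Lemma bsum_ode s : 0 <= s -> s * bsum2 s + c * bsum1 s = bsum s.
Proof.
move=> s0; have h0 := cvg_b s0; have h1 := cvg_b1 s0; have h2 := cvg_b2 s0.
have e n : pseries bcoef s n.+1 = s * pseries (pseries_diffs (pseries_diffs bcoef)) s n
    + c * pseries (pseries_diffs bcoef) s n.+1.
  rewrite /pseries /series/= !mulr_sumr [X in _ = _ + X]big_nat_recl//.
  rewrite big_nat_recl//= addrCA; congr (_ + _).
    by rewrite bcoef_diff expr0 !mulr1 add0r mulrCA mulfV ?mulr1// gt_eqF.
  rewrite -big_split/=; apply: eq_bigr => k _.
  rewrite {1}/pseries_diffs !bcoef_diff exprS /=.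
  field; have := kc0 k; have : 0 <= k%:R :> R by [].
by move=> k0 k1; do ?(apply/andP; split); rewrite gt_eqF//; have := c0; lra.
have l0 : pseries bcoef s n.+1 @[n --> \oo] --> bsum s.
  by rewrite (cvg_shiftS (pseries bcoef s)).
have l1 : pseries (pseries_diffs bcoef) s n.+1 @[n --> \oo] --> bsum1 s.
  by rewrite (cvg_shiftS (pseries (pseries_diffs bcoef) s)).
apply: (@cvg_unique _ (@Rhausdorff R) _ _ _ _ _ l0).
rewrite (_ : (fun n => _) = fun n =>
   s * pseries (pseries_diffs (pseries_diffs bcoef)) s n + c * pseries (pseries_diffs bcoef) s n.+1).
  by apply: cvgD; apply: cvgMr.
by apply/funext => n; exact: e.
Qed.

Lemma bsum_ge1 s : 0 <= s -> 1 <= bsum s.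
Proof.
move=> s0; apply: limr_ge; first exact: cvg_b.
near=> n; have n0 : (0 < n)%N by near: n; exact: nbhs_infty_gt.
rewrite -(prednK n0) /pseries /series/= big_nat_recl//= expr0 mulr1 lerDl.
by apply: sumr_ge0 => k _; rewrite mulr_ge0 ?exprn_ge0// ltW// (bcoef_gt0 k.+1).
Unshelve. all: by end_near. Qed.

Lemma bsum1_ge0 s : 0 <= s -> 0 <= bsum1 s.
Proof.
move=> s0; apply: limr_ge; first exact: cvg_b1.
apply: nearW => n; apply: sumr_ge0 => k _.
by rewrite /= bcoef_diff mulr_ge0 ?exprn_ge0 ?divr_ge0// ltW// bcoef_gt0.
Qed.

Lemma bsum_homo s x : 0 <= s <= x -> bsum s <= bsum x.
Proof.
move=> /andP[s0 sx]; have x0 := le_trans s0 sx.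
apply: ler_lim; [exact: cvg_b|exact: cvg_b|].
apply: nearW => n; apply: ler_sum => k _ /=.
by rewrite ler_pM2l ?bcoef_gt0// lerXn2r.
Qed.

End bessel_series.

Section monotone.
Context {R : realType}.

Lemma nonincr_from (f f' : R -> R) (a : R) : (forall x, a <= x -> is_derive x 1 f (f' x)) ->
  (forall x, a <= x -> f' x <= 0) -> forall x y, a <= x -> x <= y -> f y <= f x.
Proof.
move=> df f0 x y ax xy; apply: (@ler0_derive1_nincry _ f a) => //.
- by move=> z; rewrite in_itv/= andbT => /ltW/df [].
- move=> z; rewrite in_itv/= andbT => /ltW az; rewrite derive1E.
  by have := df z az => /@derive_val ->; exact: f0.
- apply: continuous_in_subspaceT => z; rewrite inE/= in_itv/= andbT => az.
  exact: is_derive_continuous (df z az).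
Qed.

End monotone.

Lemma expR_sub1_le {R : realType} (u : R) : `|expR u - 1| <= `|u| * expR `|u|.
Proof.
have [u0|u0] := leP 0 u.
  rewrite (ger0_norm u0) ger0_norm; last by rewrite subr_ge0 -[leLHS]expR0 ler_expR.
  have := expR_ge1Dx (- u); rewrite expRN -(ler_pM2r (expR_gt0 u)) mulVf ?gt_eqF ?expR_gt0//.
  lra.
rewrite (ltr0_norm u0) ltr0_norm; last by rewrite subr_lt0 -[ltRHS]expR0 ltr_expR.
have h1 := expR_ge1Dx u.
have h2 : 1 <= expR (- u) by rewrite -[leLHS]expR0 ler_expR; lra.
have : - u * 1 <= - u * expR (- u) by rewrite ler_wpM2l//; lra.
lra.
Qed.

(** * Behaviour of the Bessel function at 0 and at infinity *)

Section bessel_asymptotics.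
Context {R : realType} (lam : R) (lam0 : 0 < lam).
Implicit Types (x y z t : R).

Let c := lam + 2^-1.
Let c0 : 0 < c. Proof. by rewrite addr_gt0// invr_gt0. Qed.

Let sq z : R := z ^+ 2 / 4.
Let sq0 z : 0 <= sq z. Proof. by rewrite divr_ge0// sqr_ge0. Qed.
Let b z := bsum c (sq z).
Let b1 z := bsum1 c (sq z).
Let b2 z := bsum2 c (sq z).
Let bpos z : 0 < b z.
Proof. by apply: lt_le_trans (bsum_ge1 c0 (sq0 z)). Qed.

(* The logarithmic derivative, minus 1, of w z = z^lam * bsum c (z^2/4), which
   solves w'' = (1 + lam (lam - 1) / z^2) w. *)
Let p z : R := lam / z + 2^-1 * (z * (b1 z / b z)) - 1.
Let m := lam * (lam - 1).

Let dsq z : is_derive z 1 sq (z / 2).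
Proof.
have d := is_derive_scale 4^-1 (is_derive_mul (is_derive_id z (1 : R)) (is_derive_id z 1)).
rewrite (_ : sq = fun t => 4^-1 * (t * t)); last first.
  by apply/funext => t; rewrite /sq mulrC expr2.
by apply: (is_derive_eq d); field.
Qed.

Let db z : is_derive z 1 b (b1 z * (z / 2)).
Proof. by apply: (@is_derive1_comp _ (bsum c) sq); [exact: is_derive_bsum|exact: dsq]. Qed.

Let db1 z : is_derive z 1 b1 (b2 z * (z / 2)).
Proof. by apply: (@is_derive1_comp _ (bsum1 c) sq); [exact: is_derive_bsum1|exact: dsq]. Qed.

Let dinvb z : is_derive z 1 (fun t => 1 / b t) (- 1 * (b1 z * (z / 2)) / b z ^+ 2).
Proof. by apply: is_derive_div; [rewrite gt_eqF|exact: db]. Qed.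

(** For u = 1 + p the linear equation of w becomes the Riccati equation u' = 1 + m / z^2 - u^2; the
    equation of the series is used to eliminate [b2]. *)
Let dp z : 0 < z -> is_derive z 1 p (m / z ^+ 2 - 2 * p z - p z ^+ 2).
Proof.
move=> z0; have d1 := is_derive_div lam (lt0r_neq0 z0) (is_derive_id z 1).
have d2 := is_derive_mul (db1 z) (dinvb z).
have d3 := is_derive_scale 2^-1 (is_derive_mul (is_derive_id z 1) d2).
have d4 := is_derive_sub (is_derive_add d1 d3) (is_derive_cst (1 : R) z 1).
rewrite (_ : p = fun t => lam / t + 2^-1 * (t * (b1 t * (1 / b t))) - 1); last first.
  by apply/funext => t; rewrite /p div1r.
apply: (is_derive_eq d4).
have ode := bsum_ode c0 (sq0 z); rewrite -/(b z) -/(b1 z) -/(b2 z) in ode.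
rewrite /m; have bz := lt0r_neq0 (bpos z); have z1 := lt0r_neq0 z0.
have -> : b2 z = (b z - c * b1 z) / sq z.
  by rewrite -ode addrK mulrC mulKf// mulf_neq0 ?invr_eq0 ?sqrf_eq0.
by rewrite /sq /c; field; rewrite bz z1.
Qed.

Let p_gtN1 z : 0 < z -> -1 < p z.
Proof.
move=> z0; rewrite /p ltrBrDr addrC subrr ltr_wpDr ?divr_gt0//.
by rewrite !mulr_ge0 ?invr_ge0 ?(ltW z0) ?(ltW (bpos z))// bsum1_ge0.
Qed.

Let K := 1 + 2 * `|m| + 64 * `|p 8|.
Let K0 : 0 < K.
Proof. by rewrite ltr_wpDr ?mulr_ge0// ltr_wpDr ?mulr_ge0. Qed.
Let Km : 2 * m ^+ 2 <= K ^+ 2.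
Proof.
have h : 2 * `|m| <= K by rewrite /K; have := normr_ge0 (p 8); lra.
apply: (@le_trans _ _ ((2 * `|m|) ^+ 2)); last by rewrite lerXn2r ?nnegrE ?mulr_ge0// ltW.
by rewrite [leRHS]exprMn real_normK ?num_real// ler_wpM2r ?sqr_ge0//; lra.
Qed.
Let Kp : 8 ^+ 4 * p 8 ^+ 2 <= K ^+ 2.
Proof.
have h : 64 * `|p 8| <= K by rewrite /K; have := normr_ge0 m; lra.
apply: (@le_trans _ _ ((64 * `|p 8|) ^+ 2)); last by rewrite lerXn2r ?nnegrE ?mulr_ge0// ltW.
by rewrite exprMn real_normK ?num_real// (_ : 8 ^+ 4 = 64 ^+ 2)//; ring.
Qed.

(** The function G = expR t * (p^2 - K^2 / t^4) is nonincreasing from 8 on, and G 8 <= 0 because K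
    >= 64 * |p 8|. In its derivative p > -1 gives - 2 p^3 <= 2 p^2, and the mixed term is at most
    p^2 + m^2 / t^4; the squares of p then cancel exactly, and the terms in t^-4 are not positive in
    total since 2 m^2 <= K^2 and 4 / t <= 1 / 2. *)
Let pK z : 8 <= z -> `|p z| <= K / z ^+ 2.
Proof.
move=> z8; have z0 : 0 < z by lra.
pose G t : R := expR t * (p t * p t - K ^+ 2 / (t * t * (t * t))).
pose G' t : R := expR t * (2 * p t * (m / t ^+ 2 - 2 * p t - p t ^+ 2) +
   4 * K ^+ 2 / t ^+ 5) + (p t * p t - K ^+ 2 / (t * t * (t * t))) * expR t.
have dG t : 8 <= t -> is_derive t 1 G (G' t).
  move=> t8; have t0 : 0 < t by lra.
  have ds := is_derive_mul (is_derive_id t (1 : R)) (is_derive_id t 1).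
  have ds4 := is_derive_mul ds ds.
  have nz : t * t * (t * t) != 0 by rewrite !mulf_neq0// gt_eqF.
  have dv := @is_derive_div _ (K ^+ 2) (fun t => t * t * (t * t)) t _ nz ds4.
  have d := is_derive_mul (is_derive_expR t)
    (is_derive_sub (is_derive_mul (dp t0) (dp t0)) dv).
  apply: (is_derive_eq d); rewrite /G'; congr (_ * _ + _).
  by field; rewrite gt_eqF.
have G'0 t : 8 <= t -> G' t <= 0.
  move=> t8; have t0 : 0 < t by lra.
  rewrite /G' mulrC -mulrDl mulrC pmulr_rle0 ?expR_gt0//.
  set q := p t; have q1 : -1 < q by exact: p_gtN1.
  pose w := (t ^+ 2)^-1; have w0 : 0 < w by rewrite invr_gt0 exprn_gt0.
  have -> : K ^+ 2 / (t * t * (t * t)) = K ^+ 2 * w ^+ 2.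
    by rewrite /w; field; rewrite gt_eqF.
  have : 4 * K ^+ 2 / t ^+ 5 <= K ^+ 2 * w ^+ 2 / 2.
    rewrite (_ : 4 * K ^+ 2 / t ^+ 5 = (K ^+ 2 * w ^+ 2) * (4 / t)); last first.
      by rewrite /w; field; rewrite gt_eqF.
    apply: ler_wpM2l; first by rewrite mulr_ge0 ?sqr_ge0.
    by rewrite ler_pdivrMr//; lra.
  have h1 : - 2 * q ^+ 3 <= 2 * q ^+ 2.
    have : 0 <= q ^+ 2 * (1 + q) by rewrite mulr_ge0 ?sqr_ge0//; lra.
    by rewrite !exprS expr0; lra.
  have h2 : 2 * q * m * w <= q ^+ 2 + m ^+ 2 * w ^+ 2.
    by have := sqr_ge0 (q - m * w); rewrite sqrrB exprMn; lra.
  have h3 : 2 * m ^+ 2 * w ^+ 2 <= K ^+ 2 * w ^+ 2 by rewrite ler_wpM2r ?sqr_ge0.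
  rewrite (_ : 2 * q * (m / t ^+ 2 - 2 * q - q ^+ 2) =
    2 * q * m * w - 4 * q ^+ 2 - 2 * q ^+ 3); last by rewrite /w; ring.
  by rewrite -(expr2 q); lra.
have := nonincr_from dG G'0 (lexx 8) z8.
have G8 : G 8 <= 0.
  rewrite /G pmulr_rle0 ?expR_gt0// subr_le0 ler_pdivlMr ?mulr_gt0//.
  by move: Kp; rewrite !expr2 !exprS expr0; lra.
move=> /le_trans/(_ G8); rewrite /G pmulr_rle0 ?expR_gt0// subr_le0.
rewrite -!expr2 => h.
rewrite -ler_sqr ?nnegrE ?divr_ge0 ?sqr_ge0 ?(ltW K0)// real_normK ?num_real//.
by rewrite expr_div_n.
Qed.

Let L z : R := lam * ln z - z + ln (b z).

Let dL z : 0 < z -> is_derive z 1 L (p z).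
Proof.
move=> z0; have d := is_derive_add (is_derive_sub (is_derive_scale lam (is_derive1_ln z0))
  (is_derive_id z 1)) (is_derive_ln (bpos z) (db z)).
apply: (is_derive_eq d); rewrite /p; field.
by rewrite !gt_eqF.
Qed.

Let dinv z : 0 < z -> is_derive z 1 (fun t => K / t) (- K * 1 / z ^+ 2).
Proof. by move=> z0; apply: is_derive_div => //; rewrite gt_eqF. Qed.

(** As |L'| <= K / z^2, L + K / z is nonincreasing and L - K / z nondecreasing; the supremum of the
    latter is the limit, reached at rate 1 / z. *)
Let L_lim : exists l K, 0 < K /\ forall z, 8 <= z -> `|L z - l| <= K / z.
Proof.
have up x y : 8 <= x -> x <= y -> L y + K / y <= L x + K / x.
  apply: (@nonincr_from _ (fun t => L t + K / t) (fun t => p t + - K * 1 / t ^+ 2)) => t t8.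
    have t0 : 0 < t by lra.
    by apply: is_derive_add; [exact: dL|exact: dinv].
  have := pK t8; have := ler_norm (p t).
  by rewrite mulr1 mulNr; lra.
have dn x y : 8 <= x -> x <= y -> - (L y - K / y) <= - (L x - K / x).
  apply: (@nonincr_from _ (fun t => - (L t - K / t)) (fun t => - (p t - - K * 1 / t ^+ 2))) => t t8.
    have t0 : 0 < t by lra.
    apply: is_deriveN; apply: is_derive_sub; [exact: dL|exact: dinv].
  have := pK t8; have := ler_norm (- p t); rewrite normrN.
  by rewrite mulr1 mulNr; lra.
pose S := [set L z - K / z | z in [set z | 8 <= z]].
have S0 : S !=set0 by exists (L 8 - K / 8), 8 => /=.
have le x y : 8 <= x -> 8 <= y -> L x - K / x <= L y + K / y.
  move=> x8 y8; have [xy|/ltW yx] := leP x y.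
    have := dn _ _ x8 xy; have : 0 <= K / y by rewrite divr_ge0 ?(ltW K0)//; lra.
    lra.
  have := up _ _ y8 yx; have : 0 <= K / x by rewrite divr_ge0 ?(ltW K0)//; lra.
  lra.
have Sb : has_ubound S by exists (L 8 + K / 8) => _ [z z8 <-]; exact: le.
exists (sup S), K; split => // z z8; have h1 : L z - K / z <= sup S.
  by apply: ub_le_sup => //; exists z.
have h2 : sup S <= L z + K / z by apply: ge_sup => // _ [x x8 <-]; exact: le.
rewrite ler_norml; lra.
Qed.

(** A constant multiple of sqrt z * exp (- z) * I_nu (z) with nu = lam - 1/2. *)
Definition bphi z : R := z `^ lam * expR (- z) * bsum c (z ^+ 2 / 4).

(** In the heat kernel, the factor 1 - exp (- 2 z) produces the Gaussian minus its reflection; for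
    lam = 1 it is proportional to [bphi]. At 0 it vanishes like z and [bphi] like z^lam, hence the
    exponent min lam 1. The two bounds are effective at opposite ends but are stated for all z. *)
Lemma bphi_asymp : exists l K, [/\ 0 < l, 0 <= K & forall z, 0 < z ->
  `|bphi z - l * (1 - expR (- (2 * z)))| <= K / z /\
  `|bphi z - l * (1 - expR (- (2 * z)))| <= K * z `^ Num.min lam 1].
Proof.
have [l [B [B0 hl]]] := L_lim; pose al := Num.min lam 1; rewrite -/al.
have al0 : 0 < al by rewrite lt_min lam0 ltr01.
have al1 : al <= 1 by rewrite ge_min lexx orbT.
have allam : al <= lam by rewrite ge_min lexx.
pose D1 := expR l * (B * expR B + 1).
pose D2 := bsum c 16 * 8 `^ (lam - al) + 16 * expR l.
have b16 : 0 < bsum c 16 by apply: (@lt_le_trans _ _ 1) => //; exact: bsum_ge1.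
have D10 : 0 <= D1 by rewrite mulr_ge0 ?expR_ge0// addr_ge0// mulr_ge0 ?expR_ge0// ltW.
have D20 : 0 <= D2 by rewrite addr_ge0 ?mulr_ge0 ?powR_ge0 ?expR_ge0// ltW.
have bphiE z : 0 < z -> bphi z = expR (L z).
  by move=> z0; rewrite /bphi /L powRP// !expRD lnK// posrE.
(* The 64 bounds z times its power for z <= 8, where the estimate by the power of z must also yield
   the one by 1 / z. *)
exists (expR l), (D1 + 64 * D2); split; [exact: expR_gt0|by rewrite addr_ge0// mulr_ge0|].
move=> z z0; have [z8|/ltW z8] := leP 8 z.
  have h : `|bphi z - expR l * (1 - expR (- (2 * z)))| <= D1 / z.
    rewrite bphiE// (_ : _ - _ = expR l * (expR (L z - l) - 1) + expR l * expR (- (2 * z))); last first.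
      by rewrite [expR (L z - l)]expRD [expR (- l)]expRN; field; rewrite gt_eqF// expR_gt0.
    rewrite (le_trans (ler_normD _ _))// !normrM !(ger0_norm (expR_ge0 _)) -mulrDr /D1 -mulrA.
    rewrite ler_pM2l ?expR_gt0// [leRHS]mulrDl; apply: lerD.
      apply: (le_trans (expR_sub1_le _)); have hz := hl z z8.
      rewrite mulrAC; apply: ler_pM => //; rewrite ?expR_ge0// ler_expR (le_trans hz)//.
      by rewrite ler_pdivrMr// ler_peMr ?(ltW B0)//; lra.
    rewrite expRN mul1r lef_pV2 ?posrE ?expR_gt0//.
    by have := expR_ge1Dx (2 * z); lra.
  split; apply: (le_trans h).
    by rewrite ler_pM2r ?invr_gt0// lerDl mulr_ge0.
  apply: (@le_trans _ _ (D1 * 1)).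
    by rewrite ler_wpM2l// invf_le1//; lra.
  apply: ler_pM => //; first by rewrite lerDl mulr_ge0.
  by rewrite powRP// -[leLHS]expR0 ler_expR mulr_ge0 ?(ltW al0)// ln_ge0//; lra.
have l8 : ln z <= ln 8 by rewrite ler_ln ?posrE.
have za1 : z `^ lam <= 8 `^ (lam - al) * z `^ al.
  rewrite !powRP// -expRD ler_expR -lerBlDr -mulrBl ler_wpM2l// subr_ge0//.
have l80 : 0 <= ln 8 :> R by rewrite ln_ge0// ler1n.
have za2 : z <= 8 * z `^ al.
  rewrite -[leLHS]lnK ?posrE// -[8]lnK ?posrE// powRP// -expRD ler_expR.
  have : (1 - al) * ln z <= (1 - al) * ln 8 by rewrite ler_wpM2l// subr_ge0.
  have : 0 <= al * ln 8 by rewrite mulr_ge0 ?(ltW al0).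
  lra.
have za8 : z `^ al <= 8.
  rewrite powRP// -[leRHS]lnK ?posrE// ler_expR.
  apply: (@le_trans _ _ (al * ln 8)); first by rewrite ler_pM2l.
  by rewrite ler_piMl.
have h : `|bphi z - expR l * (1 - expR (- (2 * z)))| <= D2 * z `^ al.
  rewrite (le_trans (ler_normB _ _))// /D2 [leRHS]mulrDl; apply: lerD.
    have e1 : expR (- z) <= 1 by rewrite -[leRHS]expR0 ler_expR oppr_le0 ltW.
    have hb : bsum c (z ^+ 2 / 4) <= bsum c 16.
      apply: bsum_homo => //; rewrite sq0/= ler_pdivrMr// expr2.
      by rewrite (_ : 16 * 4 = 8 * 8 :> R); [apply: ler_pM => //; exact: ltW|ring].
    have hb0 : 0 <= bsum c (z ^+ 2 / 4) by exact: ltW (bpos z).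
    rewrite /bphi ger0_norm; last by rewrite !mulr_ge0 ?powR_ge0 ?expR_ge0.
    rewrite (_ : _ * _ * z `^ al = (8 `^ (lam - al) * z `^ al) * bsum c 16); last by ring.
    apply: ler_pM => //; first by rewrite mulr_ge0 ?expR_ge0 ?powR_ge0.
    by apply: le_trans za1; rewrite ler_piMr ?powR_ge0.
  rewrite normrM (ger0_norm (expR_ge0 _)) mulrAC mulrC ler_pM2r ?expR_gt0//.
  have := expR_ge1Dx (- (2 * z)).
  have : expR (- (2 * z)) <= 1 by rewrite -[leRHS]expR0 ler_expR oppr_le0 mulr_ge0// ltW.
  by move=> e1 e2; rewrite ger0_norm ?subr_ge0//; lra.
split; apply: (le_trans h).
  rewrite ler_pdivlMr// -mulrA; apply: (@le_trans _ _ (D2 * 64)); last by rewrite mulrC lerDr.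
  apply: ler_wpM2l => //; apply: (@le_trans _ _ (8 * 8)); last by rewrite -natrM.
  by apply: ler_pM => //; [exact: powR_ge0|exact: ltW].
by rewrite ler_wpM2r ?powR_ge0//; clearbody D1 D2; lra.
Qed.

End bessel_asymptotics.

(** * The heat kernel of the Bessel operator *)

Section heat_kernel.
Context {R : realType} (lam : R) (lam0 : 0 < lam).
Local Notation leb := (@lebesgue_measure R).
Implicit Types (x y z s t : R) (k n : nat).

Let c := lam + 2^-1.
Let c0 : 0 < c. Proof. by rewrite addr_gt0// invr_gt0. Qed.

Lemma bcoefE k : bcoef c k = Gamma c / (k`!%:R * Gamma (k%:R + c)).
Proof.
have G0 : 0 < Gamma c by exact: Gamma_gt0.
elim: k => [|k IH] /=; first by rewrite add0r mul1r divff// gt_eqF.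
have kc : 0 < k%:R + c by rewrite ltr_wpDl.
have Gk := Gamma_gt0 kc.
rewrite IH -natr1 addrAC GammaS// factS natrM -natr1; field.
by rewrite natr1 !gt_eqF//= ltr0n fact_gt0.
Qed.

Lemma besselIE z : 0 < z ->
  besselI (lam - 2^-1) z = (z / 2) `^ (lam - 2^-1) / Gamma c * bsum c (z ^+ 2 / 4).
Proof.
move=> z0; have z2 : 0 < z / 2 by rewrite divr_gt0.
have G0 : 0 < Gamma c by exact: Gamma_gt0.
rewrite /besselI (_ : series _ = fun n => (z / 2) `^ (lam - 2^-1) / Gamma c *
    pseries (bcoef c) (z ^+ 2 / 4) n).
  apply/cvg_lim => //; apply: cvgMr; apply: cvg_b => //.
  by rewrite divr_ge0// sqr_ge0.
apply/funext => n; rewrite /pseries /series/= mulr_sumr; apply: eq_bigr => k _.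
rewrite /besselI_coeff bcoefE (_ : k%:R + (lam - 2^-1) + 1 = k%:R + c); last first.
  by rewrite /c -!addrA; congr (_ + (_ + _)); lra.
have kc : 0 < k%:R + c by rewrite ltr_wpDl.
have Gk := Gamma_gt0 kc.
rewrite [X in X / _ = _]powRD; last by rewrite (gt_eqF z2) implybT.
rewrite powR_mulrn ?(ltW z2)// exprM (_ : (z / 2) ^+ 2 = z ^+ 2 / 4); last first.
  by rewrite expr_div_n -natrX.
set u := _ `^ _; set v := _ ^+ k; field.
by rewrite !gt_eqF//= ltr0n fact_gt0.
Qed.

Definition kappa : R := Num.sqrt (pi *+ 2) * (2^-1) `^ (lam - 2^-1) / Gamma c.

Lemma kappa_gt0 : 0 < kappa.
Proof.
rewrite divr_gt0 ?Gamma_gt0// mulr_gt0 ?powR_gt0 ?invr_gt0//.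
by rewrite sqrtr_gt0 mulrn_wgt0// pi_gt0.
Qed.

(** At time s^2 / 2 the exponent is - (x^2 + y^2) / (2 s^2) = - (y - x)^2 / (2 s^2) - z with z = x y
    / s^2. The factor exp (- z) goes into [bphi], where it balances the growth of the Bessel
    function. *)
Lemma heat_kernelE s x y : 0 < s -> 0 < x -> 0 < y ->
  heat_kernel lam (s ^+ 2 / 2) x y = kappa * (gk s x y * bphi lam (x * y / s ^+ 2)).
Proof.
move=> s0 x0 y0; have s20 : 0 < s ^+ 2 by rewrite exprn_gt0.
pose z := x * y / s ^+ 2; have z0 : 0 < z by rewrite divr_gt0// mulr_gt0.
have e2 : 2 * (s ^+ 2 / 2) = s ^+ 2 by field.
rewrite /heat_kernel e2 -/z besselIE// gkE// /bphi /kappa -/c.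
have exy : x * y = s ^+ 2 * z by rewrite /z; field; rewrite gt_eqF.
rewrite exy sqrtrM ?(ltW s20)// sqrtr_sqr (gtr0_norm s0).
rewrite powRM ?(ltW z0) ?invr_ge0//.
have -> : z `^ lam = Num.sqrt z * z `^ (lam - 2^-1).
  rewrite -powR12_sqrt ?(ltW z0)// -powRD; last by rewrite (gt_eqF z0) implybT.
  by congr (_ `^ _); lra.
have -> : - (x ^+ 2 + y ^+ 2) / (4 * (s ^+ 2 / 2)) = - ((y - x) / s) ^+ 2 / 2 - z.
  by rewrite /z; field; rewrite gt_eqF.
have -> : normal_peak s = (s * Num.sqrt (pi *+ 2))^-1.
  rewrite /normal_peak -mulrnAr sqrtrM ?(ltW s20)// sqrtr_sqr (gtr0_norm s0)//.
have p0 : Num.sqrt (pi *+ 2) != 0 :> R.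
  by rewrite gt_eqF// sqrtr_gt0 mulrn_wgt0// pi_gt0.
rewrite expRD; set a := _ `^ _; set b := _ `^ _; set d := Num.sqrt z; set e := expR _.
set g := expR _; set h := bsum _ _; set q := Num.sqrt _ in p0 *.
by field; rewrite p0 !gt_eqF// Gamma_gt0.
Qed.

Lemma gk_reflect s x y : 0 < s ->
  gk s x (- y) = gk s x y * expR (- (2 * (x * y / s ^+ 2))).
Proof.
move=> s0; rewrite !gkE// -[RHS]mulrA -expRD; congr (_ * expR _).
by field; rewrite gt_eqF.
Qed.

Let al := Num.min lam 1.
Let al0 : 0 < al. Proof. by rewrite lt_min lam0 ltr01. Qed.
Let al1 : al <= 1. Proof. by rewrite ge_min lexx orbT. Qed.

Lemma heat_kernel_approx : exists a K, [/\ 0 < a, 0 <= K & forall s x y, 0 < s -> 0 < x -> 0 < y ->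
  let D := `|heat_kernel lam (s ^+ 2 / 2) x y - a * (gk s x y - gk s x (- y))| in
  D <= K * gk s x y * (s ^+ 2 / (x * y)) /\
  D <= K * gk s x y * (x * y / s ^+ 2) `^ al].
Proof.
have [l [K [l0 K0 h]]] := bphi_asymp lam0.
have k0 := kappa_gt0.
exists (kappa * l), (kappa * K); split; [exact: mulr_gt0|by rewrite mulr_ge0// ltW|].
move=> s x y s0 x0 y0 /=.
have z0 : 0 < x * y / s ^+ 2 by rewrite divr_gt0 ?exprn_gt0// mulr_gt0.
have [h1 h2] := h _ z0.
rewrite heat_kernelE// gk_reflect//.
rewrite (_ : _ - _ = kappa * gk s x y * (bphi lam (x * y / s ^+ 2) -
   l * (1 - expR (- (2 * (x * y / s ^+ 2)))))); last by ring.
have g0 := gk_ge0 s x y.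
rewrite normrM (ger0_norm (mulr_ge0 (ltW k0) g0)).
rewrite (_ : kappa * K * gk s x y = kappa * gk s x y * K); last by ring.
have kg : 0 <= kappa * gk s x y by rewrite mulr_ge0 ?(ltW k0).
split; rewrite -[leRHS]mulrA; apply: ler_wpM2l => //.
by rewrite -[s ^+ 2 / _]invf_div.
Qed.

Lemma measurable_bphi : measurable_fun [set: R] (bphi lam).
Proof.
apply: measurable_funM; first apply: measurable_funM.
- exact: measurable_powR.
- by apply: measurableT_comp => //; exact: measurable_funN.
- apply: continuous_measurable_fun => z.
  have d := is_derive_scale 4^-1 (is_derive_mul (is_derive_id z (1 : R)) (is_derive_id z 1)).
  have d2 := @is_derive1_comp _ (bsum c) (fun t => 4^-1 * (t * t)) z _ _
    (@is_derive_bsum _ c c0 (4^-1 * (z * z)) _) d.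
  rewrite (_ : (fun _ => _) = bsum c \o (fun t => 4^-1 * (t * t))).
    apply: is_derive_continuous; apply: d2.
    by rewrite mulr_ge0 ?invr_ge0// -expr2 sqr_ge0.
  by apply/funext => t /=; rewrite mulrC expr2.
Qed.

Lemma measurable_heat_kernel s x : 0 < s -> 0 < x ->
  measurable_fun pos (heat_kernel lam (s ^+ 2 / 2) x).
Proof.
move=> s0 x0; apply: (eq_measurable_fun (fun y => kappa * (gk s x y * bphi lam (x * y / s ^+ 2)))).
  by move=> y /set_mem/posP y0; rewrite heat_kernelE.
apply: measurable_funTS; apply: measurable_funM => //; apply: measurable_funM.
  exact: measurable_gk.
apply: measurableT_comp; first exact: measurable_bphi.
by apply: measurable_funM => //; exact: measurable_funM.
Qed.

Lemma measurable_balayage_kernel x : 0 < x ->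
  measurable_fun quadrant (balayage_kernel lam x).
Proof.
(* The kernel is rewritten with real powers for the inverse of 2 t and for the root, and through
   [bphi]; the factor expR (Z p) cancels the decaying exponential inside [bphi]. *)
move=> x0; pose T (p : R * R) := (2 * p.2) `^ (- 1).
pose Z p := x * p.1 * T p.
pose h (p : R * R) : R := (x * p.1) `^ 2^-1 * T p *
  (2^-1 `^ (lam - 2^-1) * (expR (Z p) * Z p `^ (- 2^-1)) / Gamma c * bphi lam (Z p)) *
  expR (- (x ^+ 2 + p.1 ^+ 2) * (2^-1 * T p)).
have mT : measurable_fun [set: R * R] T.
  apply: (measurableT_comp (measurable_powR (- 1))).
  by apply: measurable_funM => //; exact: measurable_snd.
have mx : measurable_fun [set: R * R] (fun p : R * R => x * p.1).
  by apply: measurable_funM => //; exact: measurable_fst.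
have mZ : measurable_fun [set: R * R] Z by exact: measurable_funM.
have mh : measurable_fun [set: R * R] h.
  apply: measurable_funM; last first.
    apply: measurableT_comp => //; apply: measurable_funM; last exact: measurable_funM.
    apply: measurable_funN; apply: measurable_funD => //.
    by apply: measurable_funX; exact: measurable_fst.
  apply: measurable_funM.
    by apply: measurable_funM => //; apply: (measurableT_comp (measurable_powR 2^-1)).
  apply: measurable_funM; last by apply: measurableT_comp => //; exact: measurable_bphi.
  apply: measurable_funM => //; apply: measurable_funM => //; apply: measurable_funM.
    exact: measurableT_comp.
  exact: (measurableT_comp (measurable_powR (- 2^-1))).
apply: (eq_measurable_fun h); last exact: measurable_funTS.
move=> [y t] /set_mem [/= /posP y0 /posP t0].
have t2 : 0 < 2 * t by rewrite mulr_gt0.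
have TE : T (y, t) = (2 * t)^-1 by rewrite /T/= powR_inv1// ltW.
have ZE : Z (y, t) = x * y / (2 * t) by rewrite /Z TE.
have z0 : 0 < x * y / (2 * t) by rewrite divr_gt0// mulr_gt0.
rewrite /h ZE TE/= /balayage_kernel/= /heat_kernel besselIE// powR12_sqrt ?mulr_ge0 ?ltW//.
rewrite -/c /bphi -/c.
have -> : (x * y / (2 * t) / 2) `^ (lam - 2^-1) =
    (x * y / (2 * t)) `^ lam * (x * y / (2 * t)) `^ (- 2^-1) * 2^-1 `^ (lam - 2^-1).
  rewrite powRM ?invr_ge0 ?(ltW z0)// -powRD// (gt_eqF z0) implybT //.
rewrite (_ : 2^-1 / (2 * t) = (4 * t)^-1); last by field; rewrite gt_eqF.
have e : expR (- (x * y / (2 * t))) = (expR (x * y / (2 * t)))^-1 by rewrite expRN.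
rewrite e; have := expR_gt0 (x * y / (2 * t)).
move: (expR (x * y / (2 * t))) => u u0.
move: (expR _) (bsum _ _) (_ `^ (lam - 2^-1)) (_ `^ lam) (_ `^ (- 2^-1)) (Num.sqrt _) => *.
by field; rewrite !gt_eqF ?Gamma_gt0.
Qed.

Let frac v : R := v / (1 + v) ^+ 2.

Let frac_ge (v : R) : 0 < v -> v <= 1 -> v <= 4 * frac v.
Proof.
move=> v0 v1; rewrite /frac mulrA ler_pdivlMr ?exprn_gt0 ?addr_gt0//.
rewrite mulrC ler_pM2r// (_ : 4 = 2 ^+ 2) ?lerXn2r ?nnegrE//; lra.
Qed.

Let frac_geV (v : R) : 1 <= v -> v^-1 <= 4 * frac v.
Proof.
move=> v1; have v0 : 0 < v by lra.
rewrite /frac mulrA ler_pdivlMr ?exprn_gt0 ?addr_gt0// ler_pdivrMl//.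
rewrite mulrCA -expr2 (_ : 4 * v ^+ 2 = (2 * v) ^+ 2); last by ring.
by rewrite lerXn2r ?nnegrE; lra.
Qed.

(** For s <= x, the first pointwise bound gives 2 * (s / x)^2 on y >= x / 2, while on y < x / 2 a
    Gaussian tail gives 24 * (s / x)^2; for s >= x, the second bound gives a multiple of (x / s)^al,
    its power of y / s being absorbed by a wider Gaussian. Both cases fit v / (1 + v)^2, which is at
    least a quarter of the smaller of v and 1 / v, and which telescopes well over the scales. *)
Lemma int_heat_err : exists a C, [/\ 0 < a, 0 <= C & forall s x, 0 < s -> 0 < x ->
  let v := (s / x) `^ al in
  (\int[leb]_(y in pos) `|heat_kernel lam (s ^+ 2 / 2) x y - a * (gk s x y - gk s x (- y))|%:E
    <= (C * (v / (1 + v) ^+ 2))%:E)%E].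
Proof.
have [a [K [a0 K0 hK]]] := heat_kernel_approx.
exists a, (4 * (26 * K)); split; [by []|by rewrite !mulr_ge0|].
move=> s x s0 x0 /=; set v := _ `^ _; rewrite -/(frac v).
have mW : measurable_fun pos (fun y =>
    `|heat_kernel lam (s ^+ 2 / 2) x y - a * (gk s x y - gk s x (- y))|).
  apply: measurableT_comp => //; apply: measurable_funB; first exact: measurable_heat_kernel.
  apply: measurable_funTS; apply: measurable_funM => //; apply: measurable_funB.
    exact: measurable_gk.
  by apply: (measurableT_comp (measurable_gk s x)); exact: measurable_funN.
have v0 : 0 < v by rewrite powR_gt0// divr_gt0.
have g0 y := gk_ge0 s x y.
have g20 y := gk_ge0 (2 * s) x y.
have s20 : 0 < 2 * s by rewrite mulr_gt0.
have mp : measurable (pos : set R) := measurable_pos.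
have [sx|/ltW xs] := leP s x.
- pose far : set R := [set y | x / 2 <= `|x - y|].
  have mf : measurable far.
    rewrite (_ : far = (fun y => `|x - y|) @^-1` `[x / 2, +oo[).
      have mn : measurable_fun [set: R] (fun y => `|x - y|).
        by apply: measurableT_comp => //; exact: measurable_funB.
      by rewrite -[X in measurable X]setTI; apply: mn.
    by apply/seteqP; split=> y /=; rewrite in_itv/= andbT.
  have mI : measurable_fun [set: R] (\1_far : R -> R) by exact: measurable_indic.
  have I0 y : 0 <= (\1_far y : R) by rewrite indicE.
  pose w := 2 * (s / x) ^+ 2.
  have w0 : 0 <= w by rewrite mulr_ge0 ?sqr_ge0.
  apply: (@le_trans _ _ (\int[leb]_(y in pos) (K * (w * gk s x y + gk s x y * \1_far y))%:E)%E).
    apply: ge0_le_integral => //.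
    + exact/measurable_EFinP.
    + apply: measurable_funTS; apply: measurable_funEFin; apply: measurable_funM => //.
      by apply: measurable_funD; apply: measurable_funM => //; exact: measurable_gk.
    + move=> y /posP y0; rewrite lee_fin; have [h1 h2] := hK s x y s0 x0 y0.
      have z0 : 0 < x * y / s ^+ 2 by rewrite divr_gt0 ?exprn_gt0// mulr_gt0.
      have [yx|xy] := leP (x / 2) y.
        apply: (le_trans h1); rewrite -[leLHS]mulrA ler_wpM2l//.
        apply: (@le_trans _ _ (w * gk s x y)); last by rewrite lerDl mulr_ge0.
        rewrite mulrC ler_wpM2r// /w ler_pdivrMr ?mulr_gt0//.
        rewrite (_ : 2 * (s / x) ^+ 2 * (x * y) = s ^+ 2 * (y / (x / 2))); last first.
          by field; rewrite gt_eqF.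
        by rewrite ler_peMr ?sqr_ge0// ler_pdivlMr ?divr_gt0// mul1r.
      have yf : \1_far y = 1 :> R.
        by rewrite indicE mem_set// /far/= ger0_norm; lra.
      rewrite yf mulr1; apply: (@le_trans _ _ (K * gk s x y)); last first.
        by rewrite ler_wpM2l// lerDr mulr_ge0.
      have [z1|z1] := leP (x * y / s ^+ 2) 1.
        apply: (le_trans h2); rewrite ler_piMr ?mulr_ge0// powRP// -[leRHS]expR0 ler_expR.
        by rewrite pmulr_rle0// ln_le0.
      apply: (le_trans h1); rewrite ler_piMr ?mulr_ge0// -invf_div invf_le1//.
      exact: ltW.
  have g1 y : 0 <= w * gk s x y by rewrite mulr_ge0.
  have g2 y : 0 <= gk s x y * \1_far y by rewrite mulr_ge0.
  have m1 : measurable_fun [set: R] (fun y => w * gk s x y).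
    by apply: measurable_funM => //; exact: measurable_gk.
  have m2 : measurable_fun [set: R] (fun y => gk s x y * \1_far y).
    by apply: measurable_funM => //; exact: measurable_gk.
  have g3 y : 0 <= w * gk s x y + gk s x y * \1_far y by rewrite addr_ge0.
  rewrite intLZ//; last exact: measurable_funD.
  rewrite intLD// intLZ//; last exact: measurable_gk.
  have b1 : (\int[leb]_(y in pos) (gk s x y)%:E <= 1)%E by exact: int_gk_le1.
  have b2 : (\int[leb]_(y in pos) (gk s x y * \1_far y)%:E <= (24 * (s / x) ^+ 2)%:E)%E.
    apply: (@le_trans _ _ (\int[leb]_y (gk s x y * \1_far y)%:E)%E).
      by apply: ge0_subset_integral => //; [exact: measurable_funEFin|move=> y _; rewrite lee_fin].
    have -> : (\int[leb]_y (gk s x y * \1_far y)%:E = \int[leb]_(y in far) (gk s x y)%:E)%E.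
      rewrite [RHS]integral_mkcond; apply: eq_integral => y _.
      by rewrite /patch indicE; case: (y \in far); rewrite ?mulr1 ?mulr0.
    apply: (le_trans (int_gk_tail (d := x / 2) _ _ _ _)) => //; first exact: divr_gt0.
    by rewrite lee_fin le_eqVlt; apply/orP; left; apply/eqP; field; rewrite gt_eqF.
  apply: (@le_trans _ _ (K%:E * (w%:E * 1 + (24 * (s / x) ^+ 2)%:E))%E).
    by rewrite lee_wpmul2l ?lee_fin// leeD// lee_wpmul2l ?lee_fin.
  rewrite mule1 -EFinD -EFinM lee_fin.
  have u1 : s / x <= 1 by rewrite ler_pdivrMr// mul1r.
  have u0 : 0 < s / x by rewrite divr_gt0.
  have v1 : v <= 1.
    by rewrite /v powRP// -[leRHS]expR0 ler_expR pmulr_rle0// ln_le0.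
  have uv : (s / x) ^+ 2 <= v.
    rewrite -powR_mulrn ?(ltW u0)// /v !powRP// ler_expR ler_wnM2r ?ln_le0//.
    by apply: le_trans al1 _; rewrite ler1n.
  rewrite (_ : K * _ = 26 * K * (s / x) ^+ 2); last by rewrite /w; ring.
  rewrite (_ : 4 * (26 * K) * frac v = 26 * K * (4 * frac v)); last by ring.
  by rewrite ler_wpM2l ?mulr_ge0// (le_trans uv)// frac_ge.
- pose w := (x / s) `^ al.
  have w0 : 0 <= w by exact: powR_ge0.
  apply: (@le_trans _ _ (\int[leb]_(y in pos) (K * w * (3 * gk s x y + 6 * gk (2 * s) x y))%:E)%E).
    apply: ge0_le_integral => //.
    + exact/measurable_EFinP.
    + apply: measurable_funTS; apply: measurable_funEFin; apply: measurable_funM => //.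
      by apply: measurable_funD; apply: measurable_funM => //; exact: measurable_gk.
    + move=> y /posP y0; rewrite lee_fin; have [_ h2] := hK s x y s0 x0 y0.
      apply: (le_trans h2); rewrite -[leLHS]mulrA -[leRHS]mulrA ler_wpM2l//.
      have -> : x * y / s ^+ 2 = (x / s) * (y / s) by field; rewrite gt_eqF.
      have u0 : 0 < y / s by rewrite divr_gt0.
      rewrite powRM ?(ltW u0) ?divr_ge0 ?(ltW x0) ?(ltW s0)// -/w mulrCA ler_wpM2l//.
      have p1 : (y / s) `^ al <= 1 + y / s.
        have [y1|/ltW y1] := leP (y / s) 1.
          apply: (@le_trans _ _ 1); last by rewrite lerDl ltW.
          by rewrite powRP// -[leRHS]expR0 ler_expR pmulr_rle0// ln_le0.
        apply: (@le_trans _ _ (y / s)); last by rewrite lerDr.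
        by rewrite powRP// -[leRHS]lnK ?posrE// ler_expR ler_piMl// ln_ge0.
      have p2 : y / s <= 1 + `|x - y| / s.
        rewrite ler_pdivrMr// mulrDl mul1r divfK ?gt_eqF//.
        by have := ler_norm (y - x); rewrite distrC; lra.
      have p3 : gk s x y * (`|x - y| / s) <= gk s x y + 6 * gk (2 * s) x y.
        have [d1|/ltW d1] := leP `|x - y| s.
          rewrite (@le_trans _ _ (gk s x y))// ?lerDl ?mulr_ge0//.
          by rewrite ler_piMr// ler_pdivrMr// mul1r.
        have d0 : 0 < `|x - y| by exact: lt_le_trans d1.
        have := gk_tail s0 d0 (lexx `|x - y|) => ht.
        have dd : 0 <= `|x - y| / s by rewrite divr_ge0 ?ltW.
        have := ler_wpM2r dd ht.
        rewrite (_ : 6 * (s / `|x - y|) ^+ 2 * gk (2 * s) x y * (`|x - y| / s) =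
          6 * gk (2 * s) x y * (s / `|x - y|)); last by field; rewrite !gt_eqF.
        have : 6 * gk (2 * s) x y * (s / `|x - y|) <= 6 * gk (2 * s) x y.
          by rewrite ler_piMr ?mulr_ge0// ler_pdivrMr// mul1r.
        have := g0 y; lra.
      apply: (@le_trans _ _ (gk s x y * (2 + `|x - y| / s))).
        by rewrite ler_wpM2l// (le_trans p1)//; lra.
      by rewrite mulrDr; lra.
  have m1 : measurable_fun [set: R] (fun y => 3 * gk s x y).
    by apply: measurable_funM => //; exact: measurable_gk.
  have m2 : measurable_fun [set: R] (fun y => 6 * gk (2 * s) x y).
    by apply: measurable_funM => //; exact: measurable_gk.
  have g1 y : 0 <= 3 * gk s x y by rewrite mulr_ge0.
  have g2 y : 0 <= 6 * gk (2 * s) x y by rewrite mulr_ge0.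
  have g3 y : 0 <= 3 * gk s x y + 6 * gk (2 * s) x y by rewrite addr_ge0.
  have Kw : 0 <= K * w by rewrite mulr_ge0.
  rewrite intLZ//; last exact: measurable_funD.
  rewrite intLD// !intLZ//; do ?exact: measurable_gk.
  have b1 : (\int[leb]_(y in pos) (gk s x y)%:E <= 1)%E by exact: int_gk_le1.
  have b2 : (\int[leb]_(y in pos) (gk (2 * s) x y)%:E <= 1)%E by exact: int_gk_le1.
  apply: (@le_trans _ _ ((K * w)%:E * (3%:E * 1 + 6%:E * 1))%E).
    by rewrite lee_wpmul2l ?lee_fin// leeD// lee_wpmul2l ?lee_fin.
  rewrite !mule1 -EFinD -EFinM lee_fin.
  have v1 : 1 <= v.
    rewrite /v powRP ?divr_gt0// -[leLHS]expR0 ler_expR mulr_ge0 ?(ltW al0)// ln_ge0//.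
    by rewrite ler_pdivlMr// mul1r.
  have wv : w = v^-1.
    rewrite /w /v !powRP ?divr_gt0// -expRN -mulrN -lnV ?posrE ?divr_gt0//.
    by rewrite invf_div.
  rewrite wv (_ : 4 * (26 * K) * frac v = 26 * K * (4 * frac v)); last by ring.
  apply: (@le_trans _ _ (26 * K * v^-1)).
    rewrite mulrAC ler_wpM2r ?invr_ge0 ?(ltW v0)// mulrC ler_wpM2r//.
    by rewrite -natrD ler_nat.
  by rewrite ler_wpM2l ?mulr_ge0// frac_geV.
Qed.

(* The numbers v form a geometric progression of ratio q = 2^-al, and v / (1 + v)^2 is
   at most (1 - q)^-1 times the increment of v / (1 + v) from q v to v. *)
Lemma sum_heat_err r eta n x : 0 < r -> 0 < eta -> 0 < x ->
  \sum_(0 <= k < n) ((eta ^+ 2 * scale r k.+1) / x) `^ al /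
     (1 + ((eta ^+ 2 * scale r k.+1) / x) `^ al) ^+ 2 <= (1 - 2^-1 `^ al)^-1.
Proof.
move=> r0 e0 x0; pose q := (2^-1 : R) `^ al.
have i2 : 0 < 2^-1 :> R by rewrite invr_gt0.
have q0 : 0 < q by rewrite powR_gt0.
have q1 : q < 1.
  rewrite /q powRP// -[ltRHS]expR0 ltr_expR pmulr_rlt0// lnV ?posrE// oppr_lt0 ln_gt0//.
  by rewrite ltr1n.
pose V k := ((eta ^+ 2 * scale r k) / x) `^ al.
have sc k : 0 < (eta ^+ 2 * scale r k) / x.
  by rewrite divr_gt0 ?mulr_gt0 ?exprn_gt0 ?scale_gt0.
have V0 k : 0 < V k by rewrite powR_gt0.
have VS k : V k.+1 = q * V k.
  rewrite /V /q -powRM ?ltW//; congr (_ `^ _).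
  by rewrite (scaleS r k) mulr2n; field; rewrite gt_eqF.
pose ph v : R := v / (1 + v).
have tel k : V k / (1 + V k) ^+ 2 <= (1 - q)^-1 * (ph (V k) - ph (V k.+1)).
  rewrite ler_pdivlMl ?subr_gt0// VS /ph; have := V0 k; set v := V k => v0.
  have p1 : 0 < 1 + v by rewrite addr_gt0.
  have p2 : 0 < 1 + q * v by rewrite addr_gt0 ?mulr_gt0.
  rewrite (_ : v / (1 + v) - q * v / (1 + q * v) = ((1 - q) * v) / ((1 + v) * (1 + q * v))).
    rewrite mulrA; apply: ler_wpM2l; first by rewrite mulr_ge0 ?subr_ge0 ?(ltW q1) ?(ltW v0).
    rewrite lef_pV2 ?posrE ?exprn_gt0 ?mulr_gt0// expr2 ler_pM2l// lerD2l.
    by rewrite ler_piMl ?(ltW v0) ?(ltW q1).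
  by field; rewrite !gt_eqF.
apply: (@le_trans _ _ (\sum_(0 <= k < n) (1 - q)^-1 * (ph (V k.+1) - ph (V k.+2)))).
  by apply: ler_sum => k _; exact: tel.
rewrite -mulr_sumr -[leRHS]mulr1 ler_wpM2l ?invr_ge0 ?subr_ge0 ?(ltW q1)//.
have ph1 k : 0 <= ph (V k) <= 1.
  by rewrite /ph divr_ge0 ?addr_ge0 ?(ltW (V0 k))//= ler_pdivrMr ?addr_gt0// mul1r lerDr.
suff -> : \sum_(0 <= k < n) (ph (V k.+1) - ph (V k.+2)) = ph (V 1%N) - ph (V n.+1).
  by have := ph1 1%N; have := ph1 n.+1; lra.
elim: n => [|n IH]; first by rewrite big_geq// subrr.
by rewrite big_nat_recr//= IH; ring.
Qed.

End heat_kernel.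

(** * Measures carried by horizontal lines *)

Section integral_mrestr.
Context d (T : measurableType d) (R : realType) (m : {measure set T -> \bar R}).
Variables (D Q : set T) (mD : measurable D).
Local Open Scope ereal_scope.

Lemma ge0_integral_mrestr (f : T -> \bar R) : measurable Q -> D `<=` Q ->
  measurable_fun Q f -> (forall x, Q x -> 0 <= f x) ->
  \int[mrestr m mD]_(x in Q) f x = \int[m]_(x in D) f x.
Proof.
move=> mQ DQ mf f0; have mQD : measurable (Q `\` D) by exact: measurableD.
have eQ : Q = D `|` (Q `\` D) by rewrite setDUK.
rewrite {1}eQ ge0_integral_setU//=; last 3 first.
- by rewrite -eQ.
- by move=> x DQx; apply: f0; rewrite eQ.
- by apply/disj_setPS => x [Dx [_ /(_ Dx)]].
rewrite [X in _ + X]null_set_integral//; last 2 first.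
- by apply: measurable_funS mf => // x [].
- by rewrite [LHS](_ : _ = m ((Q `\` D) `&` D))// setIC setIDA setIC -setIDA setDv setI0 measure0.
rewrite adde0; apply: eq_measure_integral => A mA AD.
by rewrite /= /mrestr (setIidl AD).
Qed.

End integral_mrestr.

Section layers.
Context {R : realType}.
Local Notation leb := (@lebesgue_measure R).
Local Notation MR := (measurableTypeR R).
Implicit Types (b : R -> R) (t : R).

Lemma measurable_coord1 : measurable_fun [set: MR * MR] (fun p : MR * MR => p.1 : R).
Proof. by move=> mD Y mY; exact: (@measurable_fst _ _ MR MR mD Y mY). Qed.

Lemma measurable_coord2 : measurable_fun [set: MR * MR] (fun p : MR * MR => p.2 : R).
Proof. by move=> mD Y mY; exact: (@measurable_snd _ _ MR MR mD Y mY). Qed.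

Definition under_graph b : set (MR * MR) :=
  [set p : MR * MR | [/\ 0 < p.1, 0 <= p.2 & p.2 < b p.1]].

Lemma measurable_under_graph b : measurable_fun [set: R] b -> measurable (under_graph b).
Proof.
move=> mb.
have m2 : measurable_fun [set: MR * MR] (fun p : MR * MR => b p.1 - p.2).
  apply: (@measurable_funB _ (MR * MR)%type R); last exact: measurable_coord2.
  exact: (measurableT_comp mb measurable_coord1).
have -> : under_graph b = (pos `*` `[0, +oo[%classic) `&` (fun p : MR * MR => b p.1 - p.2) @^-1` pos.
  apply/seteqP; split => [p [p1 p2 p3]|p [[/posP p1 /=]]].
    by split; [split; [exact/posP|rewrite /= in_itv/= p2]|apply/posP; rewrite subr_gt0].
  by rewrite in_itv/= andbT => p2 /posP; rewrite subr_gt0.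
apply: measurableI; first by apply: measurableX; exact: measurable_itv.
by rewrite -[X in measurable X]setTI; apply: m2 => //; exact: measurable_pos.
Qed.

Definition at_height t (p : MR * MR) : R * R := (p.1, t).

Lemma measurable_at_height t : measurable_fun [set: MR * MR] (at_height t).
Proof.

apply/measurable_fun_pairP; split; last exact: measurable_cst.
by move=> mD Y mY; exact: (measurable_coord1 mD mY).
Qed.

(* Pushed forward by [at_height t], the area under the graph of b becomes the
   measure b(y) dy carried by the line at height t. *)
Definition layer b (mb : measurable_fun [set: R] b) t : {measure set (R * R) -> \bar R} :=
  measure_function_pushforward__canonical__measure_function_Measure
    (mrestr (leb \x leb)%E (measurable_under_graph mb)) (measurable_at_height t).

Local Open Scope ereal_scope.

Lemma integral_layer b (mb : measurable_fun [set: R] b) t (h : R * R -> \bar R) :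
  (forall x, 0 <= b x)%R -> (0 < t)%R ->
  measurable_fun quadrant h -> (forall p, quadrant p -> 0 <= h p) ->
  \int[layer mb t]_(p in quadrant) h p = \int[leb]_(y in pos) ((b y)%:E * h (y, t)).
Proof.
move=> b0 t0 mh h0; have mQ : measurable (quadrant : set (R * R)).
  by apply: measurableX; exact: measurable_itv.
rewrite /layer ge0_integral_pushforward//=; last 2 first.
- exact: measurable_at_height.
- by move=> p /set_mem; exact: h0.
pose Q : set (MR * MR) := pos `*` setT.
have eQ : at_height t @^-1` quadrant = Q.
  apply/seteqP; split => [p [/= p1 _]|p [/posP p1 _]]; first by split.
  by split => /=; rewrite in_itv/= andbT.
rewrite eQ.
have mQ' : measurable Q by apply: measurableX => //; exact: measurable_itv.
have mh' : measurable_fun Q (h \o at_height t).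
  rewrite -eQ => mE Y mY; rewrite comp_preimage -preimage_setI.
  have := mh mQ Y mY; move: (quadrant `&` _) => Z mZ.
  by have := measurable_at_height t measurableT mZ; rewrite setTI.
have hh p : Q p -> 0 <= (h \o at_height t) p.
  move=> [/posP p1 _]; apply: h0; split => /=; rewrite in_itv/= andbT//.
have DQ : under_graph b `<=` Q by move=> p [p1 _ _]; split => //; exact/posP.
rewrite ge0_integral_mrestr// integral_mkcond fubini_tonelli1; last 2 first.
- apply/(measurable_restrictT _ (measurable_under_graph mb)).
  exact: measurable_funS mh'.
- by move=> p; apply: erestrict_ge0 => q /DQ/hh.
rewrite [RHS]integral_mkcond; apply: eq_integral => y _.
rewrite /fubini_F /= [RHS]patchE; case: ifPn => [/set_mem/posP y0|/negP yp].
  transitivity (\int[leb]_(s in ico 0 (b y)) h (y, t)).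
    rewrite [RHS]integral_mkcond; apply: eq_integral => s _.
    rewrite !patchE; congr (if _ then _ else _); 
    rewrite /ico; apply/idP/idP => /set_mem H; apply/mem_set.
      by case: H => /= _ s0 sb; rewrite in_itv/= add0r s0.
    by move: H; rewrite /= in_itv/= add0r => /andP[].
  have mi : measurable (ico 0 (b y) : set MR) by exact: measurable_itv.
  rewrite -(leb_itv 0 (b0 y)) muleC.
  exact: (@integral_cst _ MR R leb (ico 0 (b y)) mi (h (y, t))).
apply: integral0_eq => s _; rewrite patchE ifF//.
by apply/negP => /set_mem[/= y0 _ _]; apply: yp; apply/mem_set/posP.

Qed.

Lemma layered_measure (b : nat -> R -> R) (t : nat -> R) :
  (forall k, measurable_fun [set: R] (b k)) -> (forall k x, 0 <= b k x)%R ->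
  (forall k, 0 < t k)%R ->
  exists m : {measure set (R * R) -> \bar R}, m (~` quadrant) = 0 /\
    forall h, measurable_fun quadrant h -> (forall p, quadrant p -> 0 <= h p) ->
    \int[m]_(p in quadrant) h p =
    \sum_(0 <= k <oo) \int[leb]_(y in pos) ((b k y)%:E * h (y, t k)).
Proof.
move=> mb b0 t0; exists (mseries (fun k => layer (mb k) (t k)) 0); split.
  rewrite /= /mseries eseries0// => k _ _.
  rewrite /layer /= /pushforward /mrestr.
  rewrite [X in (_ \x _) X](_ : _ = set0) ?measure0//.
  apply/seteqP; split => // p [/= np [p1 p2 p3]]; apply: np.
  by split => /=; rewrite in_itv/= andbT.
move=> h mh h0; rewrite ge0_integral_measure_series//; last first.
  by apply: measurableX; exact: measurable_itv.
by apply: eq_eseriesr => k _; exact: integral_layer.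
Qed.

Definition posr (x : R) : R := Num.max x 0%R.

Lemma posr_ge0 x : (0 <= posr x)%R. Proof. by rewrite /posr le_max lexx orbT. Qed.

Lemma posrB x : (posr x - posr (- x) = x)%R.
Proof.
by rewrite /posr; case: (leP x 0%R) => x0; case: (leP (- x) 0)%R => x1; lra.
Qed.

Lemma posrD x : (posr x + posr (- x) = `|x|)%R.
Proof.
by rewrite /posr; case: (leP x 0%R) => x0; case: (leP (- x) 0)%R => x1;
  [rewrite ler0_norm//|rewrite ler0_norm//|rewrite gtr0_norm//|]; lra.
Qed.

Lemma posr_mul0 x : (0 < posr x)%R -> posr (- x) = 0%R.
Proof.
by rewrite /posr; case: (leP x 0%R) => x0; case: (leP (- x) 0)%R => x1; lra.
Qed.

Lemma measurable_posr (b : R -> R) : measurable_fun [set: R] b ->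
  measurable_fun [set: R] (fun x => posr (b x)).
Proof. by move=> mb; apply: measurable_maxr. Qed.

(** The heights are distinct so that the two parts are mutually singular: [P] collects on each line
    the points where the density is positive, and no other layer lives on that line. *)
Lemma layered_signed_measure (b : nat -> R -> R) (t : nat -> R) :
  (forall k, measurable_fun [set: R] (b k)) -> injective t ->
  (forall k, 0 < t k)%R ->
  exists mu : signed_measure R, forall h,
    measurable_fun quadrant h -> (forall p, quadrant p -> 0 <= h p) ->
    \int[pos_part mu]_(p in quadrant) h p =
      \sum_(0 <= k <oo) \int[leb]_(y in pos) ((posr (b k y))%:E * h (y, t k)) /\
    \int[neg_part mu]_(p in quadrant) h p =
      \sum_(0 <= k <oo) \int[leb]_(y in pos) ((posr (- b k y))%:E * h (y, t k)).
Proof.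
move=> mb tI t0.
have mb1 k : measurable_fun [set: R] (fun x => posr (b k x)) by exact: measurable_posr.
have mb2 k : measurable_fun [set: R] (fun x => posr (- b k x)).
  by apply: measurable_posr; apply: measurableT_comp.
have [m1 [m1Q m1E]] := layered_measure mb1 (fun k x => posr_ge0 _) t0.
have [m2 [m2Q m2E]] := layered_measure mb2 (fun k x => posr_ge0 _) t0.
have mQ : measurable (quadrant : set (R * R)).
  by apply: measurableX; exact: measurable_itv.
pose P : set (R * R) := \bigcup_k ([set y | (0 < posr (b k y))%R] `*` [set t k]).
have mP : measurable P.
  apply: bigcup_measurable => k _; apply: measurableX; last exact: measurable_set1.
  rewrite (_ : [set y | _] = (fun x => posr (b k x)) @^-1` pos); last first.
    by apply/seteqP; split => y /posP.
  by rewrite -[X in measurable X]setTI; apply: mb1 => //; exact: measurable_itv.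
(* The parts are known only through their integrals over the quadrant; a null set is recognised by
   the integral of its indicator, together with the null complement of the quadrant. *)
have null (m : {measure set (R * R) -> \bar R}) A : m (~` quadrant) = 0 -> measurable A ->
    \int[m]_(p in quadrant) (\1_A p)%:E = 0 -> m A = 0.
  move=> mq mA; rewrite integral_indic// => m0; apply/eqP; rewrite eq_le measure_ge0 andbT.
  rewrite -(adde0 0) -{1}m0 -mq.
  apply: (@le_trans _ _ (m (A `&` quadrant `|` ~` quadrant))).
    apply: le_measure; rewrite ?inE//.
      by apply: measurableU; [exact: measurableI|exact: measurableC].
    by move=> p Ap; have [pq|pq] := pselect (quadrant p); [left|right].
  by apply: measureU2; [exact: measurableI|exact: measurableC].
have indic_ok A : measurable A -> measurable_fun quadrant (fun p : R * R => (\1_A p)%:E : \bar R).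
  by move=> mA; apply/measurable_EFinP; exact: measurable_indic.
have sing : exists P : set (R * R), [/\ measurable P, m1 (~` P) = 0 & m2 P = 0].
  exists P; split => //.
    apply: null => //; first exact: measurableC.
    rewrite m1E; [|by apply: indic_ok; exact: measurableC|by move=> p _; rewrite lee_fin].
    rewrite eseries0// => k _ _; apply: integral0_eq => y _.
    rewrite -EFinM indicE; have [b0|b0] := boolP (0 < posr (b k y))%R.
      by rewrite memNset ?mulr0//; apply; exists k.
    have /eqP -> : posr (b k y) == 0%R by rewrite eq_le posr_ge0 andbT leNgt.
    by rewrite mul0r.
  apply: null => //.
  rewrite m2E; [|exact: indic_ok|by move=> p _; rewrite lee_fin].
  rewrite eseries0// => k _ _; apply: integral0_eq => y _.
  rewrite -EFinM indicE; have [b0|b0] := boolP (0 < posr (b k y))%R.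
    by rewrite posr_mul0// mul0r.
  rewrite memNset ?mulr0// => -[j _ [/= bj /tI kj]].
  by move: b0; rewrite kj bj.
exists (SignedMeasure m1Q m2Q sing) => h mh h0.
by split; [exact: m1E|exact: m2E].
Qed.

End layers.

(** * Odd reflection *)

Section reflection.
Context {R : realType}.
Local Notation leb := (@lebesgue_measure R).
Local Notation MR := (measurableTypeR R).

Lemma measurable_opp : measurable_fun [set: MR] (fun x : MR => - x : MR).
Proof. exact: (@oppr_measurable R setT). Qed.

Definition leb_opp : {measure set MR -> \bar R} :=
  measure_function_pushforward__canonical__measure_function_Measure
    leb measurable_opp.

Lemma leb_oppE (A : set R) : measurable A -> leb A = leb_opp A.
Proof.
apply: (@lebesgue_measure_unique R leb_opp) => X [[a b] ab <-] /=.
rewrite /leb_opp /= /pushforward.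
rewrite (_ : _ @^-1` _ = `[- b, - a[%classic :> set R); last first.
  by apply/seteqP; split => x /=; rewrite !in_itv/= lerNl ltrNr andbC.
by rewrite !lebesgue_measure_itv/= !lte_fin ltrN2; case: ifP => // _;
  rewrite -!EFinB opprK addrC.
Qed.

Lemma ge0_integral_opp (D : set R) (f : R -> \bar R) : measurable D ->
  measurable_fun D f -> (forall x, D x -> 0 <= f x)%E ->
  (\int[leb]_(x in D) f x = \int[leb]_(x in -%R @^-1` D) f (- x)%R)%E.
Proof.
move=> mD mf f0; rewrite (@eq_measure_integral _ MR R D leb_opp); last first.
  by move=> A mA _; exact: leb_oppE.
apply: (@ge0_integral_pushforward _ _ MR MR R _ measurable_opp leb D f) => //.
by move=> x /set_mem; exact: f0.
Qed.

Lemma integral_opp (D : set R) (f : R -> R) : measurable D ->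
  measurable_fun [set: R] f -> leb.-integrable D (EFin \o f) ->
  \int[leb]_(x in D) f x = \int[leb]_(x in -%R @^-1` D) f (- x).
Proof.
move=> mD mf fi; rewrite /Rintegral; congr fine.
rewrite (@eq_measure_integral _ MR R D leb_opp); last first.
  by move=> A mA _; exact: leb_oppE.
apply: (@integral_pushforward _ _ MR MR R _ measurable_opp leb D (EFin \o f)) => //.
- exact: measurableT_comp.
- have /integrableP[_ foo] := fi.
  have mD' : measurable (-%R @^-1` D : set MR).
    by rewrite -[X in measurable X]setTI; exact: measurable_opp.
  apply/integrableP; split.
    apply: measurable_funTS; apply: measurableT_comp; last exact: measurable_opp.
    exact: measurableT_comp.
  apply: le_lt_trans foo; rewrite ge0_integral_opp//.
  by apply: measurable_funTS; do 2 apply: measurableT_comp => //.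
Qed.

Lemma ae_opp (P : R -> Prop) : {ae leb, forall x, P x} -> {ae leb, forall x, P (- x)}.
Proof.
move=> [A [mA A0 PA]]; exists (-%R @^-1` A); split.
- by rewrite -[X in measurable X]setTI; exact: measurable_opp.
- by rewrite -A0 (leb_oppE mA).
- by move=> x Px; exact: PA.
Qed.

End reflection.

(** * Balayage of layered measures *)

Section layered_balayage.
Context {R : realType}.
Local Notation leb := (@lebesgue_measure R).
Local Notation MR := (measurableTypeR R).

Lemma bounded_interval_len (I : set R) : bounded_interval I ->
  leb I = (len I)%:E /\ 0 < len I.
Proof.
move=> [iI [M [_ HM]] Ipos I0]; suff h : leb I = (len I)%:E.
  by split => //; rewrite -lte_fin -h.
rewrite /len fineK// ge0_fin_numE//.
have H1 : leb (`[- (M + 1), M + 1]%classic : set R) = (if (- (M + 1) < M + 1)%R then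
    (M + 1)%:E - (- (M + 1))%:E else 0)%E.
  by rewrite lebesgue_measure_itv/= lte_fin.
apply: (@le_lt_trans _ _ (leb (`[- (M + 1), M + 1]%classic : set R))).
  apply: le_measure; rewrite ?inE; [exact: is_interval_measurable|exact: measurable_itv|].
  move=> x Ix /=; rewrite in_itv/= -ler_norml; apply: HM => //.
  by rewrite ltrDl.
by rewrite H1; case: ifP => _; rewrite ?ltry// -EFinB ltry.
Qed.

Lemma heat_kernel_ge0 (lam s x y : R) : 0 < lam -> 0 < s -> 0 < x -> 0 < y ->
  0 <= heat_kernel lam (s ^+ 2 / 2) x y.
Proof.
move=> l0 s0 x0 y0; rewrite heat_kernelE// mulr_ge0 ?(ltW (kappa_gt0 l0))//.
rewrite mulr_ge0 ?gk_ge0// mulr_ge0 ?mulr_ge0 ?powR_ge0 ?expR_ge0//.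
rewrite (le_trans ler01)// bsum_ge1 ?addr_gt0 ?invr_gt0//.
by rewrite divr_ge0// sqr_ge0.
Qed.

Lemma balayage_kernel_ge0 (lam x : R) p : 0 < lam -> 0 < x -> quadrant p ->
  0 <= balayage_kernel lam x p.
Proof.
move=> l0 x0 [/posP p1 /posP p2]; rewrite /balayage_kernel.
rewrite (_ : p.2 = Num.sqrt (2 * p.2) ^+ 2 / 2).
  by rewrite heat_kernel_ge0// sqrtr_gt0 mulr_gt0.
by rewrite sqr_sqrtr ?mulr_ge0 ?(ltW p2)// mulrC mulKf.
Qed.

Lemma nneseries_term_le (P : nat -> \bar R) j : (forall k, 0 <= P k)%E ->
  (P j <= \sum_(0 <= k <oo) P k)%E.
Proof.
move=> P0; apply: (@le_trans _ _ (\sum_(0 <= k < j.+1) P k)%E).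
  by rewrite big_nat_recr//= leeDr// sume_ge0.
by apply: nneseries_lim_ge => k _ _.
Qed.

Lemma nneseries_fine_cvg (P : nat -> \bar R) : (forall k, 0 <= P k)%E ->
  (\sum_(0 <= k <oo) P k < +oo)%E ->
  \sum_(0 <= k < n) fine (P k) @[n --> \oo] --> fine (\sum_(0 <= k <oo) P k)%E.
Proof.
move=> P0 Poo; have fP k : P k \is a fin_num.
  rewrite ge0_fin_numE//; apply: le_lt_trans Poo.
  exact: nneseries_term_le.
rewrite (_ : (fun n => _) = fine \o (fun n => \sum_(0 <= k < n) P k)%E).
  apply: fine_cvg; rewrite fineK; first by apply: is_cvg_nneseries => k _ _.
  by rewrite ge0_fin_numE// nneseries_ge0.
apply/funext => n /=; rewrite (eq_bigr (fun k => (fine (P k))%:E)) ?sumEFin//.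
by move=> k _; rewrite fineK.
Qed.

Variables (mu : signed_measure R) (b : nat -> R -> R) (t : nat -> R) (B : R).
Hypotheses (mb : forall k, measurable_fun [set: R] (b k)) (t0 : forall k, 0 < t k)
  (bB : forall n y, \sum_(0 <= k < n) `|b k y| <= B)
  (muE : forall h, measurable_fun quadrant h -> (forall p, quadrant p -> 0 <= h p)%E ->
    (\int[pos_part mu]_(p in quadrant) h p =
      \sum_(0 <= k <oo) \int[leb]_(y in pos) ((posr (b k y))%:E * h (y, t k)))%E /\
    (\int[neg_part mu]_(p in quadrant) h p =
      \sum_(0 <= k <oo) \int[leb]_(y in pos) ((posr (- b k y))%:E * h (y, t k)))%E).

Lemma measurable_slice (u : R) (h : R * R -> \bar R) : 0 < u ->
  measurable_fun quadrant h -> measurable_fun pos (fun y => h (y, u)).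
Proof.
move=> u0 mh mP Y mY.
have mQ : measurable (quadrant : set (R * R)) by apply: measurableX; exact: measurable_itv.
rewrite (_ : _ `&` _ = (fun y : R => (y, u)) @^-1` (quadrant `&` h @^-1` Y)); last first.
  apply/seteqP; split => y /=; first by move=> [y0 hy]; split => //; split => //; exact/posP.
  by move=> [[y0 _] hy]; split.
have mp : measurable_fun [set: R] (fun y : R => (y, u)).
  by apply/measurable_fun_pairP; split; [exact: measurable_id|exact: measurable_cst].
by have := mp measurableT _ (mh mQ Y mY); rewrite setTI.
Qed.

Lemma measurable_layer_term (c : R -> R) k (h : R * R -> \bar R) : measurable_fun [set: R] c ->
  measurable_fun quadrant h -> measurable_fun pos (fun y => (c y)%:E * h (y, t k))%E.
Proof.
move=> mc mh; apply: emeasurable_funM; last exact: measurable_slice.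
by apply/measurable_EFinP; exact: measurable_funTS.
Qed.

Lemma abs_measureE h : measurable_fun quadrant h -> (forall p, quadrant p -> 0 <= h p)%E ->
  (\int[abs_measure mu]_(p in quadrant) h p =
   \sum_(0 <= k <oo) \int[leb]_(y in pos) (`|b k y|%:E * h (y, t k)))%E.
Proof.
move=> mh h0; have [e1 e2] := muE mh h0.
have mQ : measurable (quadrant : set (R * R)) by apply: measurableX; exact: measurable_itv.
have hp k y : pos y -> (0 <= h (y, t k))%E.
  by move=> y0; apply: h0; split => //=; exact/posP.
have mp c k : measurable_fun [set: R] c ->
    measurable_fun pos (fun y => (posr (c y))%:E * h (y, t k))%E.
  by move=> mc; apply: measurable_layer_term => //; exact: measurable_posr.
have pp c k y : pos y -> (0 <= (posr (c y))%:E * h (y, t k))%E.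
  by move=> y0; rewrite mule_ge0 ?lee_fin ?posr_ge0 ?hp.
apply: (etrans (ge0_integral_measure_add (pos_part mu) (neg_part mu) mQ h0 mh)).
rewrite e1 e2 -nneseriesD; last 2 first.
- by move=> k _ _; apply: integral_ge0 => y y0; exact: (pp (b k)).
- by move=> k _ _; apply: integral_ge0 => y y0; exact: (pp (fun y => - b k y)).
apply: eq_eseriesr => k _.
rewrite -ge0_integralD; first last.
- by apply: (mp (fun y => - b k y)); exact: measurableT_comp.
- by move=> y y0; exact: (pp (fun y => - b k y)).
- exact: mp.
- by move=> y y0; exact: (pp (b k)).
- exact: measurable_pos.
apply: eq_integral => y /set_mem y0.
by rewrite -ge0_muleDl ?lee_fin ?posr_ge0// -EFinD posrD.
Qed.

(** A box over I lies in the full strip over I, whose measure under |mu| is the integral over I of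
    the sum of the |b k|. *)
Lemma carleson_norm_le : (carleson_norm mu <= B%:E)%E.
Proof.
apply: ge_ereal_sup => _ [I bI <-]; have [lI l0] := bounded_interval_len bI.
have [iI _ Ip _] := bI; have mI : measurable I by exact: is_interval_measurable.
rewrite lee_pdivrMr// -lI.
have mQ : measurable (quadrant : set (R * R)) by apply: measurableX; exact: measurable_itv.
have mbox : measurable (carleson_box I) by apply: measurableX => //; exact: measurable_itv.
have boxQ : carleson_box I `<=` quadrant.
  move=> [y u] [/= yI]; rewrite in_itv/= => /andP[u0 _].
  by split; [exact: Ip|rewrite /= in_itv/= u0].
rewrite -{1}(setIidl boxQ) -integral_indic//.
rewrite (abs_measureE (h := fun p => (\1_(carleson_box I) p)%:E)); first last.
- by move=> p _; rewrite lee_fin.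
- by apply/measurable_EFinP; exact: measurable_indic.
have m1 k : measurable_fun pos (fun y => `|b k y|%:E * (\1_(carleson_box I) (y, t k))%:E)%E.
  apply: (@measurable_layer_term (fun y => `|b k y|) k (fun p => (\1_(carleson_box I) p)%:E)); first exact: measurableT_comp.
  by apply/measurable_EFinP; exact: measurable_indic.
have p1 k y : (0 <= `|b k y|%:E * (\1_(carleson_box I) (y, t k))%:E :> \bar R)%E.
  by rewrite -EFinM lee_fin mulr_ge0.
apply: lime_le; first by apply: is_cvg_nneseries => k _ _; exact: integral_ge0.
apply: nearW => n; rewrite -ge0_integral_sum//; last exact: measurable_pos.
have B0 : 0 <= B by have := bB 0 0; rewrite big_geq.
have mi : measurable_fun [set: R] (\1_I : R -> R) by exact: measurable_indic.
apply: (@le_trans _ _ (\int[leb]_(y in pos) (B * \1_I y)%:E)%E).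
  apply: ge0_le_integral; first exact: measurable_pos.
  - by move=> y _; exact: sume_ge0.
  - exact: emeasurable_sum.
  - by apply/measurable_EFinP; apply: measurable_funTS; exact: measurable_funM.
  move=> y _; under eq_bigr do rewrite -EFinM.
  rewrite sumEFin lee_fin.
  apply: (@le_trans _ _ (\sum_(0 <= k < n) `|b k y| * \1_I y)).
    apply: ler_sum => k _; rewrite ler_wpM2l// !indicE.
    have [_|nI] := boolP (y \in I); first by case: (_ \in _).
    by rewrite memNset// => -[/= yI _]; move: nI; rewrite mem_set.
  by rewrite -mulr_suml ler_wpM2r.
rewrite intLZ//; last exact: measurable_pos.
rewrite intL_indic//; last exact: measurable_pos.
by rewrite (setIidl Ip).
Qed.

(** The positive and negative parts of b k are dominated by |b k|, so both series of nonnegative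
    integrals are finite and can be subtracted term by term. *)
Lemma balayage_layers lam x : 0 < lam -> 0 < x ->
  (\sum_(0 <= k <oo) \int[leb]_(y in pos) (`|b k y| * heat_kernel lam (t k) x y)%:E < +oo)%E ->
  balayage_converges lam mu x /\
  \sum_(0 <= k < n) \int[leb]_(y in pos) (b k y * heat_kernel lam (t k) x y) @[n --> \oo]
    --> balayage lam mu x.
Proof.
move=> l0 x0 Aoo; pose h p := (balayage_kernel lam x p)%:E.
have mh : measurable_fun quadrant h.
  by apply/measurable_EFinP; exact: measurable_balayage_kernel.
have h0 p : quadrant p -> (0 <= h p)%E by move=> Qp; rewrite lee_fin balayage_kernel_ge0.
have mQ : measurable (quadrant : set (R * R)) by apply: measurableX; exact: measurable_itv.
have [e1 e2] := muE mh h0; have e3 := abs_measureE mh h0.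
have hp k y : pos y -> (0 <= h (y, t k))%E.
  by move=> y0; apply: h0; split => //=; exact/posP.
pose P c k := (\int[leb]_(y in pos) ((posr (c k y))%:E * h (y, t k)))%E.
pose b' k y := - b k y.
have P0 c k : (0 <= P c k)%E.
  by apply: integral_ge0 => y y0; apply: mule_ge0; [rewrite lee_fin posr_ge0|exact: hp].
have mb' k : measurable_fun [set: R] (b' k) by exact: measurableT_comp.
have Ple c : (forall k, measurable_fun [set: R] (c k)) ->
    (forall k y, posr (c k y) <= `|b k y|) -> (\sum_(0 <= k <oo) P c k < +oo)%E.
  move=> mc cb; apply: le_lt_trans Aoo; apply: lee_nneseries => k _; first by move=> _; exact: P0.
  apply: ge0_le_integral; first exact: measurable_pos.
  - by move=> y y0; apply: mule_ge0; [rewrite lee_fin posr_ge0|exact: hp].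
  - by apply: measurable_layer_term => //; exact: measurable_posr.
  - apply: (@measurable_layer_term (fun y => `|b k y|) k h) => //.
    exact: measurableT_comp.
  - move=> y y0; rewrite [leRHS]EFinM lee_wpmul2r//; first exact: hp.
    by rewrite lee_fin.
have Pb : (\sum_(0 <= k <oo) P b k < +oo)%E.
  by apply: Ple => // k y; rewrite -posrD lerDl posr_ge0.
have Pb' : (\sum_(0 <= k <oo) P b' k < +oo)%E.
  by apply: Ple => // k y; rewrite -posrD lerDr posr_ge0.
split.
  apply/integrableP; split => //.
  rewrite (eq_integral h); last by move=> p /set_mem Qp; rewrite gee0_abs ?h0.
  by rewrite e3.
rewrite /balayage /Rintegral -/h e1 e2 -/(P b).
rewrite (_ : (fun n => _) = fun n => \sum_(0 <= k < n) fine (P b k) - \sum_(0 <= k < n) fine (P b' k)).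
  by apply: cvgB; exact: nneseries_fine_cvg.
apply/funext => n; rewrite -sumrB; apply: eq_bigr => k _.
have fin c j : (forall k, measurable_fun [set: R] (c k)) -> (\sum_(0 <= k <oo) P c k < +oo)%E ->
    leb.-integrable pos (EFin \o (fun y => posr (c j y) * heat_kernel lam (t j) x y)).
  move=> mc coo; apply/integrableP; split.
    by apply: (@measurable_layer_term (fun y => posr (c j y)) j h) => //; exact: measurable_posr.
  apply: le_lt_trans coo; apply: (le_trans _ (nneseries_term_le j (P0 c))).
  rewrite le_eqVlt; apply/orP; left; apply/eqP; apply: eq_integral => y /set_mem y0.
  rewrite /= ger0_norm//.
  by have := hp j y y0; rewrite /h lee_fin => hh; rewrite mulr_ge0// posr_ge0.
rewrite -[fine (P b k)]/(\int[leb]_(y in pos) (posr (b k y) * heat_kernel lam (t k) x y)).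
rewrite -[fine (P b' k)]/(\int[leb]_(y in pos) (posr (b' k y) * heat_kernel lam (t k) x y)).
rewrite -RintegralB//; [|exact: measurable_pos|exact: fin|exact: fin].
by apply: eq_Rintegral => y _; rewrite -mulrBl posrB.
Qed.

End layered_balayage.

(** * Extension by zero of functions in BMOo *)

Section lbmo_of_BMOo.
Context {R : realType}.
Local Notation leb := (@lebesgue_measure R).
Local Notation MR := (measurableTypeR R).
Implicit Types (f : R -> R) (a c r x l : R).
#[local] Hint Extern 0 (measurable (ico _ _)) => solve [exact: measurable_ico] : core.

Lemma measurable_pos_BMOo f : BMOo f -> measurable_fun pos f.
Proof.
move=> [fi _]; rewrite (_ : pos = \bigcup_n `]0, n.+1%:R[%classic :> set R).
  apply/measurable_fun_bigcup => [n|n]; first exact: measurable_itv.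
  have /integrableP[mf _] := fi n.+1%:R (ltr0Sn _ n).
  exact/measurable_EFinP.
apply/seteqP; split => [x /posP x0|x [n _]/=].
  exists (Num.trunc x) => //=; rewrite in_itv/= x0/=.
  by rewrite truncnS_gt.
by rewrite in_itv/= => /andP[x0 _]; exact/posP.
Qed.

Lemma measurable_restrict_pos f : measurable_fun pos f -> measurable_fun [set: R] (f \_ pos).
Proof. by move=> mf; apply/(measurable_restrictT _ _).1 => //; exact: measurable_pos. Qed.

Lemma restrict_pos f x : 0 < x -> (f \_ pos) x = f x.
Proof. by move=> x0; rewrite patchE mem_set//; exact/posP. Qed.

Lemma restrict_neg f x : x <= 0 -> (f \_ pos) x = 0.
Proof.
move=> x0; rewrite patchE; case: ifPn => // /set_mem/posP.
by rewrite ltNge x0.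
Qed.

Lemma mem_ooE (y z : R) : (y \in (`]0, z[%classic : set R)) = (0 < y < z).
Proof. by rewrite mem_setE in_itv. Qed.

Lemma mem_icoE (y x l : R) : (y \in ico x l) = (x <= y < x + l).
Proof. by rewrite mem_setE in_itv. Qed.

Lemma integral_norm_le f r c : BMOo f -> bmo_bound f c -> 0 < r ->
  (\int[leb]_(y in `]0%R, r[) `|f y|%:E <= (c * r)%:E)%E.
Proof.
move=> [fi _] [_ fb] r0; have := fb r r0; rewrite ler_pdivrMl// mulrC => h.
have ii := integrable_abse (fi r r0).
have fin : (\int[leb]_(y in `]0%R, r[) `|f y|%:E)%E \is a fin_num.
  exact: (integrable_fin_num _ ii).
by rewrite -(fineK fin) lee_fin.
Qed.

Lemma integral_norm_restrict_le f c x l : BMOo f -> bmo_bound f c -> x <= 0 -> 0 <= l -> 0 <= c ->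
  (\int[leb]_(y in ico x l) `|(f \_ pos) y|%:E <= (c * l)%:E)%E.
Proof.
move=> fB fc x0 l0 c0; have mf := measurable_pos_BMOo fB.
rewrite integral_mkcond.
have [xl|xl] := leP (x + l) 0.
  rewrite integral0_eq ?lee_fin ?mulr_ge0// => y _.
  rewrite patchE; case: ifPn => // /set_mem; rewrite /ico/= in_itv/= => /andP[_ yl].
  by rewrite restrict_neg ?normr0// (le_trans (ltW yl)).
apply: (@le_trans _ _ (c * (x + l))%:E); last by rewrite lee_fin ler_wpM2l// gerDr.
rewrite (le_trans _ (integral_norm_le fB fc xl))// [leRHS]integral_mkcond.
rewrite le_eqVlt; apply/orP; left; apply/eqP; apply: eq_integral => y _.
rewrite patchE [RHS]patchE mem_icoE mem_ooE; have [y0|y0] := ltP 0 y; last first.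
  by rewrite /= restrict_neg// normr0 if_same.
by rewrite /= (le_trans x0 (ltW y0)) restrict_pos.
Qed.

(** An interval starting at x > 0 is covered by the oscillation condition on f. For x <= 0 the
    constant is 0, and the bound on the averages over intervals starting at 0 controls the part in
    the half-line; this is what allows extension by zero. At the top scale, f lives on an interval
    of length r up to a null set. *)
Lemma lbmo_of_BMOo f c r : BMOo f -> 0 < c -> bmo_bound f c -> 0 < r ->
  {ae leb, forall x, r <= x -> f x = 0} -> lbmo r c (f \_ pos).
Proof.
move=> fB c0 fc r0 f0; have mf := measurable_pos_BMOo fB.
have mg := measurable_restrict_pos mf.
split => // [x l /andP[l0 lr]|x].
  have [x0|x0] := leP x 0.
    exists 0; under eq_integral do rewrite subr0.
    exact: integral_norm_restrict_le (ltW l0) (ltW c0).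
  exists (mean f (ico x l)).
  have bI : bounded_interval (ico x l).
    split; first exact: interval_is_interval.
    - exists (x + l); split => [|M xlM y]; first exact: num_real.
      rewrite /ico/= in_itv/= => /andP[xy yl].
      by rewrite ger0_norm ?(le_trans (ltW x0))// (le_trans (ltW yl) (ltW xlM)).
    - by move=> y; rewrite /ico/= !in_itv/= => /andP[xy _]; rewrite (lt_le_trans x0).
    - by rewrite leb_itv ?(ltW l0)// lte_fin.
  have lE : len (ico x l) = l by rewrite /len leb_itv ?(ltW l0).
  have := fc.1 _ bI; rewrite [X in X^-1 * _]lE ler_pdivrMl// mulrC => h.
  set m := mean _ _ in h *.
  have xl0 : 0 < x + l by rewrite addr_gt0.
  have fi : leb.-integrable (ico x l) (EFin \o f).
    apply: (@integrableS _ MR R leb `]0, (x + l)[%classic) => //.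
    - by move=> y; rewrite /ico/= !in_itv/= => /andP[xy ->]; rewrite (lt_le_trans x0).
    - exact: fB.1.
  have fmi : leb.-integrable (ico x l) (EFin \o (fun y => f y - m)).
    have -> : EFin \o (fun y => f y - m) = ((EFin \o f) \- (EFin \o cst m))%E by [].
    apply: (@integrableB _ MR R leb) => //.
    apply: measurable_bounded_integrable.
    - by [].
    - by rewrite /= leb_itv ?(ltW l0)// ltry.
    - exact: measurable_cst.
    - exact: bounded_cst.
  have fin : (\int[leb]_(y in ico x l) `|f y - m|%:E)%E \is a fin_num.
    exact: (integrable_fin_num _ (integrable_abse fmi)).
  apply: (@le_trans _ _ (\int[leb]_(y in ico x l) `|f y - m|%:E)%E); last first.
    by rewrite -(fineK fin) lee_fin.
  rewrite le_eqVlt; apply/orP; left; apply/eqP; apply: eq_integral => y /set_mem; rewrite /ico/= in_itv/= => /andP[xy _].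
  by rewrite restrict_pos// (lt_le_trans x0).
have mabs : measurable_fun [set: R] (fun y => `|(f \_ pos) y|%:E).
  by apply/measurable_EFinP; exact: measurableT_comp.
apply: (@le_trans _ _ (\int[leb]_y `|(f \_ pos) y|%:E)%E).
  exact: ge0_subset_integral.
rewrite (le_trans _ (integral_norm_le fB fc r0))// [leRHS]integral_mkcond.
have mI : measurable (`]0, r[%classic : set R) by exact: measurable_itv.
have mr : measurable_fun (`]0, r[%classic : set R) (fun y => `|f y|%:E).
  apply/measurable_EFinP; apply: measurableT_comp => //.
  apply: measurable_funS mf; first exact: measurable_pos.
  by move=> y /=; rewrite in_itv/= => /andP[y0 _]; exact/posP.
rewrite le_eqVlt; apply/orP; left; apply/eqP.
apply: (@ae_eq_integral _ MR R leb setT) => //.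
  exact: (measurable_restrictT _ mI).1 mr.
apply: (ae_leb_impl f0) => y fy _ /=; rewrite [RHS]patchE.
have [y0|y0] := ltP 0 y; last first.
  by rewrite restrict_neg// normr0 mem_ooE ltNge y0.
rewrite restrict_pos//; have [ry|yr] := leP r y.
  by rewrite fy// normr0 if_same.
by rewrite mem_ooE y0 yr.
Qed.

Lemma lbmo_scale r c f : 0 < c -> lbmo r c f -> lbmo r 1 (fun x => f x / c).
Proof.
move=> c0 [mf h1 h2]; have ci : 0 <= c^-1 by rewrite invr_ge0 ltW.
have key D m (e : R) : measurable (D : set R) -> (\int[leb]_(y in D) `|f y - m|%:E <= (c * e)%:E)%E ->
    (\int[leb]_(y in D) `|f y / c - m / c|%:E <= (1 * e)%:E)%E.
  move=> mD h; under eq_integral do rewrite -mulrBl normrM (ger0_norm ci) mulrC.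
  rewrite intLZ//; last by apply: measurableT_comp => //; exact: measurable_funB.
  apply: (@le_trans _ _ (c^-1%:E * (c * e)%:E)%E); first by rewrite lee_wpmul2l// lee_fin.
  by rewrite -EFinM mulKf ?gt_eqF// mul1r.
split; first by apply: measurable_funM.
- move=> x l lr; have [m hm] := h1 x l lr; by exists (m / c); apply: key => //; exact: measurable_ico.
- move=> x; have := @key (ico x r) 0 r; rewrite mul0r => k.
  have : (\int[leb]_(y in ico x r) `|f y - 0|%:E <= (c * r)%:E)%E.
    by under eq_integral do rewrite subr0; exact: h2.
  move=> /k; under eq_integral do rewrite subr0; apply.
  exact: measurable_itv.
Qed.

End lbmo_of_BMOo.

(** * Odd parts and integrals over the half-line *)

Section odd_part.
Context {R : realType}.
Local Notation leb := (@lebesgue_measure R).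
Local Notation MR := (measurableTypeR R).
Implicit Types (s x y : R) (b : R -> R).

Lemma gk_opp s x y : 0 < s -> gk s x (- y) = gk s (- x) y.
Proof.
move=> s0; rewrite !gkE//; congr (_ * expR _).
by rewrite (_ : - y - x = - (y - - x)) ?mulNr ?sqrrN// opprD !opprK.
Qed.

Definition oddp b y := b y - b (- y).

Lemma measurable_oppT b : measurable_fun [set: R] b -> measurable_fun [set: R] (fun y => b (- y)).
Proof. by move=> mb; apply: (measurableT_comp mb); exact: oppr_measurable. Qed.

Lemma measurable_oddp b : measurable_fun [set: R] b -> measurable_fun [set: R] (oddp b).
Proof. by move=> mb; apply: measurable_funB => //; exact: measurable_oppT. Qed.

Lemma oddp_le b M : (forall y, `|b y| <= M) -> forall y, `|oddp b y| <= 2 * M.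
Proof.
move=> bM y; rewrite (le_trans (ler_normB _ _))// mulr_natl mulr2n.
by rewrite lerD.
Qed.

Lemma gconv_opp s x b M : 0 < s -> measurable_fun [set: R] b -> (forall y, `|b y| <= M) ->
  gconv s (fun y => b (- y)) x = gconv s b (- x).
Proof.
move=> s0 mb bM; rewrite /gconv [RHS]integral_opp//.
- rewrite preimage_setT; apply: eq_Rintegral => y _.
  by rewrite gk_opp// opprK.
- by apply: measurable_funM => //; exact: measurable_gk.
- exact: (integrable_gk_mul (- x) s0 mb bM).
Qed.

Lemma gconv_oddp s x b M : 0 < s -> measurable_fun [set: R] b -> (forall y, `|b y| <= M) ->
  gconv s (oddp b) x = gconv s b x - gconv s b (- x).
Proof.
move=> s0 mb bM.
have mbN : measurable_fun [set: R] (fun y => b (- y)) by exact: measurable_oppT.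
have bNM y : `|b (- y)| <= M by [].
have -> : oddp b = fun y => b y + -1 * b (- y).
  by apply/funext => y; rewrite mulN1r.
rewrite (@gconvD _ s x b (fun y => -1 * b (- y)) M M)//.
- by rewrite (@gconvZ _ s x _ M)// (gconv_opp x s0 mb bM) mulN1r.
- exact: measurable_funM.
- by move=> y; rewrite mulN1r normrN.
Qed.

(** The line is folded at 0: since [oddp] b is odd, the negative half contributes the reflected
    Gaussian with a minus sign. *)
Lemma int_pos_oddp s x b M : 0 < s -> measurable_fun [set: R] b -> (forall y, `|b y| <= M) ->
  \int[leb]_(y in pos) (oddp b y * (gk s x y - gk s x (- y))) = gconv s (oddp b) x.
Proof.
move=> s0 mb bM; have mo := measurable_oddp mb; have oM := oddp_le bM.
pose u y := gk s x y * oddp b y.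
have mu : measurable_fun [set: R] u by apply: measurable_funM => //; exact: measurable_gk.
have ui : leb.-integrable setT (EFin \o u) by exact: (integrable_gk_mul x s0 mo oM).
have mp : measurable (pos : set R) by exact: measurable_pos.
have mpC : measurable (~` pos : set R) by exact: measurableC.
have iS (D : set R) (f : R -> R) : measurable D -> leb.-integrable setT (EFin \o f) ->
    leb.-integrable D (EFin \o f).
  by move=> mD; apply: (@integrableS _ MR R leb setT).
have uNi : leb.-integrable setT (EFin \o (fun y => u (- y))).
  have -> : (fun y => u (- y)) = fun y => - (gk s (- x) y * oddp b y).
    by apply/funext => y; rewrite /u gk_opp// /oddp opprK -mulrN opprB.
  have -> : EFin \o (fun y => - (gk s (- x) y * oddp b y)) =
      (\- (EFin \o (fun y => (gk s (- x) y * oddp b y)%R)))%E by [].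
  apply: (@integrableN _ MR R leb setT).
  exact: (integrable_gk_mul (- x) s0 mo oM).
have e1 : gconv s (oddp b) x = \int[leb]_(y in pos) u y + \int[leb]_(y in ~` pos) u y.
  rewrite /gconv -/u -(setUv pos) Rintegral_setU//; last exact/disj_setPCl.
  by rewrite setUv.
have e2 : \int[leb]_(y in ~` pos) u y = \int[leb]_(y in pos) u (- y).
  rewrite integral_opp//; last exact: iS.
  rewrite /Rintegral; congr fine; rewrite integral_mkcond [RHS]integral_mkcond.
  apply: eq_integral => y _; rewrite !patchE.
  have -> : (y \in -%R @^-1` (~` (pos : set R))) = (0 <= y).
    apply/idP/idP => [/set_mem /= npos|y0].
      by rewrite leNgt; apply/negP => y0; apply: npos; apply/posP; rewrite oppr_gt0.
    by apply/mem_set => /posP; rewrite oppr_gt0 ltNge y0.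
  have -> : (y \in (pos : set R)) = (0 < y).
    by apply/idP/idP => [/set_mem/posP//|y0]; apply/mem_set/posP.
  case: (ltgtP 0 y) => // <-.
  by rewrite /u /oddp !oppr0 subrr mulr0.
rewrite e1 e2 -RintegralD//; [|exact: iS|exact: iS].
apply: eq_Rintegral => y _; rewrite /u /oddp opprK; ring.
Qed.

Lemma int_pos_oddp_norm s x b : 0 < s -> measurable_fun [set: R] b ->
  (\int[leb]_(y in pos) (gk s x y * `|oddp b y|)%:E <=
   \int[leb]_y (gk s x y * `|b y|)%:E + \int[leb]_y (gk s (- x) y * `|b y|)%:E)%E.
Proof.
move=> s0 mb.
have mbN : measurable_fun [set: R] (fun y => b (- y)) by exact: measurable_oppT.
have m1 : measurable_fun [set: R] (fun y => gk s x y * `|b y|).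
  by apply: measurable_funM; [exact: measurable_gk|exact: measurableT_comp].
have m2 : measurable_fun [set: R] (fun y => gk s (- x) y * `|b y|).
  by apply: measurable_funM; [exact: measurable_gk|exact: measurableT_comp].
have m3 : measurable_fun [set: R] (fun y => gk s x y * `|b (- y)|).
  by apply: measurable_funM; [exact: measurable_gk|exact: measurableT_comp].
have m4 : measurable_fun [set: R] (fun y => gk s x y * `|oddp b y|).
  apply: measurable_funM; [exact: measurable_gk|apply: measurableT_comp => //].
  exact: measurable_oddp.
have p z (h : R -> R) y : 0 <= gk s z y * `|h y| by rewrite mulr_ge0 ?gk_ge0.
apply: (@le_trans _ _ (\int[leb]_y (gk s x y * `|oddp b y|)%:E)%E).
  apply: ge0_subset_integral => //; first exact: measurable_pos.
    exact/measurable_EFinP.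
  by move=> y _; rewrite lee_fin p.
apply: (@le_trans _ _ (\int[leb]_y (gk s x y * `|b y| + gk s x y * `|b (- y)|)%:E)%E).
  apply: le_intL => //; first exact: measurable_funD.
  move=> y _; rewrite p/= -mulrDr ler_wpM2l ?gk_ge0//.
  by rewrite /oddp (le_trans (ler_normB _ _)).
have e : (\int[leb]_y (gk s (- x) y * `|b y|)%:E = \int[leb]_y (gk s x y * `|b (- y)|)%:E)%E.
  rewrite (@ge0_integral_opp _ setT (fun y => (gk s (- x) y * `|b y|)%:E))//.
  - by rewrite preimage_setT; apply: eq_integral => y _; rewrite gk_opp// opprK.
  - exact/measurable_EFinP.
  - by move=> y _; rewrite lee_fin p.
rewrite e intLD// => y; exact: (p x (fun y => b (- y)) y).
Qed.

End odd_part.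

Section term_estimate.
Context {R : realType}.
Local Notation leb := (@lebesgue_measure R).
Local Notation MR := (measurableTypeR R).
Variables (lam : R) (s x a B E : R) (b : R -> R).
Hypotheses (lam0 : 0 < lam) (s0 : 0 < s) (x0 : 0 < x) (a0 : 0 <= a)
  (mb : measurable_fun [set: R] b) (bB : forall y, `|b y| <= B).
Let W y := heat_kernel lam (s ^+ 2 / 2) x y.
Let K y := gk s x y - gk s x (- y).
Hypothesis err : (\int[leb]_(y in pos) `|W y - a * K y|%:E <= E%:E)%E.

Let mp : measurable (pos : set R). Proof. exact: measurable_pos. Qed.
Let B0 : 0 <= B. Proof. exact: le_trans (bB 0). Qed.
Let mW : measurable_fun pos W. Proof. exact: measurable_heat_kernel. Qed.
Let mK : measurable_fun [set: R] K.
Proof.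
apply: measurable_funB; first exact: measurable_gk.
by apply: (@measurable_oppT _ (gk s x)); exact: measurable_gk.
Qed.
Let mbp : measurable_fun pos b. Proof. exact: measurable_funTS. Qed.
Let mnb : measurable_fun [set: R] (fun y => `|b y|). Proof. exact: measurableT_comp. Qed.
Let mgb : measurable_fun [set: R] (fun y => gk s x y * `|b y|).
Proof. by apply: measurable_funM => //; exact: measurable_gk. Qed.
Let mD : measurable_fun pos (fun y => W y - a * K y).
Proof. by apply: measurable_funB => //; apply: measurable_funTS; exact: measurable_funM. Qed.
Let mDn : measurable_fun pos (fun y => `|W y - a * K y|). Proof. exact: measurableT_comp. Qed.

Lemma int_abs_heat : (\int[leb]_(y in pos) (`|b y| * W y)%:E <=
  a%:E * \int[leb]_(y in pos) (gk s x y * `|b y|)%:E + (B * E)%:E)%E.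
Proof.
have W0 y : pos y -> 0 <= W y by move=> /posP y0; exact: heat_kernel_ge0.
have gb0 y : 0 <= gk s x y * `|b y| by rewrite mulr_ge0 ?gk_ge0.
apply: (@le_trans _ _ (\int[leb]_(y in pos)
   (a%:E * (gk s x y * `|b y|)%:E + B%:E * `|W y - a * K y|%:E))%E).
  apply: ge0_le_integral => //.
  - by move=> y y0; rewrite lee_fin mulr_ge0// W0.
  - apply/measurable_EFinP; apply: measurable_funM => //.
    exact: measurable_funTS.
  - apply: emeasurable_funD; apply: emeasurable_funM => //; apply/measurable_EFinP => //.
    exact: measurable_funTS.
  move=> y y0; rewrite -!EFinM -EFinD lee_fin.
  apply: (@le_trans _ _ (`|b y| * (a * gk s x y + `|W y - a * K y|))).
    rewrite ler_wpM2l//.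
    have h1 : W y - a * K y <= `|W y - a * K y| by exact: ler_norm.
    have h2 : a * K y <= a * gk s x y.
      by rewrite ler_wpM2l// /K lerBlDr lerDl gk_ge0.
    by rewrite -lerBlDl (le_trans _ h1)// lerD2l lerN2.
  rewrite mulrDr lerD ?ler_wpM2r//.
  by rewrite le_eqVlt; apply/orP; left; apply/eqP; ring.
rewrite ge0_integralD//; first last.
- by apply: emeasurable_funM => //; exact/measurable_EFinP.
- by move=> y _; rewrite -EFinM lee_fin mulr_ge0.
- by apply: emeasurable_funM => //; apply/measurable_EFinP; exact: measurable_funTS.
- by move=> y _; rewrite -EFinM lee_fin mulr_ge0.
rewrite ge0_integralZl//; first last.
- by move=> y _; rewrite lee_fin.
- by apply/measurable_EFinP; exact: measurable_funTS.
rewrite leeD2l// ge0_integralZl//; last exact/measurable_EFinP.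
by rewrite EFinM lee_wpmul2l// lee_fin.
Qed.

Lemma int_heat_dist :
  `|\int[leb]_(y in pos) (b y * W y) - a * \int[leb]_(y in pos) (b y * K y)| <= B * E.
Proof.
have ib : leb.-integrable pos (EFin \o (fun y => b y * K y)).
  have ib1 z : leb.-integrable pos (EFin \o (fun y => gk s z y * b y)).
    by apply: (@integrableS _ MR R leb setT) => //; exact: (integrable_gk_mul z s0 mb bB).
  have -> : EFin \o (fun y => b y * K y) =
     ((EFin \o (fun y => (gk s x y * b y)%R)) \- (EFin \o (fun y => (gk s (- x) y * b y)%R)))%E.
    by apply/funext => y /=; rewrite -EFinB /K gk_opp// mulrBr !(mulrC (b y)).
  exact: (@integrableB _ MR R leb).
have mbD : measurable_fun pos (fun y => b y * (W y - a * K y)) by exact: measurable_funM.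
have ie : (\int[leb]_(y in pos) `|(b y * (W y - a * K y))%:E| <= (B * E)%:E)%E.
  apply: (@le_trans _ _ (\int[leb]_(y in pos) (B%:E * `|W y - a * K y|%:E))%E).
    apply: ge0_le_integral => //.
    - by apply: measurableT_comp => //; exact/measurable_EFinP.
    - by apply: emeasurable_funM => //; exact/measurable_EFinP.
    - by move=> y _; rewrite -EFinM /= lee_fin normrM ler_wpM2r.
  rewrite ge0_integralZl//; last exact/measurable_EFinP.
  by rewrite EFinM lee_wpmul2l// lee_fin.
have ieI : leb.-integrable pos (EFin \o (fun y => b y * (W y - a * K y))).
  apply/integrableP; split; first exact/measurable_EFinP.
  by apply: (le_lt_trans ie); rewrite ltry.
have iaK : leb.-integrable pos (EFin \o (fun y => a * (b y * K y))).
  have -> : EFin \o (fun y => a * (b y * K y)) = (fun y => a%:E * (EFin \o (fun y => (b y * K y)%R)) y)%E by [].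
  exact: (@integrableZl _ MR R leb).
have -> : \int[leb]_(y in pos) (b y * W y) =
    a * \int[leb]_(y in pos) (b y * K y) + \int[leb]_(y in pos) (b y * (W y - a * K y)).
  rewrite -RintegralZl// -RintegralD//; apply: eq_Rintegral => y _; ring.
rewrite addrAC subrr add0r -lee_fin EFin_normr_Rintegral//.
apply: le_trans ie; apply: le_abse_integral => //.
exact/measurable_EFinP.
Qed.

End term_estimate.

(** * The decomposition *)

Section decomposition.
Context {R : realType}.
Local Notation leb := (@lebesgue_measure R).
Local Notation MR := (measurableTypeR R).

Lemma Linfty_norm_le (g : R -> R) (M : R) : 0 <= M -> (forall x, `|g x| <= M) ->
  (Linfty_norm g <= M%:E)%E.
Proof.
move=> M0 gM; rewrite /Linfty_norm unlock /=; case: ifP => // _.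
  by apply/ess_supP; apply: nearW => x /=; rewrite lee_fin.
Qed.

Lemma measurable_heat_int (lam s : R) (c : R -> R) : 0 < lam -> 0 < s ->
  measurable_fun [set: R] c -> (forall y, 0 <= c y) ->
  measurable_fun pos (fun x => \int[leb]_(y in pos)
    ((c y)%:E * (heat_kernel lam (s ^+ 2 / 2) x y)%:E))%E.
Proof.
move=> l0 s0 mc c0.
pose h (p : R * R) := c p.2 * (kappa lam * (gk s p.1 p.2 * bphi lam (p.1 * p.2 / s ^+ 2))).
have mh : measurable_fun [set: R * R] h.
  apply: measurable_funM; first exact: (measurableT_comp mc).
  apply: measurable_funM => //; apply: measurable_funM; first exact: measurable_gk2.
  apply: (measurableT_comp (measurable_bphi l0)).
  apply: measurable_funM => //; apply: measurable_funM.
    exact: measurable_fst.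
  exact: measurable_snd.
have h0 p : 0 <= h p.
  rewrite mulr_ge0// mulr_ge0 ?(ltW (kappa_gt0 l0))// mulr_ge0 ?gk_ge0//.
  rewrite mulr_ge0 ?mulr_ge0 ?powR_ge0 ?expR_ge0//.
  rewrite (le_trans ler01)// bsum_ge1 ?addr_gt0 ?invr_gt0//.
  by rewrite divr_ge0// sqr_ge0.
apply: (eq_measurable_fun (fun x => \int[leb]_(y in pos) (h (x, y))%:E)%E).
  move=> x /set_mem/posP x0; apply: eq_integral => y /set_mem/posP y0.
  by rewrite heat_kernelE// -EFinM.
apply: measurable_funTS; exact: (measurable_int_itv mh h0 measurable_pos).
Qed.

Lemma scale_inj (r : R) : 0 < r -> injective (scale r).
Proof.
move=> r0 j k; rewrite /scale => /(mulfI (lt0r_neq0 r0))/invr_inj.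
by apply: ieexprIn; rewrite ?ltr0n// pnatr_eq1.
Qed.

Lemma sg_inj (r eta : R) : 0 < r -> 0 < eta -> injective (sg r eta).
Proof.
move=> r0 e0 j k; rewrite /sg => /(mulfI (lt0r_neq0 (exprn_gt0 2 e0))).
exact: scale_inj.
Qed.

Definition clip (M u : R) : R := Num.max (- M) (Num.min M u).

Lemma clip_le M u : 0 <= M -> `|clip M u| <= M.
Proof.
move=> M0; rewrite /clip ler_norml le_max lexx/= ge_max ge_min lexx/=.
by rewrite andbT ge0_cp.
Qed.

Lemma clip_id M u : `|u| <= M -> clip M u = u.
Proof.
by rewrite ler_norml => /andP[h1 h2]; rewrite /clip (min_idPr h2) (max_idPr h1).
Qed.

Lemma lte_mulD_pinfty (a : R) (u v : \bar R) : 0 <= a -> (u < +oo)%E -> (v < +oo)%E ->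
  (a%:E * (u + v) < +oo)%E.
Proof.
move=> a0 u1 v1; apply: lte_mul_pinfty; rewrite ?lee_fin//.
exact: lte_add_pinfty.
Qed.

(** In the constant, 20 bounds g0 x - g0 (- x), B1 = 2 * A / a bounds the densities and hence the
    Carleson norm, and C0 * D bounds the heat kernel errors summed over all generations. *)
Lemma decomposition (lam : R) : 0 < lam -> exists2 C, 0 <= C &
  forall (r c : R) (f : R -> R), 0 < r -> 0 < c -> measurable_fun pos f -> lbmo r c (f \_ pos) ->
  exists (g : R -> R) (mu : signed_measure R),
  [/\ measurable_fun pos g, forall x, `|g x| <= C * c, (carleson_norm mu <= (C * c)%:E)%E &
   {ae leb, forall x, 0 < x -> balayage_converges lam mu x /\ f x = g x + balayage lam mu x}].
Proof.
move=> l0; have [eta [A [eta01 A0 HA]]] := @lbmo_heat R.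
have [e0 e1] := andP eta01.
have [a [C0 [a0 C00 herr]]] := int_heat_err l0.
pose al := Num.min lam 1; pose D := (1 - (2^-1 : R) `^ al)^-1.
have D0 : 0 <= D.
  by have := sum_heat_err l0 0 ltr01 ltr01 ltr01; rewrite big_geq.
pose B1 := a^-1 * (2 * A).
have B10 : 0 <= B1 by rewrite mulr_ge0 ?invr_ge0 ?(ltW a0)// mulr_ge0.
have CD0 : 0 <= C0 * D by exact: mulr_ge0.
have S0 : 0 <= 20 + B1 * (C0 * D) by rewrite addr_ge0//; apply: mulr_ge0.
exists (20 + B1 * (C0 * D) + B1); first exact: addr_ge0.
move=> r c f r0 c0 mf fl; set F := f \_ pos in fl *.
have [g0 [be [mg0 g0le mbe beA beae]]] := HA r _ r0 (lbmo_scale c0 fl).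
(* The factor c undoes the normalisation of F by its bound, and 1 / a compensates the constant in
   the heat kernel approximation. *)
pose be' k y := c / a * be k y.
have ca0 : 0 <= c / a by rewrite divr_ge0// ltW.
have mbe' k : measurable_fun [set: R] (be' k) by exact: measurable_funM.
have be'A n y : \sum_(0 <= k < n) `|be' k y| <= c / a * A.
  under eq_bigr do rewrite normrM (ger0_norm ca0).
  by rewrite -mulr_sumr ler_wpM2l.
have be1 k y : `|be k y| <= A by exact: term_le.
have be'1 k y : `|be' k y| <= c / a * A by exact: (term_le be'A).
pose b k := oddp (be' k).
have mb k : measurable_fun [set: R] (b k) by exact: measurable_oddp.
pose B := B1 * c.
have BE : B = c / a * A + c / a * A by rewrite /B /B1; ring.
have B0 : 0 <= B by rewrite mulr_ge0// ltW.
have bB n y : \sum_(0 <= k < n) `|b k y| <= B.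
  apply: (@le_trans _ _ (\sum_(0 <= k < n) (`|be' k y| + `|be' k (- y)|))).
    by apply: ler_sum => k _; exact: ler_normB.
  by rewrite big_split/= BE lerD.
have b1 k y : `|b k y| <= B by exact: (term_le bB).
(* Generation 0 carries no jumps, so term k belongs to generation k + 1. *)
pose s k := sg r eta k.+1.
have s0 k : 0 < s k by exact: sg_gt0.
pose t k := s k ^+ 2 / 2.
have t0 k : 0 < t k by rewrite divr_gt0// exprn_gt0.
have tI : injective t.
  move=> j k /(mulIf (lt0r_neq0 (_ : 0 < 2^-1))) => /(_ ltac:(by rewrite invr_gt0)) /eqP.
  rewrite eqrXn2 ?(ltW (s0 _))// => /eqP/(sg_inj r0 e0).
  by case.
have [mu muE] := layered_signed_measure mb tI t0.
have mpos : measurable (pos : set R) by exact: measurable_pos.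
(* The bounded part is defined from f minus the balayage, so its measurability rests on that of the
   balayage, a difference of series of nonnegative integrals. *)
have mbal : measurable_fun pos (balayage lam mu).
  pose U (d : nat -> R -> R) x := (\sum_(0 <= k <oo)
    \int[leb]_(y in pos) ((posr (d k y))%:E * (heat_kernel lam (t k) x y)%:E))%E.
  have mU d : (forall k, measurable_fun [set: R] (d k)) ->
      measurable_fun pos (fun x => fine (U d x)).
    move=> md; suff mUd : measurable_fun pos (U d).
      by apply: measurableT_comp mUd; exact: fine_measurable.
    apply: ge0_emeasurable_sum => [k x /posP x0 _|k _].
      apply: integral_ge0 => y /posP y0.
      by rewrite -EFinM lee_fin mulr_ge0 ?posr_ge0// heat_kernel_ge0.
    apply: measurable_heat_int => //; first exact: measurable_posr.
    by move=> y; exact: posr_ge0.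
  pose bN k y := - b k y.
  apply: (eq_measurable_fun (fun x => fine (U b x) - fine (U bN x))); last first.
    by apply: measurable_funB; apply: mU => // k; exact: measurableT_comp.
  move=> x /set_mem/posP x0.
  have mh : measurable_fun quadrant (fun p => (balayage_kernel lam x p)%:E).
    by apply/measurable_EFinP; exact: measurable_balayage_kernel.
  have h0 p : quadrant p -> (0 <= (balayage_kernel lam x p)%:E)%E.
    by move=> Qp; rewrite lee_fin balayage_kernel_ge0.
  by have [u1 u2] := muE _ mh h0; rewrite /balayage /Rintegral u1 u2.
pose M := (20 + B1 * (C0 * D)) * c.
have M0 : 0 <= M by apply: mulr_ge0; last exact: ltW.
(* clipping changes f - balayage on a null set only *)
exists (fun x => clip M (f x - balayage lam mu x)), mu; split.
- by apply: measurable_maxr => //; apply: measurable_minr => //; exact: measurable_funB.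
- move=> x; apply: (le_trans (clip_le _ M0)).
  by rewrite /M ler_wpM2r ?(ltW c0)// lerDl.
- apply: (le_trans (carleson_norm_le mb t0 bB muE)).
  by rewrite lee_fin /B ler_wpM2r ?(ltW c0)// lerDr.
have hsae : {ae leb, forall x, (heat_sum r eta be' x < +oo)%E}.
  exact: (heat_sum_ae r0 eta01 mbe' be'A).
have all : {ae leb, forall x, (heat_sum r eta be' x < +oo)%E /\
    \sum_(0 <= k < n) gconv (sg r eta k.+1) (be k) x @[n --> \oo] --> F x / c - g0 x}.
  by apply: (ae_leb_impl2 hsae beae) => x h [_ h'].
(* The odd reflection requires convergence at - x as well as at x. *)
apply: (ae_leb_impl2 all (ae_opp all)) => x [hx cx] [hNx cNx] x0.
pose E k := C0 * ((s k / x) `^ al / (1 + (s k / x) `^ al) ^+ 2).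
have E0 k : 0 <= E k.
  by rewrite mulr_ge0// divr_ge0 ?powR_ge0// exprn_ge0// addr_ge0// powR_ge0.
have sumE n : \sum_(0 <= k < n) E k <= C0 * D.
  rewrite -mulr_sumr ler_wpM2l//.
  exact: (sum_heat_err l0 n r0 e0 x0).
have errk k : (\int[leb]_(y in pos) `|heat_kernel lam (s k ^+ 2 / 2) x y -
    a * (gk (s k) x y - gk (s k) x (- y))|%:E <= (E k)%:E)%E by exact: herr.
have abs_fin : (\sum_(0 <= k <oo) \int[leb]_(y in pos)
    (`|b k y| * heat_kernel lam (t k) x y)%:E < +oo)%E.
  pose H z k := (\int[leb]_y (gk (sg r eta k.+1) z y * `|be' k y|)%:E)%E.
  have H0 z k : (0 <= H z k)%E.
    by apply: integral_ge0 => y _; rewrite lee_fin mulr_ge0 ?gk_ge0.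
  have term k : (\int[leb]_(y in pos) (`|b k y| * heat_kernel lam (t k) x y)%:E <=
      a%:E * (H x k + H (- x)%R k) + (B * E k)%:E)%E.
    have h := int_abs_heat l0 (s0 k) x0 (ltW a0) (mb k) (b1 k) (errk k).
    apply: (le_trans h); rewrite leeD2r// lee_wpmul2l ?lee_fin ?(ltW a0)//.
    exact: (int_pos_oddp_norm x (s0 k) (mbe' k)).
  have HH0 k : (0 <= a%:E * (H x k + H (- x)%R k))%E.
    by rewrite mule_ge0 ?lee_fin ?(ltW a0)// adde_ge0.
  have BE0 k : (0 <= (B * E k)%:E)%E by rewrite lee_fin mulr_ge0.
  apply: (@le_lt_trans _ _ (\sum_(0 <= k <oo) (a%:E * (H x k + H (- x)%R k) + (B * E k)%:E))%E).
    apply: lee_nneseries => k _ => // _.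
    apply: integral_ge0 => y /posP y0.
    by rewrite lee_fin mulr_ge0// heat_kernel_ge0.
  rewrite nneseriesD// nneseriesZl; last by move=> k _; rewrite adde_ge0.
  rewrite nneseriesD// lte_add_pinfty//.
    exact: lte_mulD_pinfty (ltW a0) hx hNx.
  apply: (@le_lt_trans _ _ (B * (C0 * D))%:E); last exact: ltry.
  apply: lime_le; first by apply: is_cvg_nneseries.
  apply: nearW => n; rewrite sumEFin lee_fin -mulr_sumr ler_wpM2l//.
have [conv lim] := balayage_layers mb t0 muE l0 x0 abs_fin; split => //.
have main : `|balayage lam mu x - (f x - c * (g0 x - g0 (- x)))| <= B * (C0 * D).
  pose G z n := \sum_(0 <= k < n) gconv (sg r eta k.+1) (be' k) z.
  have cG z l : \sum_(0 <= k < n) gconv (sg r eta k.+1) (be k) z @[n --> \oo] --> l ->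
      G z n @[n --> \oo] --> c / a * l.
    move=> cl; rewrite (_ : (fun n => _) =
      fun n => c / a * \sum_(0 <= k < n) gconv (sg r eta k.+1) (be k) z).
      by apply: cvgMr.
    apply/funext => n; rewrite /G mulr_sumr; apply: eq_bigr => k _.
    exact: (gconvZ _ _ (s0 k) (mbe k) (be1 k)).
  have dist n : `|\sum_(0 <= k < n) \int[leb]_(y in pos) (b k y * heat_kernel lam (t k) x y)
      - a * (G x n - G (- x) n)| <= B * (C0 * D).
    rewrite /G -sumrB mulr_sumr -sumrB (le_trans (ler_norm_sum _ _ _))//.
    apply: (@le_trans _ _ (\sum_(0 <= k < n) B * E k)); last first.
      by rewrite -mulr_sumr ler_wpM2l.
    apply: ler_sum => k _.
    have := int_heat_dist l0 (s0 k) x0 (mb k) (b1 k) (errk k).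
    by rewrite (int_pos_oddp x (s0 k) (mbe' k) (be'1 k))
      (gconv_oddp x (s0 k) (mbe' k) (be'1 k)).
  have cv : `|\sum_(0 <= k < n) \int[leb]_(y in pos) (b k y * heat_kernel lam (t k) x y)
      - a * (G x n - G (- x) n)| @[n --> \oo] --> `|balayage lam mu x -
      a * (c / a * (F x / c - g0 x) - c / a * (F (- x) / c - g0 (- x)))|.
    apply: cvg_norm; apply: cvgB => //; apply: cvgMr.
    by apply: cvgB; exact: cG.
  have FN : F (- x) = 0 by rewrite /F restrict_neg// oppr_le0 ltW.
  have Fx : F x = f x by exact: restrict_pos.
  rewrite (_ : f x - c * (g0 x - g0 (- x)) =
    a * (c / a * (F x / c - g0 x) - c / a * (F (- x) / c - g0 (- x)))); last first.
    by rewrite FN Fx; field; rewrite !gt_eqF.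
  rewrite -(cvg_lim _ cv)//; apply: limr_le; first exact: cvgP cv.
  exact: nearW.
rewrite clip_id ?subrK//.
rewrite (_ : f x - balayage lam mu x = c * (g0 x - g0 (- x)) -
   (balayage lam mu x - (f x - c * (g0 x - g0 (- x))))); last by ring.
apply: (le_trans (ler_normB _ _)).
rewrite /M mulrDl lerD//; last by rewrite [leRHS]mulrAC.
rewrite normrM (gtr0_norm c0) mulrC ler_wpM2r ?(ltW c0)//.
apply: (le_trans (ler_normB _ _)).
by have := g0le x; have := g0le (- x); lra.
Qed.

End decomposition.

(** * The norm as an infimum of admissible bounds *)

Section bmo_norm.
Context {R : realType}.
Local Notation leb := (@lebesgue_measure R).
Local Notation MR := (measurableTypeR R).

Lemma bmo_bound_le (f : R -> R) (c c' : R) : c <= c' -> bmo_bound f c -> bmo_bound f c'.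
Proof.
by move=> cc' [h1 h2]; split => [I bI|a a0]; apply: le_trans cc'; [exact: h1|exact: h2].
Qed.

Lemma BMOo_norm_ge0 (f : R -> R) : 0 <= BMOo_norm f.
Proof.
have [[c Sc]|Sn] := pselect ([set C | 0 < C /\ bmo_bound f C] !=set0).
  by apply: lb_le_inf; [exists c|move=> d [/ltW]].
rewrite /BMOo_norm (_ : [set C | _] = set0) ?inf0//.
by apply/seteqP; split => // c Sc; apply: Sn; exists c.
Qed.

Lemma bmo_bound_gt_norm (f : R -> R) (c : R) : BMOo f -> BMOo_norm f < c -> bmo_bound f c.
Proof.
move=> [_ [c1 c10 fc1]] cN.
have hinf : has_inf [set C | 0 < C /\ bmo_bound f C].
  by split; [exists c1|exists 0 => d [/ltW]].
have [c2 [_ fc2] c2c] := inf_lt hinf.1 cN.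
by apply: bmo_bound_le fc2; exact: ltW.
Qed.

(** Every positive number is then an admissible bound, so the integral of |f| over (0, r) is
    arbitrarily small. *)
Lemma BMOo_norm0 (f : R -> R) (r : R) : BMOo f -> BMOo_norm f = 0 -> 0 < r ->
  {ae leb, forall x, r <= x -> f x = 0} -> {ae leb, forall x, 0 < x -> f x = 0}.
Proof.
move=> fB N0 r0 f0; have mf := measurable_pos_BMOo fB.
have mI : measurable (`]0, r[%classic : set R) by exact: measurable_itv.
have mfr : measurable_fun (`]0, r[%classic : set R) f.
  apply: measurable_funS mf; first exact: measurable_pos.
  by move=> y /=; rewrite in_itv/= => /andP[y0 _]; exact/posP.
have i0 : (\int[leb]_(y in `]0%R, r[) `|(EFin \o f) y| = 0)%E.
  apply/eqP; rewrite eq_le integral_ge0 ?andbT//.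
  apply/lee_addgt0Pr => e e0; rewrite add0e.
  have fe : bmo_bound f (e / r) by apply: bmo_bound_gt_norm => //; rewrite N0 divr_gt0.
  by have := integral_norm_le fB fe r0; rewrite divfK ?gt_eqF.
have := (ae_eq_integral_abs leb mI (measurableT_comp (@EFin_measurable R setT) mfr)).1 i0.
move=> z; apply: (ae_leb_impl2 f0 z) => x fx fx' x0.
have [rx|xr] := leP r x; first exact: fx.
have xI : `]0, r[%classic x by rewrite /= in_itv/= x0 xr.
by case: (fx' xI).
Qed.

End bmo_norm.

Theorem corollary1p2 (R : realType) (lambda : R) (lambda_gt0 : 0 < lambda) :
  exists2 C : R, 0 < C &
    forall f : R -> R, BMOo f ->
      (exists2 a : R, 0 < a &
         {ae (@lebesgue_measure R), forall x, a < x -> f x = 0}) ->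
      exists (g : R -> R) (mu : signed_measure R),
        [/\ Linfty g,
            carleson_measure mu,
            {ae (@lebesgue_measure R), forall x, 0 < x ->
               balayage_converges lambda mu x /\
               f x = g x + balayage lambda mu x} &
            (Linfty_norm g + carleson_norm mu <= (C * BMOo_norm f)%:E)%E].
Proof.
have [C C0 H] := decomposition lambda_gt0.
(* For N > 0, the number 2 * N exceeds the infimum and is therefore an admissible bound; the norms
   of g and of mu are each at most C * (2 * N), hence 4 * C. The 1 makes the constant positive. *)
exists (4 * C + 1) => [|f fB [a a0 fa]]; first by rewrite ltr_wpDl// mulr_ge0.
have N0 := BMOo_norm_ge0 f; set N := BMOo_norm f in N0 *.
(* Doubling a turns vanishing for a < x into vanishing for r <= x. *)
have a20 : 0 < 2 * a by rewrite mulr_gt0.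
have fa2 : {ae (@lebesgue_measure R), forall x, 2 * a <= x -> f x = 0}.
  by apply: (ae_leb_impl fa) => x fx ax; apply: fx; lra.
(* [decomposition] needs a positive bound c, so a vanishing norm is treated apart *)
have [Npos|] := ltP 0 N; last first.
  move=> Nle; have {N0}Nz : N = 0 by apply/eqP; rewrite eq_le Nle.
  pose b (k : nat) (y : R) : R := 0; pose t (k : nat) : R := k.+1%:R.
  have mb k : measurable_fun [set: R] (b k) by exact: measurable_cst.
  have t0 k : 0 < t k by rewrite ltr0n.
  have tI : injective t by move=> j k /eqP; rewrite eqr_nat => /eqP[].
  have bB n (y : R) : \sum_(0 <= k < n) `|b k y| <= 0 by rewrite big1// => k _; rewrite normr0.
  have [mu muE] := layered_signed_measure mb tI t0.
  have mu0 : (carleson_norm mu <= 0)%E := carleson_norm_le mb t0 bB muE.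
  have g0 : (Linfty_norm (cst 0%R : R -> R) <= 0)%E by apply: Linfty_norm_le => // x; rewrite normr0.
  exists (cst 0), mu; split.
  - by split; [exact: measurable_cst|exact: le_lt_trans g0 _].
  - exact: le_lt_trans mu0 _.
  - apply: (ae_leb_impl (BMOo_norm0 fB Nz a20 fa2)) => x fx x0.
    have abs_fin : (\sum_(0 <= k <oo) \int[@lebesgue_measure R]_(y in pos)
        (`|b k y| * heat_kernel lambda (t k) x y)%:E < +oo)%E.
      rewrite eseries0// => k _ _; apply: integral0_eq => y _.
      by rewrite normr0 mul0r.
    have [conv lim] := balayage_layers mb t0 muE lambda_gt0 x0 abs_fin; split => //.
    rewrite fx// add0r; apply/esym; apply: (cvg_unique _ lim) => //.
    rewrite (_ : (fun n => _) = cst 0); first exact: cvg_cst.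
    apply/funext => n; rewrite big1// => k _.
    by rewrite /Rintegral integral0_eq// => y _; rewrite mul0r.
  - by rewrite Nz mulr0 -[leRHS]adde0; exact: leeD.
have N20 : 0 < 2 * N by rewrite mulr_gt0.
have f2N : bmo_bound f (2 * N) by apply: bmo_bound_gt_norm => //; rewrite -/N; lra.
have [g [mu [mg gC muC fae]]] := H _ _ f a20 N20 (measurable_pos_BMOo fB)
  (lbmo_of_BMOo fB N20 f2N a20 fa2).
have C20 : 0 <= C * (2 * N) by rewrite mulr_ge0// ltW.
have gn := Linfty_norm_le C20 gC.
exists g, mu; split => //.
- by split => //; apply: le_lt_trans gn _; exact: ltry.
- by apply: le_lt_trans muC _; exact: ltry.
- apply: (le_trans (leeD gn muC)); rewrite -EFinD lee_fin.
  have -> : C * (2 * N) + C * (2 * N) = 4 * C * N by ring.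
  by rewrite ler_wpM2r// lerDl.
Qed.
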